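(* Minimum Cost Edge-Connectivity Augmentation to $2$ (defined in the context) can be solved in time $2^{O(p\log p)}\cdot n^{O(1)}$, where $n=|V|$.
   Context: Minimum Cost Edge-Connectivity Augmentation to $2$. Input: an arbitrary (possibly disconnected) undirected multigraph $G=(V,E)$, a cost function $c:\binom{V}{2}\to\mathbb{R}_+\cup\{\infty\}$, and an integer $p\ge 0$. Task: find a set $F\subseteq\binom{V}{2}$ of new edges with $|F|\le p$ such that $(V,E\cup F)$ is 2-edge-connected and $c(F)=\sum_{f\in F}c(f)$ is minimum (each pair of nodes can be used at most once). Here $\binom{V}{2}$ is the edge set of the complete graph on $V$. *)

(* Defs.v *)
From mathcomp Require Import all_boot all_order all_algebra.
From mathcomp Require Import all_classical all_reals all_analysis.

Set Implicit Arguments.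
Unset Strict Implicit.
Unset Printing Implicit Defensive.

Import Order.TTheory GRing.Theory Num.Theory.

Local Open Scope nat_scope.

(* An edge is an element of an abstract finite type, so parallel edges are
   distinct; an edge with a single endpoint is a loop. *)
Record multigraph (V : finType) := Multigraph {
  edge : finType;
  ends : edge -> {set V};
  ends_card : forall e, 0 < #|ends e| <= 2
}.

Definition connected_without (V : finType) (G : multigraph V)
    (X : {set edge G}) : Prop :=
  forall x y : V,
    connect (fun u v => [exists e, (e \notin X) && (ends e == [set u; v])]) x y.

(* A one-node graph is k-edge-connected for every k. *)
Definition edge_connected (k : nat) (V : finType) (G : multigraph V) : Prop :=
  forall X : {set edge G}, #|X| < k -> connected_without X.

Definition pair_of (V : finType) := {e : {set V} | #|e| == 2}.

Section Augment.
Variables (V : finType) (G : multigraph V) (F : {set pair_of V}).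

Definition augment_ends (e : edge G + {f : pair_of V | f \in F}) : {set V} :=
  match e with inl e => ends e | inr f => val (val f) end.

Lemma augment_ends_card e : 0 < #|augment_ends e| <= 2.
Proof. by case: e => [e|f] /=; [exact: ends_card | rewrite (eqP (valP (val f)))]. Qed.

(* Disjoint union: an edge of F may be parallel to an edge of G. *)
Definition augment : multigraph V := Multigraph augment_ends_card.

End Augment.

Section Problem.
Variables (R : realType) (V : finType) (G : multigraph V) (p : nat).
Variable c : pair_of V -> \bar R.

Definition total_cost (F : {set pair_of V}) : \bar R := (\sum_(f in F) c f)%E.

Definition feasible (F : {set pair_of V}) : Prop :=
  #|F| <= p /\ edge_connected 2 (augment G F).

Definition optimal (F : {set pair_of V}) : Prop :=
  feasible F /\
  forall F' : {set pair_of V},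
    feasible F' -> (total_cost F <= total_cost F')%E.

End Problem.

(* Structured programs for a random access machine with two kinds of memory:
   a fixed number of arrays of naturals and a fixed number of arrays of
   extended reals, with indirect addressing (cell [i] of array [a]).  Every
   elementary operation takes one unit of time.  On naturals there is no
   multiplication, so that the unit-cost measure is polynomially related to
   Turing machine time.  Extended reals can only be added and compared; they
   cannot be converted to naturals. *)
Inductive nexp :=
  | NLit (k : nat)
  | NGet (a : nat) (i : nexp)
  | NAdd (e1 e2 : nexp)
  | NSub (e1 e2 : nexp).

Inductive rexp :=
  | RZero
  | RInf
  | RGet (a : nat) (i : nexp)
  | RAdd (e1 e2 : rexp).

Inductive bexp :=
  | NLe (e1 e2 : nexp)
  | RLe (e1 e2 : rexp)
  | BNot (b : bexp)
  | BAnd (b1 b2 : bexp).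

Inductive prog :=
  | Skip
  | NSet (a : nat) (i e : nexp)
  | RSet (a : nat) (i : nexp) (e : rexp)
  | Seq (P Q : prog)
  | If (b : bexp) (P Q : prog)
  | While (b : bexp) (P : prog).

Fixpoint ntime (e : nexp) : nat :=
  match e with
  | NLit _ => 1
  | NGet _ i => (ntime i).+1
  | NAdd e1 e2 | NSub e1 e2 => (ntime e1 + ntime e2).+1
  end.

Fixpoint rtime (e : rexp) : nat :=
  match e with
  | RZero | RInf => 1
  | RGet _ i => (ntime i).+1
  | RAdd e1 e2 => (rtime e1 + rtime e2).+1
  end.

Fixpoint btime (b : bexp) : nat :=
  match b with
  | NLe e1 e2 => (ntime e1 + ntime e2).+1
  | RLe e1 e2 => (rtime e1 + rtime e2).+1
  | BNot b => (btime b).+1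
  | BAnd b1 b2 => (btime b1 + btime b2).+1
  end.

Section Semantics.
Variable R : realType.

Record state := State {
  nmem : nat -> nat -> nat;
  rmem : nat -> nat -> \bar R
}.

Definition upd T (m : nat -> nat -> T) (a i : nat) (v : T) : nat -> nat -> T :=
  fun b j => if (b == a) && (j == i) then v else m b j.

Fixpoint neval (s : state) (e : nexp) : nat :=
  match e with
  | NLit k => k
  | NGet a i => nmem s a (neval s i)
  | NAdd e1 e2 => neval s e1 + neval s e2
  | NSub e1 e2 => neval s e1 - neval s e2
  end.

Fixpoint reval (s : state) (e : rexp) : \bar R :=
  match e with
  | RZero => 0%E
  | RInf => +oo%E
  | RGet a i => rmem s a (neval s i)
  | RAdd e1 e2 => (reval s e1 + reval s e2)%E
  end.

Fixpoint beval (s : state) (b : bexp) : bool :=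
  match b with
  | NLe e1 e2 => neval s e1 <= neval s e2
  | RLe e1 e2 => (reval s e1 <= reval s e2)%E
  | BNot b => ~~ beval s b
  | BAnd b1 b2 => beval s b1 && beval s b2
  end.

(* [runs P s t s']: started in [s], [P] halts in [s'] after exactly [t] time
   units.  A diverging program has no such [t] and [s']. *)
Inductive runs : prog -> state -> nat -> state -> Prop :=
  | runs_Skip s : runs Skip s 1 s
  | runs_NSet a i e s :
      runs (NSet a i e) s (ntime i + ntime e).+1
        (State (upd (nmem s) a (neval s i) (neval s e)) (rmem s))
  | runs_RSet a i e s :
      runs (RSet a i e) s (ntime i + rtime e).+1
        (State (nmem s) (upd (rmem s) a (neval s i) (reval s e)))
  | runs_Seq P Q s t1 s1 t2 s2 :
      runs P s t1 s1 -> runs Q s1 t2 s2 -> runs (Seq P Q) s (t1 + t2).+1 s2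
  | runs_IfT b P Q s t s' :
      beval s b -> runs P s t s' -> runs (If b P Q) s (btime b + t).+1 s'
  | runs_IfF b P Q s t s' :
      ~~ beval s b -> runs Q s t s' -> runs (If b P Q) s (btime b + t).+1 s'
  | runs_WhileF b P s :
      ~~ beval s b -> runs (While b P) s (btime b).+1 s
  | runs_WhileT b P s t1 s1 t2 s2 :
      beval s b -> runs P s t1 s1 -> runs (While b P) s1 t2 s2 ->
      runs (While b P) s (btime b + t1 + t2).+1 s2.

End Semantics.

(* Row-major layout: entry (i, j) is stored in cell i * n + j; the other cells
   hold [z]. *)
Definition flat (n : nat) (T : Type) (z : T) (M : 'I_n -> 'I_n -> T)
    (k : nat) : T :=
  match insub (k %/ n), insub (k %% n) with
  | Some i, Some j => M i j
  | _, _ => z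
  end.

Section Encoding.
Variables (R : realType) (n : nat) (G : multigraph 'I_n) (p : nat).
Variable c : pair_of 'I_n -> \bar R.

Definition multiplicity (i j : 'I_n) : nat :=
  #|[set e : edge G | ends e == [set i; j]]|.

Definition cost_matrix (i j : 'I_n) : \bar R :=
  if insub [set i; j] is Some f then c f else 0%E.

(* Natural array 0 holds n and p, natural array 1 the multiplicity matrix of G
   and real array 0 the cost matrix; every other cell is zero. *)
Definition input : state R := State
  (fun a k => match a, k with
              | 0, 0 => n
              | 0, 1 => p
              | 1, _ => flat 0 multiplicity k
              | _, _ => 0
              end)
  (fun a k => if a is 0 then flat 0%E cost_matrix k else 0%E).

(* Cell 0 of natural array 2 tells whether the instance is feasible; if so,
   natural array 3 holds the adjacency matrix of an optimal solution. *)
Definition correct_output (s : state R) : Prop :=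
  ((exists F, feasible G p F) ->
     nmem s 2 0 = 1 /\
     exists2 F, optimal G p c F &
       forall i j : 'I_n,
         nmem s 3 (i * n + j) = [exists f in F, val f == [set i; j]]) /\
  (~ (exists F, feasible G p F) -> nmem s 2 0 = 0).

End Encoding.

Definition log2 (R : realType) (x : R) : R := (ln x / ln 2)%R.

(* Main.v *)
(* Call a vertex set tight if at most one edge of G leaves it; a set F of links is a
   solution iff at least 2 - d links of F leave every proper nonempty set that is left by
   d <= 1 edges of G.  Replace the links by virtual links (x, a, W): disjoint subsets W of
   F such that every tight set separating x from a is crossed by W, and such that G with
   all the edges (x, a) is 2-edge-connected.  Moving the ends of the virtual links along G, and merging them,
   until no such step is possible leaves a virtual link whose ends may be moved freely in
   their tokens, where the token of a vertex is its component if its 2-edge-connected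
   block has two leaving edges, and the block itself otherwise.  In the latter case the
   block is the median of three leaf blocks (all equal, if it is a leaf).  Hence W may
   be replaced by any links forming a chain from one token to the other, in particular
   by a cheapest chain of the same length, which is found by dynamic programming.

   If p links suffice, there are at most 2p leaf blocks, so ten numbers at most 2p name
   both tokens, the length of the chain and the position in the chain of one link to
   commit.  After p such steps the optimum is reached.  All the (2p+1)^(10p)
   = 2^O(p log p) digit sequences are tried, each in polynomial time. *)

(* The obstacle is that a cheapest chain has to be found without knowing the other links of the
   optimum. Three points make this harmless. Tokens depend only on the current graph, so they can be
   guessed. An end of a virtual link is free as soon as no [bad] cut exists: a cut of size exactly
   two, virtual links included, that separates the two ends and splits a component. Uncrossing such
   cuts shows that they cannot block all virtual links between components at once. Finally, the
   chain found may share a link with the rest of the optimum; that link is then safe to commit by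
   itself, which is why a step commits one link and not the whole chain. The ten digits are three
   leaves and a flag for either token, a length and a position. The length has to be guessed because
   the budget counts links, and the cheapest chain of any length might be too long. No guess needs
   to be recognised as right: every outcome is tested for feasibility and compared by cost, so wrong
   digits do no harm and a single good sequence is enough. *)
From mathcomp Require Import all_boot zify.

Set Implicit Arguments.
Unset Strict Implicit.
Unset Printing Implicit Defensive.

(** * Cuts, blocks and leaves *)

Section Cuts.
Variable V : finType.
Implicit Types (E T : seq (V * V)) (X Y : {set V}) (e : V * V).

(* [cr X e]: the edge [e] crosses the cut [X]; [bdry E X]: number of edges of [E] crossing
   [X]; [tec]: 2-edge-connected; [cov E e' e]: adding [e] covers all bridges and missing
   connections between the ends of [e'], so that [blk E u], where [e] is a loop, is the
   2-edge-connected block of [u]; [med]: median in the forest of blocks. *)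
Definition cr X e : bool := (e.1 \in X) (+) (e.2 \in X).
Definition bdry E X : nat := \sum_(e <- E) cr X e.
Definition tec E : bool :=
  [forall X : {set V}, (X != set0) && (X != setT) ==> (1 < bdry E X)].
Definition conn E u v : bool :=
  [forall X : {set V}, cr X (u, v) ==> (0 < bdry E X)].
Definition cov E (e' e : V * V) : bool :=
  [forall X : {set V}, cr X e' && (bdry E X <= 1) ==> cr X e].
Definition blk E u : {set V} := [set v | cov E (u, v) (u, u)].
Definition comp E u : {set V} := [set v | conn E u v].
Definition med E a b c : {set V} :=
  [set m | [&& cov E (a, m) (a, b), cov E (b, m) (b, c) & cov E (c, m) (c, a)]].

Lemma cr_sym X u v : cr X (u, v) = cr X (v, u).
Proof. by rewrite /cr addbC. Qed.

Lemma crxx X u : cr X (u, u) = false.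
Proof. by rewrite /cr addbb. Qed.

Lemma crC X e : cr (~: X) e = cr X e.
Proof. by rewrite /cr !inE; case: (_ \in X); case: (_ \in X). Qed.

Lemma bdryC E X : bdry E (~: X) = bdry E X.
Proof. by rewrite /bdry; apply: eq_bigr => e _; rewrite crC. Qed.

Lemma cr_side X u v : cr X (u, v) ->
  exists Y, [/\ u \in Y, v \notin Y, (forall e, cr Y e = cr X e) &
                forall E, bdry E Y = bdry E X].
Proof.
move=> cX; have := cX; rewrite /cr /=; case uX: (u \in X) => /= vX.
  by exists X; split; rewrite ?uX.
exists (~: X); split; rewrite ?inE ?uX ?negbK //.
- exact: crC.
- by move=> E; rewrite bdryC.
Qed.

Lemma bdryE E X : bdry E X = count (cr X) E.
Proof. by rewrite /bdry -sum1_count [RHS]big_mkcond; apply: eq_bigr => e _; case: cr. Qed.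

Lemma bdry_cat E T X : bdry (E ++ T) X = bdry E X + bdry T X.
Proof. by rewrite /bdry big_cat. Qed.

Lemma bdry_cons e E X : bdry (e :: E) X = cr X e + bdry E X.
Proof. by rewrite /bdry big_cons. Qed.

Lemma bdry_perm E T X : perm_eq E T -> bdry E X = bdry T X.
Proof. exact: perm_big. Qed.

Lemma bdry_gt0P E X : reflect (exists2 e, e \in E & cr X e) (0 < bdry E X).
Proof. by rewrite bdryE -has_count; exact: hasP. Qed.

Lemma tecP E : reflect (forall X, X != set0 -> X != setT -> 1 < bdry E X) (tec E).
Proof.
apply: (iffP forallP) => [h X X0 XT|h X]; first by have := h X; rewrite X0 XT.
by apply/implyP => /andP [X0 XT]; apply: h.
Qed.

Lemma tec_cr E X e : tec E -> cr X e -> 1 < bdry E X.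
Proof.
move=> /tecP h cX; apply: h; apply/eqP => X0; move: cX; rewrite X0 /cr !inE //.
Qed.

Lemma tec_in E X u v : tec E -> u \in X -> v \notin X -> 1 < bdry E X.
Proof. by move=> /tec_cr h uX vX; apply: (h _ (u, v)); rewrite /cr /= uX (negbTE vX). Qed.

Lemma covP E e' e :
  reflect (forall X, cr X e' -> bdry E X <= 1 -> cr X e) (cov E e' e).
Proof.
apply: (iffP forallP) => [h X c1 c2|h X]; first by have := h X; rewrite c1 c2.
by apply/implyP => /andP [c1 c2]; apply: h.
Qed.

Lemma connP E u v : reflect (forall X, cr X (u, v) -> 0 < bdry E X) (conn E u v).
Proof.
by apply: (iffP forallP) => h X; [move=> c; have := h X; rewrite c|apply/implyP/h].
Qed.

Lemma conn_refl E u : conn E u u.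
Proof. by apply/connP => X; rewrite crxx. Qed.

Lemma conn_sym E u v : conn E u v = conn E v u.
Proof. by apply: eq_forallb => X; rewrite cr_sym. Qed.

Lemma cr_trans X u v w : cr X (u, w) -> cr X (u, v) || cr X (v, w).
Proof. by rewrite /cr /=; do 3 case: (_ \in X). Qed.

Lemma conn_trans E v u w : conn E u v -> conn E v w -> conn E u w.
Proof.
move=> /connP h1 /connP h2; apply/connP => X /(cr_trans v) /orP [/h1|/h2] //.
Qed.

Lemma blkP E u v :
  reflect (forall X, cr X (u, v) -> 1 < bdry E X) (v \in blk E u).
Proof.
rewrite inE; apply: (iffP (covP _ _ _)) => h X c.
  by rewrite ltnNge; apply/negP => /(h X c); rewrite crxx.
by rewrite leqNgt h.
Qed.

Lemma blk_refl E u : u \in blk E u.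
Proof. by apply/blkP => X; rewrite crxx. Qed.

Lemma blk_sym E u v : (u \in blk E v) = (v \in blk E u).
Proof. by apply/blkP/blkP => h X; rewrite cr_sym; apply: h. Qed.

Lemma blk_trans E v u w : v \in blk E u -> w \in blk E v -> w \in blk E u.
Proof.
move=> /blkP h1 /blkP h2; apply/blkP => X /(cr_trans v) /orP [/h1|/h2] //.
Qed.

Lemma blk_eq E u v : v \in blk E u -> blk E v = blk E u.
Proof.
move=> vu; apply/setP => w; apply/idP/idP; first exact: blk_trans.
by apply: blk_trans; rewrite blk_sym.
Qed.

Lemma blk_conn E u v : v \in blk E u -> conn E u v.
Proof. by move=> /blkP h; apply/connP => X /h /ltnW. Qed.

Lemma blk_side E X u v : bdry E X <= 1 -> v \in blk E u -> (v \in X) = (u \in X).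
Proof.
move=> c1 /blkP h; apply/eqP/negPn/negP => ne.
have /h : cr X (u, v) by rewrite /cr /= -negb_eqb eq_sym.
by rewrite ltnNge c1.
Qed.

Lemma blk_sub E X u : bdry E X <= 1 -> u \in X -> blk E u \subset X.
Proof. by move=> c1 uX; apply/subsetP => v /(blk_side c1) ->. Qed.

Lemma blk_dis E X u v : bdry E X <= 1 -> u \notin X -> v \in blk E u -> v \notin X.
Proof. by move=> c1 uX /(blk_side c1) ->. Qed.

Lemma notin_blk E u v : v \notin blk E u ->
  exists X, [/\ v \in X, u \notin X & bdry E X <= 1].
Proof.
rewrite inE negb_forall => /existsP [X].
rewrite negb_imply => /andP [/andP [c c1] _].
move: c; rewrite cr_sym => /cr_side [Y [vY uY _ cE]].
by exists Y; rewrite cE.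
Qed.

Lemma bdry_comp E u : bdry E (comp E u) = 0.
Proof.
apply/eqP; rewrite -leqn0 leqNgt; apply/negP => /bdry_gt0P [[x y] eE].
have cxy : conn E x y.
  by apply/connP => X c; apply/bdry_gt0P; exists (x, y).
rewrite /cr /= !inE; case ux: (conn E u x).
  by rewrite (conn_trans ux cxy).
case uy: (conn E u y) => //.
by move: ux; rewrite (conn_trans uy) // conn_sym.
Qed.

Lemma comp_refl E u : u \in comp E u.
Proof. by rewrite inE conn_refl. Qed.

Lemma bdry0_side E X u v : bdry E X = 0 -> conn E u v -> (v \in X) = (u \in X).
Proof.
move=> c0 /connP h; apply/eqP/negPn/negP => ne.
have /h : cr X (u, v) by rewrite /cr /= -negb_eqb eq_sym.
by rewrite c0.
Qed.

Lemma conn_cut E X u v : conn E u v -> u \in X -> v \notin X -> 0 < bdry E X.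
Proof. by move=> /connP h uX vX; apply: h; rewrite /cr /= uX (negbTE vX). Qed.

Lemma cov_sym E e u v : cov E (u, v) e = cov E (v, u) e.
Proof. by apply: eq_forallb => X; rewrite cr_sym. Qed.

Lemma cov_trans E e2 e1 e3 : cov E e1 e2 -> cov E e2 e3 -> cov E e1 e3.
Proof. by move=> /covP h1 /covP h2; apply/covP => X c c1; apply: h2 => //; apply: h1. Qed.

Lemma sum_le E (f g : V * V -> nat) :
  (forall x y, f (x, y) <= g (x, y)) -> \sum_(e <- E) f e <= \sum_(e <- E) g e.
Proof. by move=> h; apply: leq_sum => -[x y] _. Qed.

Lemma bdry_submod E X Y : bdry E (X :&: Y) + bdry E (X :|: Y) <= bdry E X + bdry E Y.
Proof.
rewrite /bdry -!big_split; apply: sum_le => x y; rewrite /cr /= !inE.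
by do 4 case: (_ \in _).
Qed.

(** An edge counted twice on the left joins the two parts of [X], hence crosses [Y]. If [X] and [Y]
    are tight, the right side is at most 3, so one part of [X] is tight again; this is how minimal
    tight sets are cut. *)
Lemma bdry_split E X Y : bdry E (X :&: Y) + bdry E (X :\: Y) <= bdry E X + 2 * bdry E Y.
Proof.
rewrite /bdry big_distrr -!big_split; apply: sum_le => x y; rewrite /cr /= !inE.
by do 4 case: (_ \in _).
Qed.

Lemma min_set (P : {set V} -> bool) X0 : P X0 ->
  exists X, [/\ P X, X \subset X0 & forall Y, P Y -> Y \subset X -> Y = X].
Proof.
move=> pX0; pose Q X := P X && (X \subset X0).
have qX0 : Q X0 by rewrite /Q pX0 subxx.
case: (arg_minnP (fun X : {set V} => #|X|) qX0) => X /andP [pX sX] mX.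
exists X; split => // Y pY sub; apply/eqP; rewrite eqEcard sub /=; apply: mX.
by rewrite /Q pY (subset_trans sub).
Qed.

(** A component consisting of a single block, with no leaving edge, is a leaf too. *)
Definition leaf E l := bdry E (blk E l) <= 1.

(** A minimal nonempty tight set is a single block: a tight [Z] cutting it would leave one of the
    two parts tight, by [bdry_split]. *)
Lemma leaf_exists E X : X != set0 -> bdry E X <= 1 ->
  exists2 l, leaf E l & blk E l \subset X.
Proof.
move=> X0 c1; have := @min_set (fun X => (X != set0) && (bdry E X <= 1)) X.
rewrite X0 c1 => /(_ isT) [Y [/andP [/set0Pn [l lY] cY] sYX mY]].
suff Yl : Y = blk E l by exists l; rewrite /leaf -Yl.
apply/eqP; rewrite eqEsubset (blk_sub cY lY) andbT.
apply/subsetP => m mY'; case: (boolP (m \in blk E l)) => // /notin_blk [Z [mZ lZ cZ]].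
have := bdry_split E Y Z => spl.
have /orP [cI|cD] : (bdry E (Y :&: Z) <= 1) || (bdry E (Y :\: Z) <= 1).
- rewrite leqNgt [X in _ || X]leqNgt -negb_and; apply/negP => /andP [a b].
  have := leq_add a b; rewrite leqNgt ltnS (leq_trans spl) //.
  by rewrite -[3]/(1 + 2 * 1) leq_add // leq_mul2l.
- have YZ : Y :&: Z = Y.
    by apply: mY (subsetIl _ _); rewrite cI andbT; apply/set0Pn; exists m; rewrite inE mY' mZ.
  by have := lY; rewrite -YZ inE (negbTE lZ) andbF.
- have YZ : Y :\: Z = Y.
    by apply: mY (subsetDl _ _); rewrite cD andbT; apply/set0Pn; exists l; rewrite inE lY lZ.
  by have := mY'; rewrite -YZ inE mZ.
Qed.

Lemma sum_le_in E (f g : V * V -> nat) :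
  (forall x y, (x, y) \in E -> f (x, y) <= g (x, y)) ->
  \sum_(e <- E) f e <= \sum_(e <- E) g e.
Proof. by move=> h; rewrite big_seq [leqRHS]big_seq; apply: leq_sum => -[x y]; exact: h. Qed.

(** * Far sides of a block and medians of leaf blocks *)

Lemma bdryI E X Y : bdry E (X :&: Y) <= bdry E X + bdry E Y.
Proof. exact: leq_trans (leq_addr _ _) (bdry_submod E X Y). Qed.

Lemma bdryU E X Y : bdry E (X :|: Y) <= bdry E X + bdry E Y.
Proof. exact: leq_trans (leq_addl _ _) (bdry_submod E X Y). Qed.

Lemma edge_conn E x y : (x, y) \in E -> conn E x y.
Proof. by move=> e; apply/connP => X c; apply/bdry_gt0P; exists (x, y). Qed.

Lemma bdry_pick E X : 0 < bdry E X ->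
  exists e E', perm_eq E (e :: E') /\ cr X e.
Proof.
move=> /bdry_gt0P [e eE c]; exists e, (rem e E); split => //.
exact: perm_to_rem.
Qed.

(** A tight set that separates the far end from the block is cut down to the component; the given
    edge is then the only one that leaves it. *)
Lemma far_side E u x y (B := blk E u) : (x, y) \in E -> x \in B -> y \notin B ->
  exists X, [/\ y \in X, [disjoint B & X], X \subset comp E u & bdry E X = 1].
Proof.
move=> eE xB yB; have Bx : blk E x = B by apply: blk_eq.
have [X [yX xX cX]] : exists X, [/\ y \in X, x \notin X & bdry E X <= 1].
  by apply: notin_blk; rewrite Bx.
have ux : conn E u x by apply: blk_conn.
have uy := conn_trans ux (edge_conn eE).
have yX' : y \in X :&: comp E u by rewrite inE yX inE.
exists (X :&: comp E u); split => //.
- rewrite disjoint_sym; apply/pred0P => z /=; apply/negP; rewrite !inE => /andP [/andP [zX _] zB].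
  by have := blk_dis cX xX; rewrite Bx => /(_ z); rewrite inE zB zX => /(_ isT).
- exact: subsetIr.
- apply/eqP; rewrite eqn_leq (leq_trans (bdryI _ _ _)) ?bdry_comp ?addn0 //=.
  by apply/bdry_gt0P; exists (x, y) => //; rewrite /cr yX' /= inE (negbTE xX).
Qed.

Lemma far_side_cr E u e (B := blk E u) : e \in E -> cr B e ->
  exists X, [/\ cr X e, [disjoint B & X], X \subset comp E u & bdry E X = 1].
Proof.
case: e => x y eE; rewrite /cr /=; case xB: (x \in B) => /= yB.
  have [X [yX dX sX cX]] := far_side eE xB yB; exists X; split => //.
  by rewrite yX (disjointFr dX xB).
(* The other orientation follows by reversing all edges, which changes no boundary. *)
have eE' : (y, x) \in map (fun e => (e.2, e.1)) E by apply/mapP; exists (x, y).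
have swap Z : bdry (map (fun e => (e.2, e.1)) E) Z = bdry E Z.
  by rewrite /bdry big_map; apply: eq_bigr => e _; rewrite /cr addbC.
have sB v : blk (map (fun e => (e.2, e.1)) E) v = blk E v.
  by apply/setP => w; rewrite !inE; apply: eq_forallb => Z; rewrite swap.
have [||X [xX dX sX]] := @far_side _ u _ _ eE'; rewrite ?sB ?xB // swap => cX.
rewrite sB -/B in dX.
exists X; split => //; first by rewrite xX (disjointFr dX yB).
apply: subset_trans sX _; apply/subsetP => v; rewrite !inE => /connP h.
by apply/connP => Z /h; rewrite swap.
Qed.

Lemma disjN X Y x : [disjoint X & Y] -> ~~ ((x \in X) && (x \in Y)).
Proof. by move=> d; case xX: (x \in X); rewrite // (disjointFr d xX). Qed.

(** An edge leaving the intersection crosses [X1] or [X2], so it ends in the block and crosses both,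
    which is excluded. The intersection thus has empty boundary, although its vertices are connected
    to [u] outside. *)
Lemma disjoint_far E u X1 X2 (B := blk E u) :
  [disjoint B & X1] -> [disjoint B & X2] -> X1 \subset comp E u ->
  (forall e, e \in E -> cr X1 e -> cr B e) -> (forall e, e \in E -> cr X2 e -> cr B e) ->
  (forall e, e \in E -> ~~ (cr X1 e && cr X2 e)) ->
  [disjoint X1 & X2].
Proof.
move=> d1 d2 s1 a1 a2 a12; have c0 : bdry E (X1 :&: X2) = 0.
  apply/eqP; rewrite -leqn0 leqNgt; apply/negP => /bdry_gt0P [[x y] eE].
  have /implyP := a1 _ eE; have /implyP := a2 _ eE; have := a12 _ eE.
  have := disjN x d1; have := disjN y d1; have := disjN x d2; have := disjN y d2.
  rewrite /cr /= !in_setI.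
  by case: (x \in X1); case: (y \in X1); case: (x \in X2); case: (y \in X2) => //=;
    case: (x \in B); case: (y \in B) => //=.
rewrite disjoint_subset; apply/subsetP => z z1; rewrite inE; apply/negP => z2.
have uz : conn E u z by have := subsetP s1 _ z1; rewrite inE.
have := bdry0_side c0 uz; rewrite !inE z1 z2 (disjointFr d1 (blk_refl E u)).
by [].
Qed.

(** The parts of [Y] in [X1] and in [X2] are both left by an edge, their vertices being connected to
    [u]. These are two different edges, and both leave [Y] because [Y] avoids the block, where every
    edge leaving [X1] or [X2] ends. *)
Lemma far_pair E u X1 X2 Y l1 l2 (B := blk E u) :
  [disjoint B & X1] -> [disjoint B & X2] -> X1 \subset comp E u -> X2 \subset comp E u ->
  (forall e, e \in E -> cr X1 e -> cr B e) -> (forall e, e \in E -> cr X2 e -> cr B e) ->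
  [disjoint X1 & X2] -> l1 \in X1 -> l2 \in X2 -> [disjoint B & Y] -> bdry E Y <= 1 ->
  l1 \in Y -> l2 \in Y -> False.
Proof.
move=> d1 d2 s1 s2 a1 a2 d12 l1X l2X dY cY l1Y l2Y.
have uY : u \notin Y by rewrite (disjointFr dY (blk_refl E u)).
have pos X l : X \subset comp E u -> l \in X -> l \in Y -> 0 < bdry E (Y :&: X).
  move=> sX lX lY; have ul : conn E l u.
    by rewrite conn_sym; have := subsetP sX _ lX; rewrite inE.
  by apply: (conn_cut ul); rewrite inE ?lY ?lX // (negbTE uY).
have := leq_add (pos _ _ s1 l1X l1Y) (pos _ _ s2 l2X l2Y).
suff : bdry E (Y :&: X1) + bdry E (Y :&: X2) <= bdry E Y.
  by move=> h1 /leq_trans/(_ h1)/leq_trans/(_ cY).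
rewrite /bdry -big_split; apply: sum_le_in => x y eE.
have /implyP := a1 _ eE; have /implyP := a2 _ eE.
have := disjN x d12; have := disjN y d12; have := disjN x dY; have := disjN y dY.
rewrite /cr /= !in_setI.
by case: (x \in X1); case: (y \in X1); case: (x \in X2); case: (y \in X2);
  case: (x \in Y); case: (y \in Y) => //=; case: (x \in B); case: (y \in B) => //=.
Qed.

Lemma perm3 E X : 2 < bdry E X ->
  exists g1 g2 g3 E', perm_eq E [:: g1, g2, g3 & E'] /\ [/\ cr X g1, cr X g2 & cr X g3].
Proof.
move=> c; have [g1 [E1 [p1 c1]]] := bdry_pick (ltnW (ltnW c)).
move: c; rewrite (bdry_perm _ p1) bdry_cons c1 add1n ltnS => c.
have [g2 [E2 [p2 c2]]] := bdry_pick (ltnW c).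
move: c; rewrite (bdry_perm _ p2) bdry_cons c2 add1n ltnS => c.
have [g3 [E3 [p3 c3]]] := bdry_pick c.
exists g1, g2, g3, E3; split => //; apply: perm_trans p1 _; rewrite perm_cons.
by apply: perm_trans p2 _; rewrite perm_cons.
Qed.

Lemma bdry1_others E E' X e : perm_eq E (e :: E') -> bdry E X = 1 -> cr X e ->
  forall g, g \in E' -> cr X g = false.
Proof.
move=> p; rewrite (bdry_perm _ p) bdry_cons => c ce; move: c; rewrite ce add1n => -[c] g gE.
apply/negP => cg; have : 0 < bdry E' X by apply/bdry_gt0P; exists g.
by rewrite c.
Qed.

(** Three leaving edges have disjoint far sides, and one leaf is chosen in each. By [far_pair] a
    tight set that avoids the block contains at most one of these leaves. *)
Lemma branch_med E u : 2 < bdry E (blk E u) ->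
  exists l1 l2 l3, [/\ leaf E l1, leaf E l2, leaf E l3 & med E l1 l2 l3 = blk E u].
Proof.
move=> /perm3 [g1 [g2 [g3 [E' [pE [c1 c2 c3]]]]]].
set B := blk E u in c1 c2 c3 *.
have gE g : g \in [:: g1, g2, g3 & E'] -> g \in E by rewrite (perm_mem pE).
have p2 : perm_eq E [:: g2, g1, g3 & E'].
  exact: perm_trans pE (permEl (perm_catCA [:: g1] [:: g2] (g3 :: E'))).
have p3 : perm_eq E [:: g3, g1, g2 & E'].
  exact: perm_trans pE (permEl (perm_catCA [:: g1; g2] [:: g3] E')).
have [X1 [x1 d1 s1 t1]] := far_side_cr (gE g1 (mem_head _ _)) c1.
have [X2 [x2 d2 s2 t2]] : exists X, [/\ cr X g2, [disjoint B & X], X \subset comp E u & bdry E X = 1].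
  by apply: far_side_cr => //; apply: gE; rewrite !inE eqxx orbT.
have [X3 [x3 d3 s3 t3]] : exists X, [/\ cr X g3, [disjoint B & X], X \subset comp E u & bdry E X = 1].
  by apply: far_side_cr => //; apply: gE; rewrite !inE eqxx !orbT.
have o1 := bdry1_others pE t1 x1.
have o2 := bdry1_others p2 t2 x2.
have o3 := bdry1_others p3 t3 x3.
have A1 e : e \in E -> cr X1 e -> cr B e.
  by rewrite (perm_mem pE) inE => /orP [/eqP -> //|/o1 ->].
have A2 e : e \in E -> cr X2 e -> cr B e.
  by rewrite (perm_mem p2) inE => /orP [/eqP -> //|/o2 ->].
have A3 e : e \in E -> cr X3 e -> cr B e.
  by rewrite (perm_mem p3) inE => /orP [/eqP -> //|/o3 ->].
have A12 e : e \in E -> ~~ (cr X1 e && cr X2 e).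
  by rewrite (perm_mem pE) inE => /orP [/eqP ->|/o1 -> //]; rewrite o2 ?andbF // mem_head.
have A13 e : e \in E -> ~~ (cr X1 e && cr X3 e).
  by rewrite (perm_mem pE) inE => /orP [/eqP ->|/o1 -> //]; rewrite o3 ?andbF // mem_head.
have A23 e : e \in E -> ~~ (cr X2 e && cr X3 e).
  by rewrite (perm_mem p2) inE => /orP [/eqP ->|/o2 -> //]; rewrite o3 ?andbF // !inE eqxx orbT.
have D12 := disjoint_far d1 d2 s1 A1 A2 A12.
have D13 := disjoint_far d1 d3 s1 A1 A3 A13.
have D23 := disjoint_far d2 d3 s2 A2 A3 A23.
have lf X e : cr X e -> bdry E X = 1 -> exists2 l, leaf E l & l \in X.
  move=> cX c; have [|l ll sl] := @leaf_exists E X _ (eq_leq c).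
    by apply/eqP => X0; move: cX; rewrite X0 /cr !inE.
  by exists l => //; apply: (subsetP sl); exact: blk_refl.
have [l1 ll1 l1X] := lf _ _ x1 t1.
have [l2 ll2 l2X] := lf _ _ x2 t2.
have [l3 ll3 l3X] := lf _ _ x3 t3.
have P12 Y := far_pair (Y := Y) d1 d2 s1 s2 A1 A2 D12 l1X l2X.
have P13 Y := far_pair (Y := Y) d1 d3 s1 s3 A1 A3 D13 l1X l3X.
have P23 Y := far_pair (Y := Y) d2 d3 s2 s3 A2 A3 D23 l2X l3X.
exists l1, l2, l3; split => //; apply/setP => m.
have disB Y v : v \in B -> v \notin Y -> bdry E Y <= 1 -> [disjoint B & Y].
  move=> vB vY cY; rewrite disjoint_subset; apply/subsetP => z zB; rewrite inE; apply/negP => zY.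
  have : z \notin Y by apply: (blk_dis cY vY); rewrite (blk_eq vB).
  by rewrite zY.
apply/idP/idP => [|mB].
- rewrite inE => /and3P [/covP h12 /covP h23 /covP h31].
  (* A tight set around [m] that misses the block separates [m] from two of the leaves without
     separating these two from each other. *)
  apply/negPn/negP => /notin_blk [Y [mY uY cY]].
  have dY := disB Y u (blk_refl E u) uY cY.
  have k12 := h12 Y; have k23 := h23 Y; have k31 := h31 Y.
  move: k12 k23 k31 (P12 Y dY cY) (P13 Y dY cY) (P23 Y dY cY).
  by rewrite /cr /= mY; case: (l1 \in Y); case: (l2 \in Y); case: (l3 \in Y) => //=; intuition.
- have H a b : (forall Y, [disjoint B & Y] -> bdry E Y <= 1 -> a \in Y -> b \in Y -> False) ->
    cov E (a, m) (a, b).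
    move=> h; apply/covP => Y0 /cr_side [Y [aY mY cE bdryE]]; rewrite -bdryE -cE => cY.
    have := h Y (disB _ _ mB mY cY) cY aY; rewrite /cr /= aY.
    by case: (b \in Y) => // /(_ isT).
  rewrite inE; apply/and3P; split; apply: H => Y a b c d.
  + exact: P12 Y a b c d.
  + exact: P23 Y a b c d.
  + exact: P13 Y a b d c.
Qed.

Lemma leaf_med E l : med E l l l = blk E l.
Proof. by apply/setP => m; rewrite !inE !andbb. Qed.

Definition token E S :=
  exists l1 l2 l3, [/\ leaf E l1, leaf E l2, leaf E l3 &
                       S = med E l1 l2 l3 \/ S = comp E l1].

Lemma token_blk E u : bdry E (blk E u) != 2 -> token E (blk E u).
Proof.
case: (ltngtP (bdry E (blk E u)) 2) => // c _.
  by exists u, u, u; split => //; left; rewrite leaf_med.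
have [l1 [l2 [l3 [h1 h2 h3 e]]]] := branch_med c.
by exists l1, l2, l3; split => //; left.
Qed.

Lemma token_comp E u : token E (comp E u).
Proof.
have [||l ll sl] := @leaf_exists E (comp E u); rewrite ?bdry_comp //.
  by apply/set0Pn; exists u; rewrite comp_refl.
exists l, l, l; split => //; right.
have : l \in comp E u by apply: (subsetP sl); exact: blk_refl.
rewrite inE => ul; apply/setP => v; rewrite !inE; apply/idP/idP.
  by apply: conn_trans; rewrite conn_sym.
exact: conn_trans.
Qed.

(** * Virtual links *)

(** Links are unordered and occur once, hence sets of vertices collected in a set; edges may be
    repeated, hence a list of ordered pairs. *)
Definition crs X (f : {set V}) := (f :&: X != set0) && (f :\: X != set0).
Definition covs E u v f :=
  [forall X : {set V}, cr X (u, v) && (bdry E X <= 1) ==> crs X f].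
Definition hop E (W : {set {set V}}) : rel V :=
  fun u v => [exists f in W, covs E u v f].
(** A chain whose stations stay in one component can be shortened when an end of its virtual link
    moves; [cov_median] needs this connection. *)
Definition hopc E W : rel V := fun u v => hop E W u v && conn E u v.

Implicit Types (L : seq (V * V * {set {set V}})) (W F : {set {set V}}).

(* A virtual link ((x, a), W) asks for an edge (x, a), to be realized by links of [W]. *)
Definition vok E (t : V * V * {set {set V}}) :=
  connect (hop E t.2) t.1.1 t.1.2 &&
  (conn E t.1.1 t.1.2 ==> connect (hopc E t.2) t.1.1 t.1.2).

Definition load L (f : {set V}) : nat := \sum_(t <- L) (f \in t.2).

(** The bound on the load says at once that the groups are pairwise disjoint and contained in
    [F]. *)
Definition valid E F L :=
  [/\ tec (E ++ unzip1 L), all (vok E) L & forall f, load L f <= (f \in F)].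

(** When the ends lie in one component, this is the union of the blocks on the path between them.
    Moving an end along that path shrinks it, which makes [spread] the second coordinate of the
    termination measure. *)
Definition span E (e : V * V) : {set V} := [set m | cov E (e.1, m) e].
Definition spread E L := \sum_(t <- L) #|span E t.1|.

Lemma crsE X x y : crs X [set x; y] = cr X (x, y).
Proof.
rewrite /crs /cr /=; apply/andP/idP => [[/set0Pn [z] + /set0Pn [w]]|].
  rewrite !inE => /andP [/orP [] /eqP -> zX] /andP [wX /orP [] /eqP wE];
  by move: wX; rewrite wE ?zX // ?(negbTE wX) => /negbTE ->.
case xX: (x \in X) => /= yX; split; apply/set0Pn;
  [exists x|exists y|exists y|exists x]; by rewrite !inE ?xX ?yX eqxx ?orbT.
Qed.

Lemma covsE E u v x y : covs E u v [set x; y] = cov E (u, v) (x, y).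
Proof. by apply: eq_forallb => X; rewrite crsE. Qed.

Lemma covs_sym E u v f : covs E u v f = covs E v u f.
Proof. by apply: eq_forallb => X; rewrite cr_sym. Qed.

Lemma covs_cov E u v u' v' f : cov E (u', v') (u, v) -> covs E u v f -> covs E u' v' f.
Proof.
move=> /covP h /forallP k; apply/forallP => X; apply/implyP => /andP [c c1].
by have := k X; rewrite (h X c c1) c1.
Qed.

Lemma covs_blk E u v f : v \in blk E u -> covs E u v f.
Proof.
by move=> /blkP h; apply/forallP => X; apply/implyP => /andP [/h]; rewrite ltnNge => /negbTE ->.
Qed.

Lemma hop_sym E W : symmetric (hop E W).
Proof. by move=> u v; apply: eq_existsb => f; rewrite covs_sym. Qed.

Lemma hopc_sym E W : symmetric (hopc E W).
Proof. by move=> u v; rewrite /hopc hop_sym conn_sym. Qed.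

Lemma hopS E W W' u v : W \subset W' -> hop E W u v -> hop E W' u v.
Proof.
move=> /subsetP s /existsP [f /andP [fW c]]; apply/existsP; exists f.
by rewrite s.
Qed.

Lemma connect_hopS E W W' u v :
  W \subset W' -> connect (hop E W) u v -> connect (hop E W') u v.
Proof. by move=> s; apply: connect_sub => x y h; apply/connect1/(hopS s). Qed.

Lemma connect_hopcS E W W' u v :
  W \subset W' -> connect (hopc E W) u v -> connect (hopc E W') u v.
Proof.
move=> s; apply: connect_sub => x y /andP [h c]; apply/connect1.
by rewrite /hopc c (hopS s).
Qed.

Lemma connect_hopc E W u v : connect (hopc E W) u v -> connect (hop E W) u v.
Proof. by apply: connect_sub => x y /andP [h _]; apply: connect1. Qed.

Lemma connect_hop_cut E W x a X : connect (hop E W) x a -> cr X (x, a) ->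
  bdry E X <= 1 -> exists2 f, f \in W & crs X f.
Proof.
move=> /connectP [p]; elim: p x => [|y p IH] x /=; first by move=> _ ->; rewrite crxx.
move=> /andP [/existsP [f /andP [fW /forallP c]] pp] l cX c1.
have /orP [cxy|] := cr_trans y cX; last by move=> cy; exact: IH pp l cy c1.
by exists f => //; have := c X; rewrite cxy c1.
Qed.

Lemma vok_flip E x a W : vok E (x, a, W) = vok E (a, x, W).
Proof.
rewrite /vok /= conn_sym; congr (_ && (_ ==> _)).
- exact/sym_connect_sym/hop_sym.
- exact/sym_connect_sym/hopc_sym.
Qed.

(** If both fail, there are tight sets around [m], one missing [s] and [u], the other missing [u]
    and [t]. Their intersection misses [s] and [t], so it is not tight; their union misses [u], so
    some edge leaves it. That makes three, and submodularity allows two. *)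
Lemma cov_median E s u t m : conn E u m -> cov E (s, m) (s, t) ->
  cov E (s, m) (s, u) || cov E (u, m) (u, t).
Proof.
move=> um /covP h; apply/negPn/negP; rewrite negb_or => /andP [].
rewrite !negb_forall => /existsP [X1]; rewrite negb_imply cr_sym => /andP [/andP [c1 l1] n1].
move=> /existsP [X2]; rewrite negb_imply cr_sym => /andP [/andP [c2 l2] n2].
have [Y1 [mY1 sY1 e1 k1]] := cr_side c1; have [Y2 [mY2 uY2 e2 k2]] := cr_side c2.
rewrite -k1 in l1; rewrite -k2 in l2.
move: n1 n2; rewrite -e1 -e2 /cr /= (negbTE sY1) (negbTE uY2) /= => uY1 tY2.
have := leq_trans (bdry_submod E Y1 Y2) (leq_add l1 l2); rewrite leqNgt => /negP; apply.
rewrite -[(1 + 1).+1]/(2 + 1); apply: leq_add.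
  rewrite ltnNge; apply/negP => /(h (Y1 :&: Y2)).
  by rewrite /cr /= !inE mY1 mY2 (negbTE sY1) /= (negbTE tY2) andbF => /(_ isT).
rewrite conn_sym in um; apply: (conn_cut um); rewrite !inE ?mY1 //.
by rewrite negb_or uY1 uY2.
Qed.

Lemma connect_conn E W u v : connect (hopc E W) u v -> conn E u v.
Proof.
move=> /connectP [p]; elim: p u => [|y p IH] u /=; first by move=> _ ->; exact: conn_refl.
by move=> /andP [/andP [_ c] pp] l; apply: conn_trans c (IH _ pp l).
Qed.

(** By [cov_median], if the stations before the last hop do not already lead to [m], the link of the
    last hop covers the way from its first station to [m]. *)
Lemma connect_span E W s a m : W != set0 -> connect (hopc E W) s a ->
  conn E s m -> cov E (s, m) (s, a) -> connect (hopc E W) s m.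
Proof.
move=> /set0Pn [f0 f0W] /connectP [p]; elim/last_ind: p a m => [|p a' IH] a m /=.
  (* Here [m] lies in the block of [s]; any link covers such a hop, but there has to be one. *)
  move=> _ -> sm cv; apply: connect1; rewrite /hopc sm andbT; apply/existsP; exists f0.
  by rewrite f0W covs_blk // inE.
rewrite rcons_path last_rcons => /andP [pp /andP [h c]] -> sm cv.
have su : conn E s (last s p) by apply: (@connect_conn _ W); apply/connectP; exists p.
have um : conn E (last s p) m by apply: conn_trans sm; rewrite conn_sym.
have /orP [c1|c2] := cov_median um cv; first exact: (IH _ _ pp erefl sm c1).
apply: connect_trans (_ : connect (hopc E W) s (last s p)) _.
  by apply/connectP; exists p.
apply: connect1; rewrite /hopc um andbT; case/existsP: h => f /andP [fW cf].
by apply/existsP; exists f; rewrite fW (covs_cov c2).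
Qed.

Lemma span_flip E x a : span E (x, a) = span E (a, x).
Proof.
suff h y z : span E (y, z) \subset span E (z, y) by apply/eqP; rewrite eqEsubset !h.
apply/subsetP => m; rewrite !inE /= => /covP h; apply/covP => X + c1.
have := contraNN (fun k => h X k c1); rewrite /cr /=.
by case: (y \in X); case: (z \in X); case: (m \in X) => //= /(_ isT).
Qed.

Lemma perm_valid E F L L' : perm_eq L L' -> valid E F L -> valid E F L'.
Proof.
move=> p [t v l]; split.
- have pE : perm_eq (E ++ unzip1 L) (E ++ unzip1 L') by rewrite perm_cat2l; apply: perm_map.
  by apply/tecP => X X0 XT; rewrite -(bdry_perm _ pE); apply: (tecP _ t).
- by rewrite -(perm_all _ p).
- by move=> f; rewrite /load -(perm_big _ p); apply: l.
Qed.

Lemma orient X e : cr X e ->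
  exists b b', [/\ b \in X, b' \notin X, (forall Y, cr Y e = cr Y (b, b')) &
                   e = (b, b') \/ e = (b', b)].
Proof.
case: e => x y; rewrite /cr /=; case xX: (x \in X) => /= yX.
  by exists x, y; split => //; left.
exists y, x; split => //; first by rewrite xX.
  by move=> Y; rewrite addbC.
by right.
Qed.

Lemma not_tec E : ~~ tec E -> exists X, [/\ X != set0, X != setT & bdry E X <= 1].
Proof.
rewrite negb_forall => /existsP [X]; rewrite negb_imply -leqNgt => /andP [/andP [X0 XT] c].
by exists X.
Qed.

(* The bridge at which the block of [a] is left on the way to [s]. *)
Lemma bridge_toward E s a : conn E s a -> s \notin blk E a ->
  exists b b' e1 E1, [/\ perm_eq E (e1 :: E1), (forall Y, cr Y e1 = cr Y (b, b')),
    b \in blk E a, conn E s b' &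
    [/\ cov E (s, b') (s, a) & ~~ cov E (s, a) (s, b')]].
Proof.
move=> csa /notin_blk [X [sX aX cX]].
have := @min_set (fun X => [&& a \in X, s \notin X & bdry E X <= 1]) (~: X).
rewrite !inE aX sX bdryC cX => /(_ isT) [X0 [/and3P [aX0 sX0 cX0] _ mX0]].
have c1 : bdry E X0 = 1.
  apply/eqP; rewrite eqn_leq cX0 lt0n -lt0n /=.
  by apply: (conn_cut _ aX0 sX0); rewrite conn_sym.
have [e1 [E1 [pE cre]]] : exists e E', perm_eq E (e :: E') /\ cr X0 e.
  by apply: bdry_pick; rewrite c1.
have [b [b' [bX0 b'X0 ecr eE]]] := orient cre.
have cE Z : bdry E Z = cr Z (b, b') + bdry E1 Z by rewrite (bdry_perm _ pE) bdry_cons ecr.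
have cE1 : bdry E1 X0 = 0.
  by have := cE X0; rewrite c1 /cr /= bX0 (negbTE b'X0) => -[].
(* Otherwise a tight [Y] around [b] that misses [a] could be cut off from [X0]: the bridge no longer
   leaves the rest, which stays tight, against minimality. *)
have bB : b \in blk E a.
  apply/negPn/negP => /notin_blk [Y [bY aY cY]].
  have cD : bdry E (X0 :\: Y) <= 1.
    rewrite cE /cr /= !inE bY (negbTE b'X0) andbF add0n setDE.
    apply: leq_trans (bdryI _ _ _) _; rewrite cE1 bdryC add0n (leq_trans _ cY) //.
    by rewrite [leqRHS]cE leq_addl.
  have DE : X0 :\: Y = X0.
    by apply: mX0 (subsetDl _ _); rewrite !inE aX0 aY (negbTE sX0) andbF cD.
  by have := bX0; rewrite -DE inE bY.
have cbb : conn E b b'.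
  apply/connP => Y c; rewrite cE c //.
exists b, b', e1, E1; split => //.
  exact: conn_trans csa (conn_trans (blk_conn bB) cbb).
split; last first.
  rewrite negb_forall; apply/existsP; exists X0; rewrite negb_imply cX0 andbT.
  by rewrite /cr /= aX0 (negbTE sX0) (negbTE b'X0).
apply/covP => Y0; rewrite cr_sym => /cr_side [Y [bY sY crY bdryY]].
rewrite -bdryY -crY => cY; apply/negPn/negP; rewrite /cr /= (negbTE sY) /= => aY.
have bY' : b \notin Y by apply: (blk_dis cY aY).
(* [e1] is the only edge leaving [X0] and the only one leaving [Y], and it lies inside their
   union. *)
have : bdry E (Y :|: X0) = 0.
  apply/eqP; rewrite cE /cr /= !inE bX0 bY orbT /= -leqn0.
  apply: leq_trans (bdryU _ _ _) _; rewrite cE1 addn0.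
  by move: cY; rewrite cE /cr /= bY (negbTE bY') add1n ltnS.
rewrite conn_sym in csa => /bdry0_side/(_ csa); rewrite !inE aX0 (negbTE sY) (negbTE sX0) orbT.
by [].
Qed.

(* Replacing [(s, a)] and [(a2, y)] by [(s, y)] keeps the graph 2-edge-connected:
   a violating [X] contains the block but not [y], so that [X :\: U] is violating too. *)
Lemma merge_tec E R s a a2 y b b' e1 E1 (c c' : V) (U K : {set V}) :
  tec ((s, a) :: (a2, y) :: E ++ R) ->
  perm_eq E (e1 :: E1) -> (forall Y, cr Y e1 = cr Y (b, b')) ->
  b \in blk E a -> a2 \in blk E a -> c \in blk E a -> (c, c') \in E \/ (c', c) \in E ->
  a \in U -> s \notin U -> b' \notin U -> c' \in U -> bdry E U = 1 -> bdry R U = 0 ->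
  K = [set z | connect (fun u v => [&& u \notin blk E a, v \notin blk E a &
                 ((u, v) \in E ++ R) || ((v, u) \in E ++ R)]) c' z] ->
  y \in K -> K \subset U -> tec ((s, y) :: E ++ R).
Proof.
move=> tT pE ecr bB a2B cB ccE aU sU b'U c'U cEU cRU KE yK KU.
have BU v : v \in blk E a -> v \in U.
  by move=> vB; rewrite (blk_side (eq_leq cEU) vB).
apply/negPn/negP => /not_tec [X1 [X10 X1T cX1]].
have [X [X0 XT cX sX]] : exists X, [/\ X != set0, X != setT, bdry ((s, y) :: E ++ R) X <= 1 & s \notin X].
  case sX: (s \in X1); last by exists X1; rewrite sX.
  exists (~: X1); rewrite bdryC inE sX; split => //.
    by apply: contra X1T => /eqP h; rewrite -[X1]setCK h setC0.
  by apply: contra X10 => /eqP h; rewrite -[X1]setCK h setCT.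
have cEX : bdry E X <= 1.
  by apply: leq_trans cX; rewrite bdry_cons bdry_cat addnCA leq_addr.
have a2X := blk_side cEX a2B.
have BX v : v \in blk E a -> (v \in X) = (a \in X) by move=> vB; rewrite (blk_side cEX vB).
have := tecP _ tT X X0 XT; rewrite ltnNge => /negP; case.
move: cX; rewrite !bdry_cons /cr /= (negbTE sX) a2X.
case aX: (a \in X); last by [].
case yX: (y \in X); first by [].
rewrite add0n => cX; exfalso.
have bX : b \in X by rewrite BX.
have cE Z : bdry E Z = cr Z (b, b') + bdry E1 Z by rewrite (bdry_perm _ pE) bdry_cons ecr.
have yU : y \in U by apply: (subsetP KU).
(* The walk from the block through [c'] to [y] stays in [U]; it starts in [X] and ends outside. *)
have [g gR /and3P [g1U g2U cg]] : exists2 g, g \in E ++ R & [&& g.1 \in U, g.2 \in U & cr X g].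
  case c'X: (c' \in X).
    move: yK; rewrite KE inE => /connectP [p]; elim: p c' c'X {KE ccE} c'U => [|z p IH] x xX xU /=.
      by move=> _ yE; move: yX; rewrite yE xX.
    move=> /andP [/and3P [xB zB xz] pp] l.
    have zU : z \in U.
      apply/negPn/negP => zU.
      have [g gER gx] : exists2 g, g \in E ++ R & g = (x, z) \/ g = (z, x).
        by case/orP: xz => h; [exists (x, z)|exists (z, x)] => //; [left|right].
      have cg : cr U g by case: gx => ->; rewrite /cr /= xU (negbTE zU).
      move: gER; rewrite mem_cat (perm_mem pE) inE => /orP [/orP [/eqP ge|gE1]|gR].
      - have := ecr (blk E a); rewrite -ge /cr /= bB (negbTE (contra (@BU b') b'U)).
        by case: gx => -> /=; rewrite (negbTE xB) (negbTE zB).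
      - have : 0 < bdry E1 U by apply/bdry_gt0P; exists g.
        by move: cEU; rewrite cE /cr /= (BU _ bB) (negbTE b'U) add1n => -[->].
      - have : 0 < bdry R U by apply/bdry_gt0P; exists g.
        by rewrite cRU.
    case zX: (z \in X); first exact: IH zX zU pp l.
    case/orP: xz => h; [exists (x, z)|exists (z, x)] => //;
      by rewrite /cr /= xU zU xX zX.
  have [cU cX'] : c \in U /\ c \in X by rewrite BU // BX.
  case: ccE => h; [exists (c, c')|exists (c', c)]; rewrite ?mem_cat ?h //=;
    by rewrite /cr /= cU c'U cX' c'X.
pose ins := \sum_(e <- E ++ R) [&& e.1 \in U, e.2 \in U & cr X e].
have ins1 : 0 < ins.
  rewrite /ins (big_rem g) //=; by rewrite g1U g2U cg.
have cRU1 : bdry (E ++ R) U = 1 by rewrite bdry_cat cEU cRU.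
(* If [b'] is outside [X], the bridge crosses [X] in addition to the edge found inside [U]: two
   crossings where at most one is allowed. *)
case b'X: (b' \in X); last first.
  have : ins + \sum_(e <- E ++ R) (cr U e && cr X e) <= bdry (E ++ R) X.
    rewrite /ins /bdry -big_split; apply: sum_le => u v; rewrite /cr /=.
    by do 4 case: (_ \in _).
  apply/negP; rewrite -ltnNge; apply: leq_ltn_trans cX _.
  rewrite -[2]/(1 + 1) leq_add //.
  rewrite big_cat /= (leq_trans _ (leq_addr _ _)) // (perm_big _ pE) big_cons.
  by rewrite !ecr /cr /= (BU _ bB) (negbTE b'U) bX b'X.
(* Now [b'] lies in [X :\: U]. The edge inside [U] makes up for the one leaving [U], so at most one
   edge leaves this set, and neither removed virtual link crosses it. *)
have : bdry (E ++ R) (X :\: U) + ins <= bdry (E ++ R) X + bdry (E ++ R) U.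
  rewrite /ins /bdry -!big_split; apply: sum_le => u v; rewrite /cr /= !inE.
  by do 4 case: (_ \in _).
rewrite cRU1 => le2.
have ZT := tec_in tT (X := X :\: U) (u := b') (v := s).
have := ZT; rewrite !inE b'U b'X (negbTE sX) andbF => /(_ isT isT).
rewrite !bdry_cons /cr /= !inE (negbTE sX) aU yU (BU _ a2B) /= andbF !add0n.
rewrite ltnNge => /negP; apply.
by rewrite -(leq_add2r ins) (leq_trans le2) // leq_add.
Qed.

Definition smaller E L' L :=
  (size L' < size L) || ((size L' == size L) && (spread E L' < spread E L)).

Lemma load_cons t L f : load (t :: L) f = (f \in t.2) + load L f.
Proof. by rewrite /load big_cons. Qed.

Lemma vok_nonempty E x a W : vok E (x, a, W) -> x != a -> W != set0.
Proof.
move=> /andP [/connectP [[|y p] /= pp l] _]; first by rewrite l eqxx.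
by case/andP: pp => /existsP [f /andP [fW _]] _ _; apply/set0Pn; exists f.
Qed.

(** The end [a] moves over its bridge towards [s], which shrinks the span, unless some cut needs it
    where it is. In that case the part behind the other edge of the block is tied to the block by a
    further virtual link, and merging the two virtual links lowers their number. *)
Lemma float_progress E F s a W L :
  valid E F ((s, a, W) :: L) -> conn E s a -> s \notin blk E a ->
  bdry E (blk E a) = 2 ->
  exists2 L', valid E F L' & smaller E L' ((s, a, W) :: L).
Proof.
move=> [tT /= /andP [vt vL] ld] csa sB cB2.
have W0 : W != set0.
  by apply: vok_nonempty vt _; apply: contraNneq sB => ->; exact: blk_refl.
have [b [b' [e1 [E1 [pE ecr bB csb' [cv ncv]]]]]] := bridge_toward csa sB.
have cE Z : bdry E Z = cr Z (b, b') + bdry E1 Z by rewrite (bdry_perm _ pE) bdry_cons ecr.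
have hca : connect (hopc E W) s a by move: vt => /andP [_ /implyP]; exact.
case tT1 : (tec (E ++ (s, b') :: unzip1 L)).
  exists ((s, b', W) :: L); last first.
    rewrite /smaller /= eqxx ltnn /= /spread !big_cons ltn_add2r.
    apply: proper_card; rewrite /proper; apply/andP; split.
      by apply/subsetP => m; rewrite !inE => /= h; apply: cov_trans h cv.
    apply/subsetPn; exists a; rewrite ?inE //=.
    by apply/covP.
  have hcb : connect (hopc E W) s b' by apply: connect_span hca csb' cv.
  split; [exact: tT1| |by move=> f; have := ld f; rewrite !load_cons].
  rewrite /=; apply/andP; split; last exact: vL.
  by rewrite /vok /= csb' /= hcb andbT; exact: connect_hopc.
(* The move fails at a cut that [(s, a)] crosses and [(s, b')] does not. Apart from [(s, a)] exactly
   one edge, real or virtual, leaves it, and this is the bridge [e1]. *)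
move/negbT/not_tec: tT1 => [X [X0 XT]].
rewrite bdry_cat bdry_cons => cX.
have tT2 : 1 < bdry E X + (cr X (s, a) + bdry (unzip1 L) X).
  by have := tecP _ tT X X0 XT; rewrite bdry_cat bdry_cons.
have csaX : cr X (s, a).
  apply/negPn/negP => /negbTE h; move: tT2; rewrite h add0n ltnNge => /negP; apply.
  by apply: leq_trans cX; rewrite leq_add2l leq_addl.
have csb'X : cr X (s, b') = false.
  by case h: (cr X (s, b')) cX => //; rewrite csaX in tT2; rewrite leqNgt tT2.
rewrite csb'X csaX !add0n in cX tT2.
have {tT2} cX1 : bdry E X + bdry (unzip1 L) X = 1.
  by apply/eqP; rewrite eqn_leq cX /=; move: tT2; rewrite addnCA add1n ltnS.
have [U [aU sU crU bdryU]] : exists Y, [/\ a \in Y, s \notin Y, (forall e, cr Y e = cr X e) &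
                forall E, bdry E Y = bdry E X] by apply: cr_side; rewrite cr_sym.
have b'U : b' \notin U.
  by move: csb'X; rewrite -crU /cr /= (negbTE sU) /= => ->.
have cEU : bdry E U + bdry (unzip1 L) U = 1 by rewrite !bdryU.
have bU : b \in U by rewrite (blk_side _ bB) // -cEU leq_addr.
have [cEU1 cRU] : bdry E U = 1 /\ bdry (unzip1 L) U = 0.
  by move: cEU; rewrite cE /cr /= bU (negbTE b'U) add1n addSn => -[/eqP]; rewrite addn_eq0 => /andP [/eqP -> /eqP ->].
have cE1U : bdry E1 U = 0 by move: cEU1; rewrite cE /cr /= bU (negbTE b'U) => -[].
have BU v : v \in blk E a -> v \in U by move=> vB; rewrite (blk_side (eq_leq cEU1) vB).
have b'B : b' \notin blk E a by apply: contra b'U; exact: BU.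
have cE1B : bdry E1 (blk E a) = 1 by move: cB2; rewrite cE /cr /= bB (negbTE b'B) => -[].
have [e2 [E2 [pE2 cre2]]] : exists e E', perm_eq E1 (e :: E') /\ cr (blk E a) e.
  by apply: bdry_pick; rewrite cE1B.
have [c [c' [cB c'B ecr2 eE2]]] := orient cre2.
have cE2 Z : bdry E1 Z = cr Z (c, c') + bdry E2 Z by rewrite (bdry_perm _ pE2) bdry_cons ecr2.
have c'U : c' \in U.
  by move: cE1U; rewrite cE2 /cr /= (BU _ cB); case: (c' \in U).
have cE2B : bdry E2 (blk E a) = 0.
  by move: cE1B; rewrite cE2 /cr /= cB (negbTE c'B) => -[].
have ccE : (c, c') \in E \/ (c', c) \in E.
  have : e2 \in E by rewrite (perm_mem pE) inE (perm_mem pE2) mem_head orbT.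
  by case: eE2 => ->; [left|right].
pose r T := fun u v => [&& u \notin blk E a, v \notin blk E a & ((u, v) \in T) || ((v, u) \in T)].
pose T0 := E ++ unzip1 L.
(* What can be reached from the far end of the second edge while avoiding the block, virtual links
   included. *)
pose K := [set z | connect (r T0) c' z].
have c'K : c' \in K by rewrite inE connect0.
have rS T : symmetric (r T) by move=> u v; rewrite /r andbCA orbC.
have KB z : z \in K -> z \notin blk E a.
  rewrite inE (sym_connect_sym (rS _)) => /connectP [[|w p] /=]; first by move=> _ <-.
  by move=> /andP [/and3P [h _ _] _] _.
have KU : K \subset U.
  apply/subsetP => z; rewrite inE => /connectP [p].
  elim: p c' c'U {c'B ecr2 eE2 cE2 ccE K c'K KB} => [|w p IH] x xU /=; first by move=> _ ->.
  move=> /andP [/and3P [xB wB xw] pp]; apply: IH => //.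
  apply/negPn/negP => wU.
  have [g gT gx] : exists2 g, g \in T0 & g = (x, w) \/ g = (w, x).
    by case/orP: xw => h; [exists (x, w)|exists (w, x)] => //; [left|right].
  have cg : cr U g by case: gx => ->; rewrite /cr /= xU (negbTE wU).
  move: gT; rewrite mem_cat (perm_mem pE) inE => /orP [/orP [/eqP ge|gE1]|gR].
  - have := ecr (blk E a); rewrite -ge /cr /= bB (negbTE b'B).
    by case: gx => -> /=; rewrite (negbTE xB) (negbTE wB).
  - have : 0 < bdry E1 U by apply/bdry_gt0P; exists g.
    by rewrite cE1U.
  - have : 0 < bdry (unzip1 L) U by apply/bdry_gt0P; exists g.
    by rewrite cRU.
have Kcr g : g \in T0 -> cr K g ->
    exists y z, [/\ y \in K, z \in blk E a & g = (y, z) \/ g = (z, y)].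
  move=> gT cg; have [y [z [yK zK _ gyz]]] := orient cg.
  exists y, z; split => //; apply/negPn/negP => zB; move/negP: zK; case.
  have yB := KB _ yK.
  move: yK; rewrite !(in_set (fun z => connect _ _ z)) => h; apply: connect_trans h (connect1 _).
  by rewrite /r zB yB /=; case: gyz gT => -> ->; rewrite ?orbT.
have sK : s \notin K by apply: contra sU => /(subsetP KU).
have cEK : bdry E K <= 1.
  have bK : b \notin K by apply/negP => /KB; rewrite bB.
  have b'K : b' \notin K by apply: contra b'U; apply: (subsetP KU).
  rewrite cE cE2 /cr /= (negbTE bK) (negbTE b'K) /= add0n.
  suff -> : bdry E2 K = 0 by rewrite addn0 leq_b1.
  apply/eqP; rewrite -leqn0 leqNgt; apply/negP => /bdry_gt0P [g gE2 crg].
  have gE : g \in E by rewrite (perm_mem pE) inE (perm_mem pE2) inE gE2 !orbT.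
  have [|y [z [yK zB gyz]]] := Kcr g _ crg; first by rewrite mem_cat gE.
  have : 0 < bdry E2 (blk E a).
    apply/bdry_gt0P; exists g => //.
    by case: gyz => ->; rewrite /cr /= zB (negbTE (KB _ yK)).
  by rewrite cE2B.
(* At most one edge of [E] leaves [K], and [(s, a)] does not, so another virtual link must; like
   every edge leaving [K], it ends in the block. *)
have cLK : 0 < bdry (unzip1 L) K.
  have := tec_in tT c'K sK; rewrite bdry_cat bdry_cons /cr /= (negbTE sK).
  have -> : (a \in K) = false by apply/negP => /KB; rewrite blk_refl.
  rewrite add0n => /leq_trans/(_ (leq_add cEK (leqnn _))); rewrite add1n ltnS.
  by [].
have /bdry_gt0P [v2 v2L cv2] := cLK.
have [y [a2 [yK a2B v2E]]] : exists y z, [/\ y \in K, z \in blk E a & v2 = (y, z) \/ v2 = (z, y)].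
  by apply: Kcr cv2; rewrite mem_cat v2L orbT.
move/mapP: v2L => [[v2' W2] t2L /= v2v]; rewrite -v2v {v2' v2v} in t2L.
have pL := perm_to_rem t2L; set L2 := rem _ _ in pL.
have pu : perm_eq (unzip1 L) (v2 :: unzip1 L2) by have := perm_map fst pL.
have v2ok : vok E (a2, y, W2).
  have := allP vL _ t2L; case: v2E => -> //; by rewrite vok_flip.
have tT' : tec ((s, a) :: (a2, y) :: E ++ unzip1 L2).
  apply/tecP => X' X'0 X'T; have := tecP _ tT _ X'0 X'T.
  rewrite !bdry_cons !bdry_cat !bdry_cons (bdry_perm _ pu) bdry_cons.
  have -> : cr X' v2 = cr X' (a2, y) by case: v2E => ->; rewrite // cr_sym.
  by rewrite addnCA [bdry E X' + (_ + _)]addnCA.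
have cRU2 : bdry (unzip1 L2) U = 0.
  by apply/eqP; rewrite -leqn0 -cRU (bdry_perm _ pu) bdry_cons leq_addl.
have KE2 : K = [set z | connect (r (E ++ unzip1 L2)) c' z].
  apply/setP => z; rewrite !(in_set (fun z => connect _ _ z)); apply: eq_connect => u v.
  rewrite /r /T0 !mem_cat !(perm_mem pu) !in_cons.
  case uB: (u \in blk E a) => //=; case vB: (v \in blk E a) => //=.
  suff [-> ->] : ((u, v) == v2) = false /\ ((v, u) == v2) = false by [].
  split; apply/eqP => e; case: v2E; rewrite -e => -[e3 e4].
  - by rewrite -e4 vB in a2B.
  - by rewrite -e3 uB in a2B.
  - by rewrite -e4 uB in a2B.
  - by rewrite -e3 vB in a2B.
have tM := merge_tec tT' pE ecr bB a2B cB ccE aU sU b'U c'U cEU1 cRU2 KE2 yK KU.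
exists ((s, y, W :|: W2) :: L2); last first.
  by rewrite /smaller /= (perm_size pL) /= ltnSn.
have caa2 : hopc E W a a2.
  rewrite /hopc blk_conn // andbT; have /set0Pn [f fW] := W0.
  by apply/existsP; exists f; rewrite fW covs_blk.
split.
- apply/tecP => X' X'0 X'T; have := tecP _ tM _ X'0 X'T.
  by rewrite /= !bdry_cat !bdry_cons bdry_cat addnCA.
- have vL2 : all (vok E) L2 by move: vL; rewrite (perm_all _ pL) => /andP [].
  rewrite /= vL2 andbT; apply/andP; split => /=.
    apply: connect_trans (connect_hopS (subsetUl _ _) (connect_hopc hca)) _.
    apply: connect_trans (connect_hopS (subsetUl _ _) (connect_hopc (connect1 caa2))) _.
    by apply: connect_hopS (subsetUr _ _) _; move/andP: v2ok => [].
  apply/implyP => csy.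
  apply: connect_trans (connect_hopcS (subsetUl _ _) hca) _.
  apply: connect_trans (connect_hopcS (subsetUl _ _) (connect1 caa2)) _.
  apply: connect_hopcS (subsetUr _ _) _; move/andP: v2ok => [_ /implyP]; apply => /=.
  have ca2 := conn_trans csa (blk_conn a2B).
  by rewrite conn_sym in ca2; apply: conn_trans ca2 csy.
- move=> f; apply: leq_trans (ld f); rewrite !load_cons /= /load (perm_big _ pL) big_cons /= addnA.
  rewrite leq_add2r inE; by case: (f \in W); case: (f \in W2).
Qed.

(* Cuts that keep the end [a] of a virtual link (x, a) from moving in the component of [a]. *)
Definition bad E T x a X :=
  [&& bdry E (blk E a) == 2, bdry T X == 2, a \in X, x \notin X & ~~ (comp E a \subset X)].

Definition linked (R : seq (V * V)) x a := ((x, a) \in R) || ((a, x) \in R).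

Lemma linked_cr R x a X : linked R x a -> x \notin X -> a \in X -> 0 < bdry R X.
Proof.
move=> h xX aX; apply/bdry_gt0P.
by case/orP: h => h; [exists (x, a)|exists (a, x)]; rewrite // /cr /= aX (negbTE xX).
Qed.

Lemma comp_side E X a : a \in X -> ~~ (comp E a \subset X) -> 0 < bdry E X.
Proof.
move=> aX /subsetPn [m]; rewrite inE => am mX; exact: conn_cut am aX mX.
Qed.

Lemma bdry1_unique E X e g : bdry E X = 1 -> e \in E -> g \in E -> cr X e -> cr X g -> e = g.
Proof.
move=> c eE gE ce cg; apply/eqP/negPn/negP => ne.
have := bdry1_others (perm_to_rem eE) c ce (g := g).
have : g \in e :: rem e E by rewrite -(perm_mem (perm_to_rem eE)).
by rewrite inE eq_sym (negbTE ne) /= cg => h /(_ h).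
Qed.

(** Otherwise no virtual link touches [X] outside the block of [a], so every nonempty part of [X]
    there is left by two edges of [E]. But [X] and the block are left by three edges in all, too few
    for the two parts behind the two edges of the block. *)
Lemma bad_inner E R x a X : tec (E ++ R) -> linked R x a -> bad E (E ++ R) x a X ->
  exists2 r, r \in R & (r.1 \in X) && (r.2 \in X).
Proof.
move=> tT lk /and5P [/eqP cB /eqP cX aX xX sX].
apply/hasP/negPn/negP => /hasPn noin.
have cE1 := comp_side aX sX; have cR1 := linked_cr lk xX aX.
have [cE cR] : bdry E X = 1 /\ bdry R X = 1.
  by move: cX; rewrite bdry_cat; lia.
have BX : blk E a \subset X by apply: blk_sub aX; rewrite cE.
have Rin (Z : {set V}) r : r \in R -> Z \subset X :\: blk E a -> cr Z r = false.
  move=> rR ZX; apply/negP => cZ.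
  have [p [q [pZ qZ _ re]]] := orient cZ.
  have : p \in X :\: blk E a by apply: (subsetP ZX).
  rewrite inE => /andP [pB pX].
  have qX : q \notin X.
    by have := noin _ rR; case: re => -> /=; rewrite pX ?andbT.
  have crX : cr X r by case: re => ->; rewrite /cr /= pX (negbTE qX).
  have : exists2 g, g \in R & g = (x, a) \/ g = (a, x).
    by case/orP: lk => h; [exists (x, a)|exists (a, x)] => //; [left|right].
  case=> g gR ge; have cg : cr X g by case: ge => ->; rewrite /cr /= aX (negbTE xX).
  have rg := bdry1_unique cR rR gR crX cg.
  move: re ge; rewrite rg => -[] -> [] [e1 e2].
  - by rewrite -e1 pX in xX.
  - by rewrite e1 blk_refl in pB.
  - by rewrite e2 blk_refl in pB.
  - by rewrite -e2 pX in xX.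
have cR0 (Z : {set V}) : Z \subset X :\: blk E a -> bdry R Z = 0.
  move=> ZX; apply/eqP; rewrite -leqn0 leqNgt; apply/negP => /bdry_gt0P [r rR].
  by rewrite (Rin _ _ rR ZX).
have cE2 (Z : {set V}) v : Z \subset X :\: blk E a -> v \in Z -> 1 < bdry E Z.
  move=> ZX vZ; have aZ : a \notin Z.
    by apply/negP => /(subsetP ZX); rewrite inE blk_refl.
  by have := tec_in tT vZ aZ; rewrite bdry_cat cR0 // addn0.
have [v vD] : exists v, v \in X :\: blk E a.
  apply/set0Pn; apply/negP => /eqP D0.
  have XB : X = blk E a.
    by apply/eqP; rewrite eqEsubset BX -setD_eq0 D0 eqxx.
  by move: cE; rewrite XB cB.
(* An edge leaving both sets counts twice on the right and not at all for the difference, which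
   itself needs two of the three. *)
have both0 : \sum_(e <- E) (cr (blk E a) e && cr X e) = 0.
  have : bdry E (X :\: blk E a) + 2 * (\sum_(e <- E) (cr (blk E a) e && cr X e)) <=
         bdry E X + bdry E (blk E a).
    rewrite /bdry big_distrr -!big_split; apply: sum_le => p q.
    have := subsetP BX p; have := subsetP BX q; rewrite /cr /= !in_setD.
    by case: (p \in blk E a); case: (q \in blk E a); case: (p \in X); case: (q \in X) => //= h1 h2;
      (try by have := h1 isT); try by have := h2 isT.
  by rewrite cE cB; have := cE2 _ _ (subxx _) vD; lia.
have nb e : e \in E -> cr (blk E a) e -> cr X e = false.
  move=> eE cBe; apply/negP => cXe.
  by move: both0; rewrite (big_rem e) //= cBe cXe.
have [e1 [E1 [pE cre1]]] : exists e E', perm_eq E (e :: E') /\ cr (blk E a) e.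
  by apply: bdry_pick; rewrite cB.
have [e2 [E2 [pE1 cre2]]] : exists e E', perm_eq E1 (e :: E') /\ cr (blk E a) e.
  by apply: bdry_pick; move: cB; rewrite (bdry_perm _ pE) bdry_cons cre1; lia.
have e1E : e1 \in E by rewrite (perm_mem pE) mem_head.
have e2E1 : e2 \in E1 by rewrite (perm_mem pE1) mem_head.
have e2E : e2 \in E by rewrite (perm_mem pE) inE e2E1 orbT.
have [Y [cY dY _ cEY]] := far_side_cr e2E cre2.
have [b [b' [bB b'B ecr1 eE1]]] := orient cre1.
have [c [c' [cB' c'B ecr2 eE2]]] := orient cre2.
have YB w : w \in blk E a -> w \in Y = false by move=> wB; rewrite (disjointFr dY wB).
have c'Y : c' \in Y by move: cY; rewrite ecr2 /cr /= YB.
have b'Y : b' \notin Y.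
  have : bdry E1 Y = 0 \/ cr Y e1 = false.
    by move: cEY; rewrite (bdry_perm _ pE) bdry_cons; case: (cr Y e1) => [[]|]; [left|right].
  case=> [c0|]; last by rewrite ecr1 /cr /= YB //= => ->.
  have : 0 < bdry E1 Y by apply/bdry_gt0P; exists e2.
  by rewrite c0.
have c'X : c' \in X.
  by have := nb _ e2E cre2; rewrite ecr2 /cr /= (subsetP BX _ cB'); case: (c' \in X).
have b'X : b' \in X.
  by have := nb _ e1E cre1; rewrite ecr1 /cr /= (subsetP BX _ bB); case: (b' \in X).
have YX : X :&: Y \subset X :\: blk E a.
  apply/subsetP => w; rewrite !in_setI in_setD => /andP [-> wY]; rewrite andbT.
  by apply/negP => /YB; rewrite wY.
have := leq_add (cE2 _ _ YX (_ : c' \in _)) (cE2 ((X :\: blk E a) :\: Y) b' _ _).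
rewrite !in_setI !in_setD c'X c'Y b'X b'B b'Y subsetDl => /(_ isT isT isT).
apply/negP; rewrite -ltnNge ltnS.
have nY : \sum_(e <- E) (cr Y e && ~~ cr (blk E a) e) = 0.
  apply/eqP; rewrite -leqn0 leqNgt; apply/negP => pos.
  have : 0 < bdry [seq e <- E | ~~ cr (blk E a) e] Y.
    by rewrite /bdry big_filter big_mkcond; apply: leq_trans pos _; apply: leq_sum => e _; case: cr; case: cr.
  move=> /bdry_gt0P [g]; rewrite mem_filter => /andP [nB gE] cg.
  by have ge := bdry1_unique cEY gE e2E cg cY; rewrite ge cre2 in nB.
have : bdry E (X :&: Y) + bdry E ((X :\: blk E a) :\: Y) <=
    bdry E X + bdry E (blk E a) + 2 * (\sum_(e <- E) (cr Y e && ~~ cr (blk E a) e)).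
  rewrite /bdry big_distrr -!big_split; apply: sum_le => p q.
  have /implyP := subsetP BX p; have /implyP := subsetP BX q.
  have := disjN p dY; have := disjN q dY.
  rewrite /cr /= !in_setD !in_setI.
  by case: (p \in blk E a); case: (q \in blk E a); case: (p \in X); case: (q \in X) => //=;
     case: (p \in Y); case: (q \in Y).
by rewrite nY cE cB.
Qed.

(** A descent. A minimal bad set [L] contains a virtual link by [bad_inner]; uncrossing with the bad
    set of that link puts the complement of the latter properly inside [L]. Such a complement again
    contains a virtual link, and so on. *)
Lemma no_all_bad E R : tec (E ++ R) -> R != [::] ->
  (forall r, r \in R -> ~~ conn E r.1 r.2) ->
  (forall r, r \in R -> exists x a X, (r = (x, a) \/ r = (a, x)) /\ bad E (E ++ R) x a X) ->
  False.
Proof.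
move=> tT R0 nc allbad.
pose BT X := [exists x, exists a, linked R x a && bad E (E ++ R) x a X].
have [L [/existsP [x /existsP [a /andP [lk bL]]] _ mL]] : exists X, [/\ BT X, X \subset setT &
    forall Y, BT Y -> Y \subset X -> Y = X].
  case: R R0 allbad @BT {tT nc} => // r R _ h; have [x [a [X [rE b]]]] := h r (mem_head _ _).
  move=> BT; have [|X' [h1 _ h3]] := @min_set BT X; last by exists X'; rewrite h1 subsetT.
  apply/existsP; exists x; apply/existsP; exists a; rewrite b andbT /linked.
  by case: rE => <-; rewrite mem_head ?orbT.
(* The properties of the complement of a bad set that the descent keeps. *)
pose D (M : {set V}) := [&& M \subset L, bdry (E ++ R) M == 2 &
  [exists x, exists a, [&& linked R x a, x \in M, a \notin M & comp E a :&: M != set0]]].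
have inner (Q : {set V}) r : Q \subset L -> bdry (E ++ R) Q = 2 -> r \in R ->
    (r.1 \in Q) && (r.2 \in Q) -> exists2 M, D M & M \proper Q.
  move=> QL cQ rR rQ; have [x1 [a1 [L1 [rE b1]]]] := allbad r rR.
  have lk1 : linked R x1 a1 by rewrite /linked; case: rE => <-; rewrite rR ?orbT.
  have [x1Q a1Q] : x1 \in Q /\ a1 \in Q by case: rE rQ => -> /= /andP [].
  have /and5P [cB /eqP cL1 a1L1 x1L1 sL1] := b1.
  (* If the union were proper, submodularity would make the intersection a bad set inside [L], hence
     equal to [L]; yet [x1] is in [L] and not in [L1]. *)
  have QU : Q :|: L1 = setT.
    apply/eqP/negPn/negP => QU.
    have := tecP _ tT (Q :|: L1) _ QU; have := tec_in tT (X := Q :&: L1) (u := a1) (v := x1).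
    rewrite !inE a1Q a1L1 (negbTE x1L1) andbF => /(_ isT isT) k1 k2.
    have {}k2 : 1 < bdry (E ++ R) (Q :|: L1).
      by apply: k2; apply/set0Pn; exists a1; rewrite inE a1Q.
    have := bdry_submod (E ++ R) Q L1; rewrite cQ cL1 => k3.
    have QI : Q :&: L1 = L.
      apply: mL; last by rewrite subIset // QL.
      apply/existsP; exists x1; apply/existsP; exists a1.
      rewrite lk1 /bad cB !inE a1Q a1L1 (negbTE x1L1) andbF /=.
      apply/andP; split; first by apply/eqP; move: k1 k2 k3; clear; lia.
      by apply: contra sL1 => /subset_trans; apply; exact: subsetIr.
    by have := subsetP QL _ x1Q; rewrite -QI inE (negbTE x1L1) andbF.
  exists (~: L1).
    apply/and3P; split.
    - apply: subset_trans QL; apply/subsetP => v; rewrite inE => vL1.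
      by have := in_setT v; rewrite -QU inE (negbTE vL1) orbF.
    - by rewrite bdryC cL1.
    - apply/existsP; exists x1; apply/existsP; exists a1.
      rewrite lk1 !inE x1L1 a1L1 /=; move/subsetPn: sL1 => [m ma mL1].
      by apply/set0Pn; exists m; rewrite in_setI ma inE mL1.
  rewrite properE; apply/andP; split.
    apply/subsetP => v; rewrite inE => vL1.
    by have := in_setT v; rewrite -QU inE (negbTE vL1) orbF.
  by apply/subsetPn; exists a1; rewrite // inE a1L1.
have [r rR rL] := bad_inner tT lk bL.
have [_ /eqP cL _ _ _] := and5P bL.
have [M0 DM0 _] := inner L r (subxx L) cL rR rL.
have [M [/and3P [ML /eqP cM /existsP [x1 /existsP [a1 /and4P [lk1 x1M a1M /set0Pn [m mI]]]]] _ mM]] := min_set DM0.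
move: mI; rewrite !inE => /andP [a1m mM'].
have nca : ~~ conn E x1 a1.
  by case/orP: lk1 => /nc //=; rewrite conn_sym.
(* Without such a link, one edge of [E] and one virtual link leave [M]; but the parts of [M] in the
   components of [x1] and of [a1] each need their own edge of [E]. *)
have [r' r'R r'M] : exists2 r, r \in R & (r.1 \in M) && (r.2 \in M).
  apply/hasP/negPn/negP => /hasPn noin.
  have cE1 : 0 < bdry E M by rewrite conn_sym in a1m; apply: conn_cut a1m mM' a1M.
  have cR1 : 0 < bdry R M.
    by rewrite -bdryC; apply: linked_cr lk1 _ _; rewrite inE ?x1M ?a1M.
  have [cE cR] : bdry E M = 1 /\ bdry R M = 1 by move: cM cE1 cR1; rewrite bdry_cat; clear; lia.
  have : 1 < bdry (E ++ R) (M :&: comp E x1).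
    by apply: (tec_in tT (u := x1) (v := a1)); rewrite in_setI ?x1M ?comp_refl // (negbTE a1M).
  rewrite bdry_cat.
  have k1 : bdry R (M :&: comp E x1) <= bdry R M.
    apply: sum_le_in => p q pq; have := noin _ pq; rewrite /cr /= !in_setI.
    by case: (p \in M); case: (q \in M); case: (p \in comp E x1); case: (q \in comp E x1).
  have k2 : 0 < bdry E (M :&: comp E a1).
    apply: (conn_cut (u := m) (v := a1)); rewrite ?in_setI ?mM' ?inE ?a1m //.
      by rewrite conn_sym.
    by rewrite (negbTE a1M).
  have : bdry E (M :&: comp E x1) + bdry E (M :&: comp E a1) <=
         bdry E M + 2 * bdry E (comp E x1) + 2 * bdry E (comp E a1).
    rewrite /bdry !big_distrr -!big_split; apply: sum_le => p q.
    have dis v : ~~ ((v \in comp E x1) && (v \in comp E a1)).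
      rewrite !inE; apply/negP => /andP [h1 h2]; move/negP: nca; apply.
      by rewrite conn_sym in h2; apply: conn_trans h1 h2.
    have := dis p; have := dis q; rewrite /cr /= !in_setI.
    by case: (p \in M); case: (q \in M); case: (p \in comp E x1); case: (q \in comp E x1);
       case: (p \in comp E a1); case: (q \in comp E a1).
  by rewrite !bdry_comp cE; rewrite cR in k1; move: k1 k2; clear; lia.
have [M2 DM2] := inner M r' ML cM r'R r'M.
by rewrite properE => /andP [M2M]; rewrite (mM _ DM2 M2M) subxx.
Qed.

Definition good E T x a := [forall X : {set V}, ~~ bad E T x a X].

Lemma valid_rem E F L t : t \in L -> valid E F L ->
  tec (E ++ unzip1 (rem t L)) -> valid E F (rem t L).
Proof.
move=> tL [_ v l] h; split => //.
  by apply/allP => u /mem_rem /(allP v).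
move=> f; apply: leq_trans (l f).
by rewrite {2}/load (big_rem t) //= leq_addl.
Qed.

Lemma progress E F L : valid E F L -> ~~ tec E ->
  (exists2 L', valid E F L' & smaller E L' L) \/
  (exists x a W L0, [/\ perm_eq L ((x, a, W) :: L0),
     a \notin blk E x, good E (E ++ unzip1 L) x a & good E (E ++ unzip1 L) a x]).
Proof.
move=> vL nE; have [tT vk ld] := vL.
case: (boolP (has (fun t => tec (E ++ unzip1 (rem t L))) L)) => [/hasP [t tL h]|/hasPn nonred].
  left; exists (rem t L); first exact: valid_rem.
  by rewrite /smaller size_rem // ltn_predL; case: L tL {vL tT vk ld h}.
have nred x a W : (x, a, W) \in L -> a \notin blk E x.
  move=> tL; have := nonred _ tL => /not_tec [X [X0 XT cX]].
  have := tecP _ tT X X0 XT.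
  have pu : perm_eq (unzip1 L) ((x, a) :: unzip1 (rem (x, a, W) L)).
    by have := perm_map fst (perm_to_rem tL).
  rewrite bdry_cat (bdry_perm _ pu) bdry_cons addnCA -bdry_cat => c2.
  have cr1 : cr X (x, a) by case h: (cr X (x, a)) c2 => //; rewrite add0n ltnNge cX.
  apply/blkP => /(_ X cr1); rewrite ltnNge => /negP; apply.
  by apply: leq_trans cX; rewrite bdry_cat leq_addr.
case: (boolP (has (fun t => conn E t.1.1 t.1.2) L)) => [/hasP [[[s a] W] tL /= csa]|/hasPn nc].
  have naB := nred _ _ _ tL.
  have pL := perm_to_rem tL; set L0 := rem _ _ in pL.
  have vL1 := perm_valid pL vL.
  have sm L1 L' : perm_eq L1 L -> smaller E L' L1 -> smaller E L' L.
    by move=> p; rewrite /smaller (perm_size p) /spread (perm_big _ p).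
  have [ca|ca] := eqVneq (bdry E (blk E a)) 2.
    have [|L' vL' sL'] := float_progress vL1 csa _ ca; first by rewrite blk_sym.
    by left; exists L' => //; apply: sm sL'; rewrite perm_sym.
  have [cs|cs] := eqVneq (bdry E (blk E s)) 2.
    have vL2 : valid E F ((a, s, W) :: L0).
      case: vL1 => tT1 vk1 ld1; split.
      - apply/tecP => X X0 XT; have := tecP _ tT1 X X0 XT.
        by rewrite !bdry_cat !bdry_cons cr_sym.
      - by move: vk1; rewrite /= vok_flip.
      - by move=> f; have := ld1 f; rewrite !load_cons.
    have [||L' vL' sL'] := float_progress vL2 _ _ cs; [by rewrite conn_sym|exact: naB|].
    left; exists L' => //.
    have : smaller E L' ((s, a, W) :: L0).
      move: sL'; rewrite /smaller /spread !big_cons /= span_flip.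
      by [].
    by apply: sm; rewrite perm_sym.
  (* Neither block has exactly two leaving edges, so no set is bad for either end. *)
  right; exists s, a, W, L0; split => //; apply/forallP => X; rewrite /bad.
    by rewrite (negbTE ca).
  by rewrite (negbTE cs).
case: (boolP (has (fun t => good E (E ++ unzip1 L) t.1.1 t.1.2 &&
                            good E (E ++ unzip1 L) t.1.2 t.1.1) L)) =>
    [/hasP [[[s a] W] tL /= /andP [g1 g2]]|/hasPn allbad].
  right; exists s, a, W, (rem (s, a, W) L); split => //; last exact: nred tL.
  exact: perm_to_rem.
exfalso; apply: (no_all_bad tT).
- by apply: contraNneq nE => u0; rewrite u0 cats0 in tT.
- by move=> r /mapP [t tL ->]; exact: nc.
- move=> r /mapP [[[x a] W] tL ->] /=; have := allbad _ tL; rewrite negb_and /= !negb_forall.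
  case/orP => /existsP [X]; rewrite negbK => b; [exists x, a, X|exists a, x, X]; split => //.
    by left.
  by right.
Qed.

Lemma good_link_exists E F L : valid E F L -> ~~ tec E ->
  exists L' x a W L0, [/\ valid E F L', perm_eq L' ((x, a, W) :: L0),
     a \notin blk E x, good E (E ++ unzip1 L') x a & good E (E ++ unzip1 L') a x].
Proof.
move=> + nE; move sE: (size L) => n; move mE: (spread E L) => m.
elim/ltn_ind: n m L sE mE => n IHn; elim/ltn_ind => m IHm L sE mE vL.
have [[L' vL' /orP [sL|/andP [/eqP sL mL]]]|[x [a [W [L0 [h1 h2 h3 h4]]]]]] := progress vL nE.
- by apply: (IHn (size L') _ _ L' erefl erefl vL'); rewrite -sE.
- by apply: (IHm (spread E L') _ L' _ erefl vL'); rewrite -?mE ?sL.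
- by exists L, x, a, W, L0.
Qed.

(** * Exchanging one group of links *)

Definition mk (e : V * V) : {set V} := [set e.1; e.2].
Definition ncr (F : {set {set V}}) X := #|[set f in F | crs X f]|.
Definition isplit E F :=
  forall X, X != set0 -> X != setT -> 1 < bdry E X + ncr F X.

Lemma mk_seq (l : seq {set V}) : (forall f, f \in l -> exists x y, f = [set x; y]) ->
  exists s, map mk s = l.
Proof.
elim: l => [|f l IH] h; first by exists [::].
have [s <-] := IH (fun g gl => h g (mem_behead (s := f :: l) gl)).
by have [x [y ->]] := h f (mem_head _ _); exists ((x, y) :: s).
Qed.

Lemma ncrE F X : ncr F X = \sum_(f in F) crs X f.
Proof.
rewrite /ncr -sum1_card big_mkcond [RHS]big_mkcond; apply: eq_bigr => f _.
by rewrite inE; case: (f \in F); case: crs.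
Qed.

Lemma bdry_mk s X : bdry s X = \sum_(f <- map mk s) crs X f.
Proof. by rewrite /bdry big_map; apply: eq_bigr => -[x y] _; rewrite /mk crsE. Qed.

Lemma initial_valid E F : (forall f, f \in F -> exists x y, f = [set x; y]) ->
  isplit E F -> exists L, valid E F L.
Proof.
move=> F2 spl; have [|s sE] := @mk_seq (enum F); first by move=> f; rewrite mem_enum; apply: F2.
exists [seq (e, [set mk e]) | e <- s].
have u1 : unzip1 [seq (e, [set mk e]) | e <- s] = s.
  by rewrite /unzip1 -map_comp map_id_in.
split.
- apply/tecP => X X0 XT; rewrite u1 bdry_cat (bdry_mk s) sE big_enum -ncrE.
  exact: spl.
- apply/allP => t /mapP [[x y] _ ->]; rewrite /vok /=.
  have h : hop E [set mk (x, y)] x y.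
    by apply/existsP; exists [set x; y]; rewrite inE eqxx covsE; apply/covP.
  rewrite connect1 //=; apply/implyP => c; apply: connect1.
  by rewrite /hopc h.
- move=> f; rewrite /load big_map.
  have -> : \sum_(e <- s) (f \in [set mk e]) = \sum_(g <- map mk s) (f == g).
    by rewrite big_map; apply: eq_bigr => e _; rewrite inE.
  rewrite sE big_enum /=; case fF: (f \in F).
    by rewrite (bigD1 f) //= eqxx big1 // => g /andP [_ /negbTE]; rewrite eq_sym => ->.
  by rewrite big1 // => g gF; case: eqP => // fg; rewrite fg gF in fF.
Qed.

Lemma load_sum L (P : {set V} -> nat) :
  \sum_f load L f * P f = \sum_(t <- L) \sum_(f in t.2) P f.
Proof.
rewrite /load; under eq_bigr => f _ do rewrite big_distrl /=.
rewrite exchange_big /=; apply: eq_bigr => t _; rewrite [RHS]big_mkcond /=.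
by apply: eq_bigr => f _; case: (f \in t.2); rewrite ?mul1n ?mul0n.
Qed.

(** [U] holds the links of all virtual links but one, whose ends are free. On a tight cut the others
    are matched by distinct links of [U]. More is needed only on a cut of size two that [(x, a)]
    crosses; such a cut has one token on either side, so any chain from token to token crosses
    it. *)
Lemma group_exists E F : (forall f, f \in F -> exists x y, f = [set x; y]) ->
  isplit E F -> ~~ tec E ->
  exists (S S' : {set V}) (W U : {set {set V}}) x a, [/\ token E S, token E S', x \in S, a \in S' & a \notin blk E x] /\
   [/\ W \subset F, U \subset F, [disjoint U & W], connect (hop E W) x a &
   forall W', [disjoint U & W'] ->
     (exists x' a', [/\ x' \in S, a' \in S' & connect (hop E W') x' a']) ->
     isplit E (U :|: W')].
Proof.
move=> F2 spl nE; have [L vL] := initial_valid F2 spl.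
have {L vL} [L [x [a [W [L0 [vL pL naB gxa gax]]]]]] := good_link_exists vL nE.
have [tT _ _] := vL.
have pT : perm_eq (E ++ unzip1 L) ((x, a) :: E ++ unzip1 L0).
  have p1 : perm_eq (unzip1 L) ((x, a) :: unzip1 L0) by have := perm_map fst pL.
  have := perm_catCA [:: (x, a)] E (unzip1 L0) => /permEl; rewrite perm_sym.
  by apply: perm_trans; rewrite perm_cat2l.
have [_ /= /andP [vt vk] ld] := perm_valid pL vL.
pose tok u : {set V} := if bdry E (blk E u) == 2 then comp E u else blk E u.
have tokP u : token E (tok u).
  by rewrite /tok; case: eqP => [_|/eqP]; [exact: token_comp|exact: token_blk].
have tok_in u : u \in tok u.
  by rewrite /tok; case: eqP => _; rewrite ?comp_refl ?blk_refl.
(* A tight set never splits a block, and [good] keeps it from splitting the component. *)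
have tok_sub u v Y : good E (E ++ unzip1 L) v u -> u \in Y -> v \notin Y ->
    bdry E Y <= 1 -> bdry (E ++ unzip1 L) Y = 2 -> tok u \subset Y.
  move=> /forallP g uY vY c1 c2; have := g Y; rewrite /bad c2 uY vY /tok /=.
  by case: eqP => _ /=; rewrite ?negbK // => _; apply: blk_sub.
pose U := [set f | 0 < load L0 f].
exists (tok x), (tok a), W, U, x, a; split; split => //.
- by apply/subsetP => f fW; have := ld f; rewrite load_cons /= fW; case: (f \in F).
- apply/subsetP => f; rewrite inE => f0; have := ld f; rewrite load_cons.
  by case: (f \in F) => //; rewrite leqn0 addn_eq0 => /andP [_ /eqP l0]; rewrite l0 in f0.
- rewrite disjoint_subset; apply/subsetP => f; rewrite !inE => f0.
  apply/negP => fW; have := ld f; rewrite load_cons /= fW.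
  by case: (f \in F) => //; move: f0; case: (load L0 f).
- by case/andP: vt.
move=> W' dUW' [x' [a' [x'S a'S cW']]] X X0 XT.
have cU Y : bdry E Y <= 1 -> bdry (unzip1 L0) Y <= ncr U Y.
  move=> cY; rewrite ncrE.
  have h : \sum_f load L0 f * crs Y f <= \sum_(f in U) crs Y f.
    rewrite [leqRHS]big_mkcond; apply: leq_sum => f _; rewrite inE.
    have := ld f; rewrite load_cons; case: (load L0 f) => [|[|k]] //=.
      by rewrite mul1n.
    by case: (f \in W); case: (f \in F).
  apply: leq_trans h; rewrite load_sum /bdry /unzip1 big_map big_seq [leqRHS]big_seq.
  apply: leq_sum => -[[u v] Wt] tL0 /=; case cuv: (cr Y (u, v)) => //.
  have /andP [ct _] := allP vk _ tL0.
  have [f fW cf] := connect_hop_cut ct cuv cY.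
  by rewrite (bigD1 f) //= cf.
have dsum Y : ncr (U :|: W') Y = ncr U Y + ncr W' Y.
  by rewrite !ncrE -(bigU _ _ _ dUW'); apply: eq_bigl => f; rewrite in_setU.
rewrite dsum.
have cT : 1 < cr X (x, a) + (bdry E X + bdry (unzip1 L0) X).
  by have := tecP _ tT X X0 XT; rewrite (bdry_perm _ pT) bdry_cons bdry_cat.
case: (ltnP 1 (bdry E X)) => c1; first by rewrite (leq_trans c1) // leq_addr.
have cU1 := cU _ c1.
case: (ltnP 1 (bdry E X + bdry (unzip1 L0) X)) => c2.
  by move: c2 cU1; clear; lia.
have cxa : cr X (x, a) by case h: (cr X (x, a)) cT => //; rewrite add0n ltnNge c2.
suff [f fW' cf] : exists2 f, f \in W' & crs X f.
  have : 0 < ncr W' X by apply/card_gt0P; exists f; rewrite inE fW' cf.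
  by move: cT cU1; rewrite cxa; clear; lia.
apply: (connect_hop_cut cW' _ c1).
have [Y [aY xY crY bdryY]] : exists Y, [/\ a \in Y, x \notin Y, (forall e, cr Y e = cr X e) &
    forall E, bdry E Y = bdry E X] by apply: cr_side; rewrite cr_sym.
have cTY : bdry (E ++ unzip1 L) Y = 2.
  by rewrite bdryY (bdry_perm _ pT) bdry_cons bdry_cat cxa; move: cT c2; rewrite cxa; clear; lia.
have c1Y : bdry E Y <= 1 by rewrite bdryY.
have a'Y : a' \in Y := subsetP (tok_sub a x Y gxa aY xY c1Y cTY) _ a'S.
have x'Y : x' \in ~: Y.
  by apply: (subsetP (tok_sub x a (~: Y) gax _ _ _ _)); rewrite ?bdryC ?inE ?negbK.
by rewrite -crY /cr /= a'Y; move: x'Y; rewrite inE => /negbTE ->.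
Qed.

(* Distinct leaf blocks use distinct link ends. *)
Lemma leaf_count E F (s : seq V) : (forall f, f \in F -> exists x y, f = [set x; y]) ->
  isplit E F -> ~~ tec E -> uniq s -> (forall l, l \in s -> leaf E l) ->
  (forall l l', l \in s -> l' \in s -> l' \in blk E l -> l = l') ->
  size s <= 2 * #|F|.
Proof.
move=> F2 spl nE us ls inj.
have [|q qE] := @mk_seq (enum F); first by move=> f; rewrite mem_enum; apply: F2.
pose ends := map fst q ++ map snd q.
pose rep v := [seq l <- s | v \in blk E l].
have -> : 2 * #|F| = size (flatten (map (fun v => take 1 (rep v)) ends)) +
     (2 * #|F| - size (flatten (map (fun v => take 1 (rep v)) ends))).
  rewrite subnKC // size_flatten /shape -map_comp.
  have sq : size q = #|F| by rewrite cardE -qE size_map.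
  have -> : 2 * #|F| = size ends by rewrite /ends size_cat !size_map sq mul2n addnn.
  elim: (ends) => //= v l IH; rewrite -[leqRHS]add1n leq_add //.
  by rewrite size_take; case: ifP => // /negbT; rewrite -leqNgt.
apply: leq_trans (leq_addr _ _); apply: uniq_leq_size us _ => l lS.
have lB := blk_refl E l.
(* If one block were everything, [E] would be 2-edge-connected. So the leaf block is a proper cut,
   and some link has to leave it. *)
have BT : blk E l != setT.
  apply: contra nE => /eqP BT; apply/tecP => X X0 XT.
  have [u uX] := set0Pn _ X0.
  have [v vX] : exists v, v \notin X.
    apply/existsP; rewrite -negb_forall; apply: contra XT => /forallP h.
    by apply/eqP/setP => v; rewrite inE h.
  have /blkP : v \in blk E u by rewrite (blk_eq (_ : u \in blk E l)) BT inE.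
  by apply; rewrite /cr /= uX (negbTE vX).
have B0 : blk E l != set0 by apply/set0Pn; exists l.
have := spl _ B0 BT => c2.
have : 0 < ncr F (blk E l) by have := ls _ lS; rewrite /leaf; move: c2; clear; lia.
move=> /card_gt0P [f]; rewrite inE => /andP [fF cf].
have : f \in map mk q by rewrite qE mem_enum.
move=> /mapP [[x y] xq fE]; move: cf; rewrite fE /mk crsE /= => cxy.
have [v vE vB] : exists2 v, v \in ends & v \in blk E l.
  move: cxy; rewrite /cr /=; case xB: (x \in _) => /= yB.
    by exists x => //; rewrite mem_cat (map_f fst xq).
  by exists y => //; rewrite mem_cat (map_f snd xq) orbT.
apply/flattenP; exists (take 1 (rep v)); first exact: map_f.
have : l \in rep v by rewrite mem_filter vB lS.
case rE: (rep v) => [|l' r] // _.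
have : l' \in rep v by rewrite rE mem_head.
rewrite mem_filter => /andP [vB' l'S].
rewrite /= take0 inE; apply/eqP; apply: inj => //.
by rewrite blk_sym; apply: blk_trans vB' _; rewrite blk_sym.
Qed.

(** * Tight cuts from the multiplicity matrix *)

Definition eqpair (y z i j : V) := ((y == i) && (z == j)) || ((y == j) && (z == i)).
Definition mult E i j := count (fun e => eqpair e.1 e.2 i j) E.

Lemma eqp_mk (y z i j : V) : eqpair y z i j = ([set y; z] == [set i; j]).
Proof.
apply/idP/eqP => [/orP [] /andP [/eqP -> /eqP ->] //|h]; first exact: finset.setUC.
have yi : y \in [set i; j] by rewrite -h !inE eqxx.
have zi : z \in [set i; j] by rewrite -h !inE eqxx orbT.
have iy : i \in [set y; z] by rewrite h !inE eqxx.
have jy : j \in [set y; z] by rewrite h !inE eqxx orbT.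
rewrite /eqpair; move: yi zi iy jy; rewrite !inE ![i == _]eq_sym ![j == _]eq_sym.
by case: (y == i); case: (y == j); case: (z == i); case: (z == j).
Qed.

(* Adjacency after the removal of one copy of [{i, j}] and the addition of [{x, a}]. *)
Definition adj (M : V -> V -> nat) i j x a : rel V :=
  fun y z => (eqpair y z i j < M y z) || eqpair y z x a.

Lemma eqpairC y z i j : eqpair y z i j = eqpair z y i j.
Proof. by rewrite /eqpair orbC andbC [(z == j) && _]andbC. Qed.

Lemma eqpair_cr X y z i j : eqpair y z i j -> cr X (y, z) = cr X (i, j).
Proof. by case/orP => /andP [/eqP -> /eqP ->] //; rewrite cr_sym. Qed.

Lemma multC E i j : mult E i j = mult E j i.
Proof. by apply: eq_count => e; rewrite /eqpair orbC. Qed.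

Lemma adj_sym E i j x a : symmetric (adj (mult E) i j x a).
Proof. by move=> y z; rewrite /adj multC !(eqpairC y). Qed.

Lemma eqpair_sub E X y z : cr X (y, z) -> mult E y z <= bdry E X.
Proof.
move=> c; rewrite bdryE; apply: sub_count => e h; case: e h => p q /=.
by rewrite /= => h; rewrite (eqpair_cr X h).
Qed.

Lemma connect_side (r : rel V) X u v : connect r u v -> cr X (u, v) -> symmetric r ->
  exists y z, [/\ r y z & cr X (y, z)].
Proof.
move=> /connectP [p]; elim: p u => [|w p IH] u /=; first by move=> _ ->; rewrite crxx.
move=> /andP [uw pp] l c rs; have /orP [cuw|cw] := cr_trans w c; last exact: IH pp l cw rs.
by exists u, w.
Qed.

(** At most one edge leaves a tight set, and after its removal nothing does; conversely, what is
    reached from [u] after the removal of one edge is tight, unless the added link leaves it. So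
    quadratically many reachability tests replace the quantifier over sets. *)
Lemma cov_adj E u v x a :
  cov E (u, v) (x, a) = [forall i, forall j, connect (adj (mult E) i j x a) u v].
Proof.
apply/covP/forallP => [h i|h X c c1].
- apply/forallP => j; apply/negPn/negP => nuv.
  pose X := [set w | connect (adj (mult E) i j x a) u w].
  have clos y z : adj (mult E) i j x a y z -> (y \in X) = (z \in X).
    move=> yz; rewrite !inE; apply/idP/idP => k; apply: connect_trans k (connect1 _) => //.
    by rewrite adj_sym.
  have cX : cr X (u, v) by rewrite /cr /= !inE connect0 (negbTE nuv).
  have ncl y z : cr X (y, z) -> adj (mult E) i j x a y z = false.
    by rewrite /cr /= => k; apply/negP => /clos e; rewrite e addbb in k.
  have : cr X (x, a).
    apply: h => //.
    have H e : e \in E -> cr X e -> eqpair e.1 e.2 i j /\ mult E i j <= 1.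
      case: e => y z eE k; have := ncl _ _ k; rewrite /adj => /norP [].
      rewrite -leqNgt => m1 _.
      have m0 : 0 < mult E y z by rewrite -has_count; apply/hasP; exists (y, z); rewrite // /eqpair /= !eqxx.
      have e1 : eqpair y z i j by move: m1 m0; case: (eqpair y z i j) => //; case: (mult E y z).
      split=> //; rewrite (leq_trans _ (_ : mult E y z <= 1)) //; last by rewrite e1 in m1.
      apply: sub_count => -[p q] /=; rewrite /eqpair.
      by case/orP: e1 => /andP [/eqP -> /eqP ->] //; rewrite orbC.
    case: (ltnP 0 (bdry E X)) => [/bdry_gt0P [e eE ce]|]; last by move/leq_trans; apply.
    have [_ m1] := H e eE ce; apply: leq_trans m1; rewrite bdryE /mult.
    have -> : count (cr X) E = count (fun e => (e \in E) && cr X e) E.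
      by apply: eq_in_count => g ->.
    by apply: sub_count => g /= /andP [gE cg]; have [] := H g gE cg.
  by move/ncl; rewrite /adj /eqpair !eqxx orbT.
- pose e := head (u, u) [seq e <- E | cr X e].
  have := forallP (h e.1) e.2 => /connect_side /(_ c (@adj_sym E e.1 e.2 x a)) [y [z [yz cyz]]].
  case/orP: yz => [|/(eqpair_cr X) <-] // m.
  have m1 := eqpair_sub E cyz.
  have c2 := leq_trans m1 c1.
  have ey : eqpair y z e.1 e.2.
    have m0 : 0 < mult E y z by apply: leq_ltn_trans m.
    have : has (fun g => eqpair g.1 g.2 y z) E by rewrite has_count.
    case/hasP => g gE ge; have cg : cr X g by case: g ge {gE} => p q /= /(eqpair_cr X) ->.
    have : e \in [seq e <- E | cr X e].
      rewrite /e; have : g \in [seq e <- E | cr X e] by rewrite mem_filter cg gE.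
      by case: [seq e <- E | cr X e] => // g' l _; rewrite mem_head.
    rewrite mem_filter => /andP [ce eE].
    have c11 : bdry E X = 1.
      by apply/eqP; rewrite eqn_leq c1 /=; apply/bdry_gt0P; exists g.
    have eg := bdry1_unique c11 eE gE ce cg; rewrite eg.
    by move: ge; rewrite /eqpair ![_ == y]eq_sym ![_ == z]eq_sym [(z == _) && _]andbC.
  by rewrite ey ltnNge c2 in m.
Qed.

(** Removing or adding a loop changes no cut, so the same routine also computes components. *)
Lemma conn_adj E u v w : conn E u v = connect (adj (mult E) w w w w) u v.
Proof.
apply/connP/idP => [h|/connect_side h X c].
- apply/negPn/negP => nuv.
  pose X := [set z | connect (adj (mult E) w w w w) u z].
  have := h X; rewrite /cr /= !inE connect0 (negbTE nuv) => /(_ isT) /bdry_gt0P [[y z] eE].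
  have yz : adj (mult E) w w w w y z.
    rewrite /adj; have : 0 < mult E y z.
      by rewrite -has_count; apply/hasP; exists (y, z); rewrite // /eqpair /= !eqxx.
    by case: (eqpair y z w w); rewrite ?orbT // => ->.
  rewrite /cr /= !inE.
  have -> : connect (adj (mult E) w w w w) u y = connect (adj (mult E) w w w w) u z.
    apply/idP/idP => k; apply: connect_trans k (connect1 _) => //.
    by rewrite adj_sym.
  by rewrite addbb.
- have [y [z [yz cyz]]] := h X c (@adj_sym E w w w w).
  apply: leq_trans (eqpair_sub E cyz); case/orP: yz => [m|/(eqpair_cr X)]; first exact: leq_ltn_trans m.
  by rewrite cyz crxx.
Qed.

(** * Chains *)

(* Each link of a chain covers all the tight cuts between two consecutive stations, the
   first one being [u] and the last one [v]. *)
Fixpoint chain E u (ls : seq (V * V)) v : bool :=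
  if ls is l :: ls' then [exists m, cov E (u, m) l && chain E m ls' v] else u == v.

Lemma chain_cat E u l1 l2 v :
  chain E u (l1 ++ l2) v = [exists m, chain E u l1 m && chain E m l2 v].
Proof.
elim: l1 u => [|l l1 IH] u /=.
  apply/idP/existsP => [c|[m /andP [/eqP -> //]]].
  by exists u; rewrite eqxx.
apply/existsP/existsP => [[m /andP [c]]|[m /andP [/existsP [k /andP [c1 c2] c3]]]].
  rewrite IH => /existsP [k /andP [c1 c2]]; exists k; rewrite c2 andbT.
  by apply/existsP; exists m; rewrite c c1.
by exists k; rewrite c1 IH; apply/existsP; exists m; rewrite c2 c3.
Qed.

Lemma chain_rcons E u ls l v :
  chain E u (rcons ls l) v = [exists m, chain E u ls m && cov E (m, v) l].
Proof.
rewrite -cats1 chain_cat; apply: eq_existsb => m /=; congr (_ && _).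
apply/existsP/idP => [[k /andP [c /eqP <-]] //|c]; by exists v; rewrite c eqxx.
Qed.

Lemma cov_blk_trans E e u u' v : u' \in blk E u -> cov E (u', v) e -> cov E (u, v) e.
Proof.
move=> /blkP b /covP h; apply/covP => X c c1; apply: h => //.
by have /orP [/b|//] := cr_trans u' c; rewrite ltnNge c1.
Qed.

Lemma chain_blk E u u' ls v : u' \in blk E u -> ls != [::] ->
  chain E u' ls v -> chain E u ls v.
Proof.
case: ls => // l ls b _ /= /existsP [m /andP [c1 c2]]; apply/existsP; exists m.
by rewrite c2 (cov_blk_trans b).
Qed.

Lemma chain_blk_end E u ls v v' : v' \in blk E v -> ls != [::] ->
  chain E u ls v' -> chain E u ls v.
Proof.
move=> b; case/lastP: ls => // ls l _; rewrite !chain_rcons => /existsP [m /andP [c1 c2]].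
apply/existsP; exists m; rewrite c1 cov_sym.
by rewrite cov_sym in c2; apply: cov_blk_trans b c2.
Qed.

(** A tight set around [x] missing both ends of [e] would contain [u], and a tight set separating
    [u] from [x] would split it into two parts that are not tight, against [bdry_split]. So [x] lies
    on the path of [e]. *)
Lemma cov_end E x u e : u \notin blk E x -> cov E (x, u) e -> cov E (x, e.1) e.
Proof.
case: e => p q /= /notin_blk [Y0 [uY0 xY0 cY0]] /covP h; apply/covP => X0 /cr_side.
move=> [X [xX pX crX bdryX]]; rewrite -bdryX => cX; rewrite -crX; apply/negPn/negP.
rewrite /cr /= (negbTE pX) /= => qX.
have uX : u \in X.
  by apply/negPn/negP => uX; have := h X; rewrite /cr /= xX (negbTE uX) (negbTE pX) (negbTE qX) => /(_ isT cX).
have small (Z : {set V}) : Z \subset X -> cr Z (x, u) -> 1 < bdry E Z.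
  move=> ZX cZ; rewrite ltnNge; apply/negP => /(h Z cZ); rewrite /cr /=.
  by rewrite !(contraNF (subsetP ZX _)).
have s1 : 1 < bdry E (X :&: Y0).
  by apply: small (subsetIl _ _) _; rewrite /cr /= !inE xX uX uY0 (negbTE xY0).
have s2 : 1 < bdry E (X :\: Y0).
  by apply: small (subsetDl _ _) _; rewrite /cr /= !inE xX uX uY0 (negbTE xY0).
by have := bdry_split E X Y0; move: cX cY0 s1 s2; clear; lia.
Qed.

(** Neither hop stays within a block, so [cov_end] puts [u] and [v1] on the path of [e]. *)
Lemma cov_join E e u u1 v v1 : u1 \notin blk E u -> v1 \notin blk E v ->
  cov E (u, u1) e -> cov E (v, v1) e -> cov E (u, v1) e.
Proof.
move=> nu nv c1 c2; have /covP h1 := cov_end nu c1.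
rewrite cov_sym in c2; rewrite blk_sym in nv; have /covP h2 := cov_end nv c2.
apply/covP => X c cX; have /orP [k|k] := cr_trans e.1 c; first exact: h1.
by apply: h2 => //; rewrite cr_sym.
Qed.

Lemma hop_chain E W x a : (forall f, f \in W -> exists u v, f = [set u; v]) ->
  connect (hop E W) x a ->
  exists2 ls, chain E x ls a & forall f, f \in map mk ls -> f \in W.
Proof.
move=> W2 /connectP [p]; elim: p x => [|y p IH] x /=.
  by move=> _ ->; exists [::] => //=.
move=> /andP [/existsP [f /andP [fW c]] pp] l.
have [ls cls lW] := IH y pp l; have [u [v fE]] := W2 f fW.
exists ((u, v) :: ls) => /=.
  by apply/existsP; exists y; rewrite cls andbT -covsE -fE.
by move=> g; rewrite inE => /orP [/eqP ->|/lW //]; rewrite /mk /= -fE.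
Qed.

Lemma mk_cov E e e' e0 : mk e = mk e' -> cov E e0 e = cov E e0 e'.
Proof.
case: e e' e0 => x y [x' y'] [u v] h.
by rewrite -!covsE; congr covs.
Qed.

(** A shortest chain repeats no link: a use within one block is dropped, and two proper uses are
    merged by [cov_join]. Only then does the chain cost no more than [W]. *)
Lemma uniq_chain E W x a : (forall f, f \in W -> exists u v, f = [set u; v]) ->
  connect (hop E W) x a ->
  exists ls, [/\ chain E x ls a, uniq (map mk ls) & forall f, f \in map mk ls -> f \in W].
Proof.
move=> W2 /(hop_chain W2) [ls0 c0 l0].
pose P k := [exists t : k.-tuple (V * V), chain E x t a && all (mem W) (map mk t)].
have exP : exists k, P k.
  exists (size ls0); apply/existsP; exists (in_tuple ls0); rewrite c0 /=.
  by apply/allP => f /l0.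
have [k /existsP [[ls /= /eqP sz] /= /andP [cls /allP lW]] mink] := ex_minnP exP.
have {}mink ls' : chain E x ls' a -> (forall f, f \in map mk ls' -> f \in W) -> size ls <= size ls'.
  move=> c' l'; rewrite sz; apply: mink; apply/existsP; exists (in_tuple ls').
  by rewrite c' /=; apply/allP => f /l'.
exists ls; split => //; apply/negPn/negP => nu.
have [l1 [e [l2 [e' [l3 [lE me]]]]]] : exists l1 e l2 e' l3,
    ls = l1 ++ e :: l2 ++ e' :: l3 /\ mk e = mk e'.
  elim: (ls) nu => //= e l IH; rewrite negb_and negbK => /orP [/mapP [e' e'l me]|/IH].
    have [l2 l3] := splitPr e'l; by exists [::], e, l2, e', l3.
  by move=> [l1 [e1 [l2 [e' [l3 [-> me]]]]]]; exists (e :: l1), e1, l2, e', l3.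
have sub l : {subset l <= ls} -> forall f, f \in map mk l -> f \in W.
  by move=> s f /mapP [g gl ->]; apply: lW; apply: map_f; apply: s.
move: cls; rewrite lE chain_cat => /existsP [u /andP [cu /= /existsP [u1 /andP [c1]]]].
rewrite chain_cat => /existsP [v /andP [cv /= /existsP [v1 /andP [c2 c3]]]].
have [bu|bu] := boolP (u1 \in blk E u).
  have := mink (l1 ++ l2 ++ e' :: l3); rewrite lE !size_cat /= !size_cat /= => h.
  suff : size l1 + (size l2 + (size l3).+1).+1 <= size l1 + (size l2 + (size l3).+1) by clear; lia.
  apply: h; last by apply: sub => g; rewrite lE !(mem_cat, inE) => /orP [|/orP [|/orP []]] ->; rewrite ?orbT.
  rewrite chain_cat; apply/existsP; exists u; rewrite cu /=.
  apply: (chain_blk bu); first by case: (l2).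
  by rewrite chain_cat; apply/existsP; exists v; rewrite cv /=; apply/existsP; exists v1; rewrite c2.
have [bv|bv] := boolP (v1 \in blk E v).
  have := mink (l1 ++ e :: l2 ++ l3); rewrite lE !size_cat /= !size_cat /= => h.
  suff : size l1 + (size l2 + (size l3).+1).+1 <= size l1 + (size l2 + size l3).+1 by clear; lia.
  apply: h; last by apply: sub => g; rewrite lE !(mem_cat, inE) => /orP [|/orP [|/orP []]] ->; rewrite ?orbT.
  have c4 : chain E x (l1 ++ e :: l2) v.
    by rewrite chain_cat; apply/existsP; exists u; rewrite cu /=; apply/existsP; exists u1; rewrite c1.
  rewrite -cat_cons catA chain_cat; apply/existsP; exists v1; rewrite c3 andbT.
  by apply: chain_blk_end c4; [rewrite blk_sym|case: (l1)].
have := mink (l1 ++ e :: l3); rewrite lE !size_cat /= !size_cat /= => h.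
suff : size l1 + (size l2 + (size l3).+1).+1 <= size l1 + (size l3).+1 by clear; lia.
apply: h; last by apply: sub => g; rewrite lE !(mem_cat, inE) => /orP [|/orP []] ->; rewrite ?orbT.
rewrite chain_cat; apply/existsP; exists u; rewrite cu /=; apply/existsP; exists v1.
by rewrite c3 andbT; apply: cov_join bu bv c1 _; rewrite (mk_cov _ _ me).
Qed.

Lemma chain_hop E u ls v : chain E u ls v -> connect (hop E [set f in map mk ls]) u v.
Proof.
elim: ls u => [|l ls IH] u /=; first by move=> /eqP ->.
move=> /existsP [m /andP [c h]]; apply: (connect_trans (y := m)).
  apply: connect1; apply/existsP; exists (mk l); by rewrite inE mem_head /= covsE; case: (l) c.
apply: connect_hopS (IH m h); apply/subsetP => f; rewrite !inE => ->.
by rewrite orbT.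
Qed.

(** Tight sets do not split blocks, so any vertex of a leaf block can name it. *)
Lemma med_blk E a b c a' b' c' :
  a' \in blk E a -> b' \in blk E b -> c' \in blk E c -> med E a' b' c' = med E a b c.
Proof.
move=> ha hb hc; have side u u' X : u' \in blk E u -> bdry E X <= 1 -> (u' \in X) = (u \in X).
  by move=> h c1; apply: blk_side c1 h.
have cvE u u' v v' m : u' \in blk E u -> v' \in blk E v ->
    cov E (u', m) (u', v') = cov E (u, m) (u, v).
  move=> hu hv; apply: eq_forallb => X; case c1: (bdry E X <= 1); rewrite ?andbF //.
  by rewrite /cr /= (side _ _ _ hu c1) (side _ _ _ hv c1).
by apply/setP => m; rewrite !inE (cvE a a' b b') // (cvE b b' c c') // (cvE c c' a a').
Qed.

Lemma comp_blk E u u' : u' \in blk E u -> comp E u' = comp E u.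
Proof.
move=> /blk_conn h; apply/setP => v; rewrite !inE; apply/idP/idP; first exact: conn_trans.
by apply: conn_trans; rewrite conn_sym.
Qed.

Lemma leaf_blk E u u' : u' \in blk E u -> leaf E u' = leaf E u.
Proof. by rewrite /leaf => /blk_eq ->. Qed.

(** A crossing edge has exactly one end in [X], so the sum over ordered pairs counts it once. *)
Lemma bdry_mult E X : bdry E X = \sum_(y in X) \sum_(z | z \notin X) mult E y z.
Proof.
elim: E => [|e E IH].
  by rewrite /bdry big_nil big1 // => y _; rewrite big1.
rewrite bdry_cons IH /mult.
under [in RHS]eq_bigr => y _ do rewrite /= big_split /=.
rewrite big_split /=; congr (_ + _); case: e => p q /=; rewrite /cr /= /eqpair.
have one u v (f : V -> V -> bool) : (forall y z, f y z = (p == y) && (q == z) || (p == z) && (q == y)) ->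
   u \in X -> v \notin X -> (u = p /\ v = q) \/ (u = q /\ v = p) ->
   \sum_(y in X) \sum_(z | z \notin X) f y z = 1.
  move=> fE uX vX h; rewrite (bigD1 u) //= (bigD1 v) //= big1 ?addn0 => [|z /andP [zX zv]].
    rewrite big1 ?addn0 => [|y /andP [yX yu]].
      by rewrite fE; case: h => -[<- <-]; rewrite !eqxx ?orbT.
    apply: big1 => z zX; rewrite fE; case: h => -[<- <-].
      rewrite eq_sym (negbTE yu) /=; case: eqP => // uz; by rewrite uz (negbTE zX) in uX.
    rewrite [u == y]eq_sym (negbTE yu) andbF orbF.
    by case: eqP => // vy; rewrite vy yX in vX.
  rewrite fE; case: h => -[<- <-].
    rewrite [v == z]eq_sym (negbTE zv) andbF /=; case: eqP => // uz.
    by rewrite -uz uX in zX.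
  rewrite [v == z]eq_sym (negbTE zv) /=.
  rewrite orbF; case: eqP => //= vu; by rewrite vu uX in vX.
have [pX|pX] := boolP (p \in X); have [qX|qX] := boolP (q \in X) => /=.
- rewrite big1 // => y yX; rewrite big1 // => z zX.
  have pz : (p == z) = false by apply: contraNF zX => /eqP <-.
  have qz : (q == z) = false by apply: contraNF zX => /eqP <-.
  by rewrite pz qz andbF.
- by rewrite (one p q) //; left.
- by rewrite (one q p) //; right.
- rewrite big1 // => y yX; rewrite big1 // => z zX.
  have py : (p == y) = false by apply: contraNF pX => /eqP ->.
  have qy : (q == y) = false by apply: contraNF qX => /eqP ->.
  by rewrite py qy andbF.
Qed.

End Cuts.

Require Import Defs.
From mathcomp Require Import all_order all_algebra.
From mathcomp Require Import all_classical all_reals all_analysis.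
Import Order.TTheory GRing.Theory Num.Theory.

(** * The search *)

Section Model.
Variables (R : realType) (n : nat).
Notation V := 'I_n.+1.
Implicit Types (M : V -> V -> nat) (FM : rel V) (E : seq (V * V)) (S : pred V).
Variable cm : V -> V -> \bar R.

Definition covm M u v x a := [forall i, forall j, connect (adj M i j x a) u v].
Definition connm M u v := connect (adj M u u u u) u v.
Definition exits M l :=
  \sum_(y | covm M l y l l) \sum_(z | ~~ covm M l z l l) M y z.
Definition leafrep M l :=
  [forall y, covm M l y l l ==> (l <= y)] && (exits M l <= 1).
Definition leaves M := [seq l <- enum V | leafrep M l].
Definition getleaf M d := nth ord0 (leaves M) d.
Definition tokm M d1 d2 d3 fl (v : V) :=
  let: (l1, l2, l3) := (getleaf M d1, getleaf M d2, getleaf M d3) in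
  if fl == 0 then [&& covm M l1 v l1 l2, covm M l2 v l2 l3 & covm M l3 v l3 l1]
  else connm M l1 v.

(* A table gives, for every vertex, the cheapest chain of links found so far. *)
Definition table := V -> option (\bar R * seq (V * V)).

Definition start (S : pred V) : table := fun v => if S v then Some (0%E, [::]) else None.

Definition relax1 M FM (cur acc : table) (u x a : V) : table := fun v =>
  if cur u is Some (d, ls) then
    if [&& x != a, ~~ FM x a, covm M u v x a &
        if acc v is Some (d', _) then ~~ (d' <= d + cm x a)%E else true]
    then Some ((d + cm x a)%E, rcons ls (x, a)) else acc v
  else acc v.

(** Each round starts from the empty table and not from [cur], so that [w] rounds leave only chains
    of exactly [w] links. *)
Definition relax M FM (cur : table) : table :=
  foldl (fun acc u => foldl (fun acc x => foldl (fun acc a => relax1 M FM cur acc u x a)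
    acc (enum V)) acc (enum V)) (fun=> None) (enum V).

Definition better (S : pred V) (cur : table) acc v : option (\bar R * seq (V * V)) :=
  if cur v is Some (d, ls) then
    if S v && (if acc is Some (d', _) then ~~ (d' <= d)%E else true) then Some (d, ls) else acc
  else acc.

Definition cheapest S S' M FM w :=
  foldl (better S' (iter w (relax M FM) (start S))) None (enum V).

Definition pick_link S S' M FM w j : V * V :=
  if cheapest S S' M FM w is Some (_, ls) then nth (ord0, ord0) ls j else (ord0, ord0).

Definition multF M (F : {set {set V}}) x a := M x a + ([set x; a] \in F).
Definition inF (F : {set {set V}}) : rel V := fun x a => [set x; a] \in F.

(** The length digit may reach [2 * p], but a useful chain has at most [p] links, and [p] can serve
    as a loop bound. The final test discards the default link [(ord0, ord0)]. *)
Definition step p M0 (d : nat -> nat) (F : {set {set V}}) :=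
  let M := multF M0 F in
  let: (x, a) := pick_link (tokm M (d 0) (d 1) (d 2) (d 3)) (tokm M (d 4) (d 5) (d 6) (d 7))
     M (inF F) (minn p (d 8)) (d 9) in
  if (x != a) && ~~ inF F x a then [set x; a] |: F else F.

(* Step [k] reads the digits [d (10 k)], ..., [d (10 k + 9)]. *)
Fixpoint run p M0 (d : nat -> nat) k F :=
  if k is k'.+1 then step p M0 (fun i => d (10 * k' + i)) (run p M0 d k' F) else F.

Lemma covmE E u v x a : covm (mult E) u v x a = cov E (u, v) (x, a).
Proof. by rewrite cov_adj. Qed.

Lemma connmE E u v : connm (mult E) u v = conn E u v.
Proof. by rewrite (conn_adj _ _ _ u). Qed.

Lemma exitsE E l : exits (mult E) l = bdry E (blk E l).
Proof.
rewrite bdry_mult; apply: eq_big => [y|y _]; first by rewrite covmE inE.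
by apply: eq_bigl => z; rewrite covmE inE.
Qed.

Definition okl FM (l : V * V) := (l.1 != l.2) && ~~ FM l.1 l.2.
Definition costl (ls : seq (V * V)) := (\sum_(l <- ls) cm l.1 l.2)%E.

Lemma costl_rcons ls x a : costl (rcons ls (x, a)) = (costl ls + cm x a)%E.
Proof. by rewrite /costl -cats1 big_cat big_seq1. Qed.

Lemma foldl_pairs (T A B : Type) (h : T -> A -> B -> T) z (r : seq A) (s : seq B) :
  foldl (fun acc u => foldl (fun acc x => h acc u x) acc s) z r =
  foldl (fun acc p => h acc p.1 p.2) z [seq (u, x) | u <- r, x <- s].
Proof.
elim: r z => //= u r IH z; rewrite foldl_cat IH; congr foldl.
by elim: s z {IH} => //= x s IH z; rewrite IH.
Qed.

Lemma relaxE M FM cur :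
  relax M FM cur = foldl (fun acc p => relax1 M FM cur acc p.1.1 p.1.2 p.2) (fun=> None)
    [seq (p, a) | p <- [seq (u, x) | u <- enum V, x <- enum V], a <- enum V].
Proof.
rewrite /relax (foldl_pairs (fun acc u x =>
  foldl (fun acc a => relax1 M FM cur acc u x a) acc (enum V))).
exact: (foldl_pairs (fun acc p a => relax1 M FM cur acc p.1 p.2 a)).
Qed.

Lemma triples_all (p : V * V * V) :
  p \in [seq (p, a) | p <- [seq (u, x) | u <- enum V, x <- enum V], a <- enum V].
Proof.
case: p => [[u x] a]; apply/allpairsP; exists ((u, x), a); split; rewrite ?mem_enum //.
by apply/allpairsP; exists (u, x); rewrite !mem_enum.
Qed.

Lemma foldl_inv (T A : Type) (P : T -> Prop) (h : T -> A -> T) (l : seq A) z :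
  P z -> (forall acc p, P acc -> P (h acc p)) -> P (foldl h z l).
Proof. by move=> + hh; elim: l z => //= p l IH z pz; apply: IH; apply: hh. Qed.

Lemma foldl_reach (T : Type) (A : eqType) (P : T -> Prop) (h : T -> A -> T) (l : seq A) z p :
  p \in l -> (forall acc, P (h acc p)) -> (forall acc q, P acc -> P (h acc q)) ->
  P (foldl h z l).
Proof.
move=> + h1 h2; elim: l z => //= q l IH z; rewrite inE => /orP [/eqP <-|/IH //].
exact: foldl_inv.
Qed.

Lemma relax_sound M FM cur v d ls : relax M FM cur v = Some (d, ls) ->
  exists u d0 ls0 x a, [/\ cur u = Some (d0, ls0), x != a, ~~ FM x a & covm M u v x a] /\
     d = (d0 + cm x a)%E /\ ls = rcons ls0 (x, a).
Proof.
move: d ls; rewrite relaxE; apply: (foldl_inv (P := fun T : table => forall d ls,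
  T v = Some (d, ls) -> exists u d0 ls0 x a,
    [/\ cur u = Some (d0, ls0), x != a, ~~ FM x a & covm M u v x a] /\
    d = (d0 + cm x a)%E /\ ls = rcons ls0 (x, a))) => // acc [[u x] a] IH d ls /=.
rewrite /relax1; case cu: (cur u) => [[d0 ls0]|]; last exact: IH.
case: ifP => [/and4P [h1 h2 h3 _] [<- <-]|_]; last exact: IH.
by exists u, d0, ls0, x, a.
Qed.

Lemma relax_complete M FM cur v u d0 ls0 x a : cur u = Some (d0, ls0) -> x != a ->
  ~~ FM x a -> covm M u v x a ->
  exists d ls, relax M FM cur v = Some (d, ls) /\ (d <= d0 + cm x a)%E.
Proof.
move=> cu xa fx cv; rewrite relaxE.
apply: (@foldl_reach _ _ (fun T : table => exists d ls, T v = Some (d, ls) /\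
   (d <= d0 + cm x a)%E) _ _ _ (u, x, a)).
- exact: triples_all.
- move=> acc /=; rewrite /relax1 cu xa fx cv /=.
  case av: (acc v) => [[d' ls']|]; last by do 2 eexists; split.
  case: ifP => [_|/negbFE h]; first by do 2 eexists; split.
  by exists d', ls'.
- move=> acc [[u' x'] a'] [d [ls [av le]]] /=; rewrite /relax1.
  case: (cur u') => [[d1 ls1]|]; last by exists d, ls.
  case: ifP => [/and4P [_ _ _]|_]; last by exists d, ls.
  rewrite av -ltNge => h; do 2 eexists; split => //.
  exact: le_trans (ltW h) le.
Qed.

Lemma iter_sound E FM S w v d ls : iter w (relax (mult E) FM) (start S) v = Some (d, ls) ->
  exists u, [/\ S u, chain E u ls v, size ls = w, all (okl FM) ls & d = costl ls].
Proof.
elim: w v d ls => [|w IH] v d ls /=.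
  rewrite /start; case: ifP => // Sv [<- <-]; exists v; split => //=.
  by rewrite /costl big_nil.
move=> /relax_sound [u [d0 [ls0 [x [a [[cu xa fx cv] [-> ->]]]]]]].
have [u0 [S0 c0 s0 a0 ->]] := IH _ _ _ cu.
exists u0; split => //.
- by rewrite chain_rcons; apply/existsP; exists u; rewrite c0 -covmE.
- by rewrite size_rcons s0.
- by rewrite all_rcons a0 /okl /= xa fx.
- by rewrite costl_rcons.
Qed.

Lemma iter_complete E FM S ls u v : S u -> chain E u ls v -> all (okl FM) ls ->
  exists d ls', iter (size ls) (relax (mult E) FM) (start S) v = Some (d, ls') /\
    (d <= costl ls)%E.
Proof.
move=> Su; elim/last_ind: ls v => [|ls [x a] IH] v /=.
  by move=> /eqP <- _; exists 0%E, [::]; rewrite /start Su /costl big_nil.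
rewrite chain_rcons all_rcons => /existsP [m /andP [c cv]] /andP [/andP [/= xa fx] al].
have [d [ls' [e le]]] := IH m c al.
rewrite size_rcons /= costl_rcons; rewrite -covmE in cv.
have [d1 [ls1 [e1 le1]]] := relax_complete e xa fx cv.
exists d1, ls1; split => //; apply: le_trans le1 _; exact: leeD.
Qed.

Lemma cheapest_sound E FM S S' w d ls : cheapest S S' (mult E) FM w = Some (d, ls) ->
  exists u v, [/\ S u, S' v, chain E u ls v, size ls = w & all (okl FM) ls] /\ d = costl ls.
Proof.
move: d ls; apply: (foldl_inv (P := fun T => forall d ls, T = Some (d, ls) ->
  exists u v, [/\ S u, S' v, chain E u ls v, size ls = w & all (okl FM) ls] /\
    d = costl ls)) => // acc v IH d ls; rewrite /better.
case cv: (iter _ _ _ v) => [[d0 ls0]|]; last exact: IH.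
case: ifP => [/andP [S'v _] [<- <-]|_]; last exact: IH.
have [u [h1 h2 h3 h4 h5]] := iter_sound cv.
by exists u, v.
Qed.

Lemma cheapest_complete E FM S S' ls u v : S u -> S' v -> chain E u ls v ->
  all (okl FM) ls ->
  exists d ls', cheapest S S' (mult E) FM (size ls) = Some (d, ls') /\ (d <= costl ls)%E.
Proof.
move=> Su S'v c al; have [d [ls' [e le]]] := iter_complete Su c al.
apply: (@foldl_reach _ _ (fun T => exists d ls', T = Some (d, ls') /\
   (d <= costl ls)%E) _ _ _ v).
- by rewrite mem_enum.
- move=> acc; rewrite /better e S'v /=.
  case: acc => [[d' ls'']|]; last by exists d, ls'.
  case: ifP => [_|/negbFE h]; first by exists d, ls'.
  by exists d', ls''; split => //; apply: le_trans h le.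
- move=> acc w [d1 [ls1 [-> le1]]]; rewrite /better.
  case: (iter _ _ _ w) => [[d2 ls2]|]; last by exists d1, ls1.
  case: ifP => [/andP [_]|_]; last by exists d1, ls1.
  rewrite -ltNge => h; exists d2, ls2; split => //; exact: le_trans (ltW h) le1.
Qed.

End Model.

(** * Some digit sequence reaches the optimum *)

Section Completeness.
Variables (R : realType) (n : nat).
Notation V := 'I_n.+1.
Variable cs : {set V} -> \bar R.
Hypothesis cs_ge0 : forall f, (0 <= cs f)%E.
Let cm (x a : V) := cs [set x; a].
Implicit Types (F U W : {set {set V}}) (E : seq (V * V)).

Definition ctot F := (\sum_(f in F) cs f)%E.

Lemma ctot_ge0 F : (0 <= ctot F)%E.
Proof. by apply: sume_ge0. Qed.

Lemma ctotU F U : [disjoint F & U] -> ctot (F :|: U) = (ctot F + ctot U)%E.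
Proof.
move=> d; rewrite /ctot -(bigU _ _ _ d); apply: eq_bigl => f.
by rewrite finset.in_setU.
Qed.

Lemma ctot_sub F U : F \subset U -> (ctot F <= ctot U)%E.
Proof.
move=> /finset.setIidPr h; have -> : U = F :|: (U :\: F) by rewrite -{1}[U](finset.setID _ F) h.
rewrite ctotU ?leeDl ?ctot_ge0 //; rewrite disjoint_subset; apply/fintype.subsetP => f fF.
by rewrite !inE fF.
Qed.

Lemma ctot_seq (s : seq {set V}) : (ctot [set f in s] <= \sum_(f <- s) cs f)%E.
Proof.
elim: s => [|f s IH]; first by rewrite /ctot big_nil big_pred0 // => f; rewrite inE.
rewrite big_cons finset.set_cons; have [fs|fs] := boolP (f \in [set g in s]).
  have -> : f |: [set g in s] = [set g in s] by apply/finset.setUidPr; rewrite finset.sub1set.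
  by apply: le_trans IH _; rewrite leeDr.
rewrite ctotU; last by rewrite disjoints1.
by apply: leeD IH; rewrite /ctot finset.big_set1.
Qed.

Lemma costl_map ls : costl cm ls = (\sum_(f <- map (@mk _) ls) cs f)%E.
Proof. by rewrite /costl big_map. Qed.

(** Distinctness is essential: [costl] pays for a repeated link twice, [ctot] only once. *)
Lemma costl_uniq ls W : uniq (map (@mk _) ls) -> (forall f, f \in map (@mk _) ls -> f \in W) ->
  (costl cm ls <= ctot W)%E.
Proof.
move=> u sW; rewrite costl_map big_uniq //=.
apply: le_trans (_ : ctot [set f in map (@mk _) ls] <= _)%E.
  by rewrite /ctot le_eqVlt; apply/orP; left; apply/eqP; apply: eq_bigl => f; rewrite inE.
by apply: ctot_sub; apply/fintype.subsetP => f; rewrite inE; exact: sW.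
Qed.

(** Committed links become edges, so that every step faces an instance of the same kind and the
    lemmas on cuts apply to it. *)
Lemma commit_list (E0 : seq (V * V)) F : (forall f, f \in F -> #|f| = 2) ->
  exists2 E, mult E = multF (mult E0) F & forall X, bdry E X = bdry E0 X + ncr F X.
Proof.
move=> F2; have [|s sE] := @mk_seq _ (enum F).
  by move=> f; rewrite mem_enum => /F2/eqP/cards2P [x [y [_ ->]]]; exists x, y.
exists (E0 ++ s).
  apply/funext => i; apply/funext => j; rewrite /mult /multF count_cat; congr (_ + _).
  have -> : count (fun e => eqpair e.1 e.2 i j) s = count_mem [set i; j] (map (@mk _) s).
    by rewrite count_map; apply: eq_count => e /=; rewrite eqp_mk.
  by rewrite sE count_uniq_mem ?enum_uniq // mem_enum.
by move=> X; rewrite bdry_cat (bdry_mk s) sE big_enum -ncrE.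
Qed.

Lemma isplit_commit E0 E F U : (forall X, bdry E X = bdry E0 X + ncr F X) ->
  [disjoint F & U] -> isplit E U <-> isplit E0 (F :|: U).
Proof.
move=> bE d; have spl X : ncr (F :|: U) X = ncr F X + ncr U X.
  by rewrite !ncrE -(bigU _ _ _ d); apply: eq_bigl => f; rewrite finset.in_setU.
by split=> h X X0 XT; have := h X X0 XT; rewrite bE spl addnA.
Qed.

Lemma leaf_rep E l : leaf E l -> exists2 r, r \in leaves (mult E) & r \in blk E l.
Proof.
move=> ll; case: (arg_minnP (fun r : V => val r) (blk_refl E l)) => r rB mr.
exists r => //; rewrite mem_filter mem_enum andbT /leafrep exitsE.
rewrite -[bdry _ _ <= 1]/(leaf E r) (leaf_blk rB) ll andbT.
apply/forallP => y; apply/implyP; rewrite covmE => cy; apply: mr.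
by apply: blk_trans rB _; rewrite inE.
Qed.

Lemma getleaf_index E r : r \in leaves (mult E) ->
  getleaf (mult E) (index r (leaves (mult E))) = r.
Proof. exact: nth_index. Qed.

Lemma token_digits E S : token E S -> exists d1 d2 d3 fl,
  [/\ d1 < size (leaves (mult E)), d2 < size (leaves (mult E)),
      d3 < size (leaves (mult E)), fl <= 1 & tokm (mult E) d1 d2 d3 fl =1 mem S].
Proof.
move=> [l1 [l2 [l3 [/leaf_rep [r1 r1L r1B] /leaf_rep [r2 r2L r2B] /leaf_rep [r3 r3L r3B] h]]]].
exists (index r1 (leaves (mult E))), (index r2 (leaves (mult E))), (index r3 (leaves (mult E))).
case: h => [->|->]; [exists 0|exists 1]; rewrite !index_mem; split => // v;
  rewrite /tokm !getleaf_index //=.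
  by rewrite !covmE -(med_blk r1B r2B r3B) inE.
by rewrite connmE -(comp_blk r1B) inE.
Qed.

Lemma leaves_size E F : (forall f, f \in F -> #|f| = 2) ->
  isplit E F -> ~~ tec E -> size (leaves (mult E)) <= 2 * #|F|.
Proof.
move=> F2 spl nE; apply: (leaf_count (E := E)) => //.
- by move=> f /F2/eqP/cards2P [x [y [_ ->]]]; exists x, y.
- by rewrite filter_uniq ?enum_uniq.
- by move=> l; rewrite mem_filter /leafrep exitsE => /andP [/andP []].
move=> l l'; rewrite !mem_filter => /andP [/andP [/forallP h _] _] /andP [/andP [/forallP h' _] _] b.
apply: val_inj; apply/eqP; rewrite eqn_leq.
have := h l'; have := h' l; rewrite !covmE.
by have := b; rewrite inE => ->; have := b; rewrite -blk_sym inE => -> /= -> ->.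
Qed.

Lemma disjointP F U : reflect (forall f, f \in F -> f \notin U) [disjoint F & U].
Proof.
rewrite disjoint_subset; apply: (iffP fintype.subsetP) => h f /h; rewrite inE //.
Qed.

Lemma eq_pick_link S1 S1' S2 S2' M FM w j : S1 =1 S1' -> S2 =1 S2' ->
  pick_link cm S1 S2 M FM w j = pick_link cm S1' S2' M FM w j.
Proof. by move=> /funext -> /funext ->. Qed.

(** Zero digits ask for a chain without links; its link at any position is the default loop, which
    is not committed. This pads the sequence once nothing is left to do. *)
Lemma step_idle p (E0 : seq (V * V)) F : step cm p (mult E0) (fun=> 0) F = F.
Proof.
rewrite /step /pick_link minn0; case h: cheapest => [[d ls]|]; last by rewrite /= ?eqxx.
suff -> : ls = [::] by rewrite /= ?eqxx.
move: d ls h; apply: (foldl_inv (P := fun T => forall d ls, T = Some (d, ls) -> ls = [::])) => //.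
move=> acc v IH d ls; rewrite /better /= /start; case: ifP => _; last exact: IH.
by case: ifP => [_ [_ <-]|_]; last exact: IH.
Qed.

(* By [group_exists], some [W] in [U] joins a token [S] to a token [S'], and may be
   replaced by the links of a cheapest chain from [S] to [S'].  If that chain meets the
   links [U0] that are kept, the common link is committed without replacing [W];
   otherwise the replacement is made and the first link of the chain is committed. *)
Lemma step_progress p (E0 : seq (V * V)) F U : #|U| <= p ->
  (forall f, f \in F -> #|f| = 2) -> (forall f, f \in U -> #|f| = 2) ->
  [disjoint F & U] -> isplit E0 (F :|: U) ->
  exists d F' U', [/\ (forall i, d i <= 2 * #|U|), F' = step cm p (mult E0) d F,
    (forall f, f \in F' -> #|f| = 2), (forall f, f \in U' -> #|f| = 2) & [/\ [disjoint F' & U'],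
    isplit E0 (F' :|: U'), #|U'| <= #|U|.-1 & (ctot (F' :|: U') <= ctot (F :|: U))%E]].
Proof.
move=> Up F2 U2 dFU; have [E mE bE] := commit_list E0 F2.
have spE W : [disjoint F & W] -> isplit E W <-> isplit E0 (F :|: W) by apply: isplit_commit.
move=> spl; have splU : isplit E U by apply/spE.
have [tE|nE] := boolP (tec E).
  exists (fun=> 0), F, finset.set0; rewrite step_idle; split => //; first by move=> f; rewrite inE.
  have d0 : [disjoint F & finset.set0] by apply/disjointP => f; rewrite inE.
  split => //; first by apply/(spE _ d0) => X X0 XT; rewrite (leq_trans (tecP _ tE X X0 XT)) // leq_addr.
    by rewrite cards0.
  by rewrite finset.setU0; apply: ctot_sub; apply: finset.subsetUl.
have U2' f : f \in U -> exists x y, f = [set x; y].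
  by move=> /U2/eqP/cards2P [x [y [_ ->]]]; exists x, y.
have [S [S' [W [U0 [x [a [[tS tS' xS aS' naB] [WU U0U dU0W cWxa repl]]]]]]]] :=
  group_exists U2' splU nE.
have W2 f : f \in W -> exists x y, f = [set x; y] by move=> /(fintype.subsetP WU)/U2'.
have [ls [cls uls lsW]] := uniq_chain W2 cWxa.
have okW l : mk l \in U -> okl (inF F) l.
  move=> lU; rewrite /okl; have := U2 _ lU; rewrite /mk finset.cards2.
  case: eqP => //= _ _; rewrite /inF; move/disjointP: dFU => d.
  by apply/negP => /d; rewrite -[[set _; _]]/(mk l) lU.
have okls : all (okl (inF F)) ls.
  apply/allP => l lls; apply: okW; apply: (fintype.subsetP WU); apply: lsW; exact: map_f.
have szW : size ls <= #|W|.
  rewrite -(size_map (@mk _)) -[size _](card_uniqP uls); apply: subset_leq_card.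
  by apply/fintype.subsetP => f; exact: lsW.
have ls0 : 0 < size ls.
  by case: (ls) cls => //= /eqP xa; rewrite xa blk_refl in naB.
have [d1 [d2 [d3 [fl [b1 b2 b3 b4 tk]]]]] := token_digits tS.
have [e1 [e2 [e3 [fl' [c1 c2 c3 c4 tk']]]]] := token_digits tS'.
have [d [ls' [ch le]]] := cheapest_complete cm (S := mem S) (S' := mem S') xS aS' cls okls.
have [u [v [[uS vS' cls' szls' okls'] dE]]] := cheapest_sound ch.
have cW' : connect (hop E [set f in map (@mk _) ls']) u v := chain_hop cls'.
have cUW : (ctot U0 + ctot W <= ctot U)%E.
  by rewrite -ctotU //; apply: ctot_sub; rewrite finset.subUset U0U WU.
have kU : #|U0| + #|W| <= #|U|.
  have h : #|U0 :|: W| = #|U0| + #|W|.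
    by apply/eqP; rewrite (leq_card_setU U0 W).2.
  by rewrite -h; apply: subset_leq_card; rewrite finset.subUset U0U WU.
have [j [U' [jw jU' U'2 dFU' [spU' kU' cU']]]] : exists j U', [/\ j < size ls,
    mk (nth (ord0, ord0) ls' j) \in U', (forall f, f \in U' -> #|f| = 2), [disjoint F & U'] &
    [/\ isplit E U', #|U'| <= #|U| & (ctot U' <= ctot U)%E]].
  have [dUW'|] := boolP [disjoint U0 & [set f in map (@mk _) ls']].
    exists 0, (U0 :|: [set f in map (@mk _) ls']); split => //.
    - by rewrite !inE map_f ?orbT // mem_nth // szls'.
    - move=> f; rewrite !inE => /orP [/(fintype.subsetP U0U)/U2 //|/mapP [l lls' ->]].
      by have /andP [l12 _] := allP okls' _ lls'; rewrite /mk finset.cards2 l12.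
    - apply/disjointP => f fF; rewrite !inE; apply/norP; split.
        by apply/negP => /(fintype.subsetP U0U); apply/negP; move/disjointP: dFU; apply.
      by apply/mapP => -[l /(allP okls')/andP [_ +] fE]; rewrite /inF -[[set _; _]]/(mk l) -fE fF.
    split.
    - apply: repl => //; by exists u, v.
    - apply: leq_trans kU; apply: leq_trans (leq_card_setU _ _).1 _; rewrite leq_add2l.
      apply: leq_trans szW; rewrite -szls' cardsE -(size_map (@mk _)); exact: card_size.
    - rewrite ctotU //; apply: le_trans cUW; apply: leeD => //.
      apply: le_trans (ctot_seq _) _; rewrite -costl_map.
      apply: le_trans (costl_uniq uls lsW); by rewrite -dE.
  rewrite disjoint_subset => /fintype.subsetPn [f fU0]; rewrite !inE negbK => fls'.
  have [l lls' fE] := mapP fls'.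
  exists (index l ls'), U; split => //; first by rewrite -szls' index_mem.
  by rewrite nth_index // -fE; apply: (fintype.subsetP U0U).
set f := mk _ in jU'.
(* Leaf indices are below the number of leaves, at most [2 * #|U|]; flags are at most 1; the length
   is at most [#|W|], and the position is below it. *)
pose ds := [:: d1; d2; d3; fl; e1; e2; e3; fl'; size ls; j].
exists (nth 0 ds), (f |: F), (U' :\ f).
have U1 : 0 < #|U| by apply: leq_trans ls0 (leq_trans szW _); apply: subset_leq_card.
have lsz : size (leaves (mult E)) <= 2 * #|U| by apply: leaves_size.
have szp : minn p (size ls) = size ls.
  by apply/minn_idPr; move: szW (subset_leq_card WU) Up; clear; lia.
have szU : size ls <= 2 * #|U|.
  by move: szW (subset_leq_card WU); clear; lia.
have fF : f \notin F by apply/negP => fF; move/disjointP: dFU' => /(_ f fF); rewrite jU'.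
have fUU : (f |: F) :|: (U' :\ f) = F :|: U'.
  by rewrite -finset.setUA finset.setUCA finset.setD1K.
split.
- move=> i; have : all (fun k => k <= 2 * #|U|) ds.
    by move: b1 b2 b3 b4 c1 c2 c3 c4 szU jw U1 lsz; rewrite /ds /= andbT; clear; lia.
  move/all_nthP => /(_ 0 i); case: (ltnP i (size ds)) => [_ h|h _]; first exact: h.
  by rewrite nth_default.
- rewrite /step -mE /= (eq_pick_link _ _ _ _ tk tk') /pick_link szp ch.
  have lj : nth (ord0, ord0) ls' j \in ls' by rewrite mem_nth // szls'.
  have := allP okls' _ lj; rewrite /f; case: (nth _ ls' j) => y z /=.
  by rewrite /okl /= => ->.
- by move=> g; rewrite !inE => /orP [/eqP ->|/F2 //]; apply: U'2.
- by move=> g; rewrite !inE => /andP [_ /U'2].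
split.
- apply/disjointP => g; rewrite !inE negb_and negbK => /orP [->//|gF].
  by apply/orP; right; move/disjointP: dFU'; apply.
- by rewrite fUU; apply/spE.
- by move: kU'; rewrite (cardsD1 f) jU' add1n; case: (#|U|) U1.
- rewrite fUU !ctotU //; exact: leeD.
Qed.

Lemma run_eq p M0 d d' k F : (forall i, i < 10 * k -> d i = d' i) ->
  run cm p M0 d k F = run cm p M0 d' k F.
Proof.
elim: k => //= k IH h; rewrite IH => [|i ik]; last by apply: h; lia.
have e i : i < 10 -> d (10 * k + i) = d' (10 * k + i) by move=> i10; apply: h; lia.
by rewrite /step !e.
Qed.

(** Committed and remaining links together stay feasible and never get dearer, while each step takes
    one off the bound on the remaining ones. After [p] steps none remain. *)
Lemma run_complete p (E0 : seq (V * V)) U : #|U| <= p -> (forall f, f \in U -> #|f| = 2) ->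
  isplit E0 U -> exists d, (forall i, d i <= 2 * p) /\
    let F := run cm p (mult E0) d p finset.set0 in isplit E0 F /\ (ctot F <= ctot U)%E.
Proof.
move=> Up U2 spl.
suff H k : k <= p -> exists d U', [/\ forall i, d i <= 2 * p,
    forall f, f \in U' -> #|f| = 2 & let F := run cm p (mult E0) d k finset.set0 in
    [/\ forall f, f \in F -> #|f| = 2, [disjoint F & U'], isplit E0 (F :|: U'),
       #|U'| <= p - k & (ctot (F :|: U') <= ctot U)%E]].
  have [d [U' [hd _ [_ _ spF cU' cF]]]] := H p (leqnn p).
  exists d; split=> //; move: cU'; rewrite subnn leqn0 cards_eq0 => /eqP U0.
  by rewrite U0 finset.setU0 in spF cF.
elim: k => [|k IH] kp.
  exists (fun=> 0), U; split => //=; rewrite finset.set0U subn0; split => //.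
    by move=> f; rewrite inE.
  by apply/disjointP => f; rewrite inE.
have [d [U' [hd U'2 [F2 dF spF cU' cF]]]] := IH (ltnW kp).
have U'p : #|U'| <= p by move: cU'; clear; lia.
have [d' [F' [U'' [hd' F'E F'2 U''2 [dF' spF' cU'' cF']]]]] := step_progress U'p F2 U'2 dF spF.
exists (fun i => if i < 10 * k then d i else d' (i - 10 * k)), U''.
have rE : run cm p (mult E0) (fun i => if i < 10 * k then d i else d' (i - 10 * k)) k.+1 finset.set0 = F'.
  rewrite /= F'E (@run_eq _ _ _ d) => [|i ->] //.
  suff -> : (fun i => if 10 * k + i < 10 * k then d (10 * k + i) else d' (10 * k + i - 10 * k)) = d' by [].
  by apply/funext => i; rewrite ltnNge leq_addr /= addnC addnK.
rewrite rE; split => //.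
  by move=> i; case: ifP => _ //; apply: leq_trans (hd' _) _; rewrite leq_mul2l U'p orbT.
split => //; last exact: le_trans cF' cF.
by move: cU'' cU'; clear; lia.
Qed.

Lemma run_sound p M0 d k : #|run cm p M0 d k finset.set0| <= k /\
  forall f, f \in run cm p M0 d k finset.set0 -> #|f| = 2.
Proof.
elim: k => [|k [c h]] /=; first by split=> [|f]; rewrite ?cards0 ?inE.
rewrite /step; case: pick_link => x a; case: ifP => [/andP [xa nF]|_]; last by split=> //; exact: leqW.
rewrite cardsU1 (_ : _ \notin _) //=; split; first by rewrite add1n ltnS.
by move=> f; rewrite !inE => /orP [/eqP ->|/h //]; rewrite finset.cards2 xa.
Qed.

(** Lying in a common block is transitive, so the block of one vertex decides, and a single covering
    test serves as the feasibility check. *)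
Lemma tec_cover (E : seq (V * V)) : tec E = [forall v, covm (mult E) ord0 v ord0 ord0].
Proof.
apply/tecP/forallP => [h v|h X X0 XT].
  rewrite covmE; suff: v \in blk E ord0 by rewrite inE.
  apply/blkP => X cX; apply: h.
    by apply/eqP => X0; move: cX; rewrite X0 /cr !inE.
  by apply/eqP => X0; move: cX; rewrite X0 /cr !inE.
have [u uX] := set0Pn _ X0.
have [v vX] : exists v, v \notin X.
  apply/existsP; rewrite -negb_forall; apply: contra XT => /forallP k.
  by apply/eqP/finset.setP => v; rewrite inE k.
have b w : w \in blk E ord0 by rewrite inE -covmE.
have u0 : ord0 \in blk E u by rewrite blk_sym.
have /blkP := blk_trans u0 (b v); apply; by rewrite /cr /= uX (negbTE vX).
Qed.

End Completeness.

(** * Bounded programs *)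

(* Programs with bounded loops only; [CFor v b P] runs [P] for the values
   0, ..., b - 1 of cell 0 of natural array [v]. *)
Inductive cmd :=
  | CSkip
  | CN (a : nat) (i e : nexp)
  | CR (a : nat) (i : nexp) (e : rexp)
  | CSeq (P Q : cmd)
  | CIf (b : bexp) (P Q : cmd)
  | CFor (v : nat) (b : nexp) (P : cmd).

Fixpoint compile (c : cmd) : prog :=
  match c with
  | CSkip => Skip
  | CN a i e => NSet a i e
  | CR a i e => RSet a i e
  | CSeq P Q => Seq (compile P) (compile Q)
  | CIf b P Q => If b (compile P) (compile Q)
  | CFor v b P =>
      Seq (NSet v (NLit 0) (NLit 0))
        (While (NLe (NAdd (NGet v (NLit 0)) (NLit 1)) b)
          (Seq (compile P) (NSet v (NLit 0) (NAdd (NGet v (NLit 0)) (NLit 1)))))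
  end.

Fixpoint nreads (e : nexp) : seq nat :=
  match e with
  | NLit _ => [::]
  | NGet a i => a :: nreads i
  | NAdd e1 e2 | NSub e1 e2 => nreads e1 ++ nreads e2
  end.

Fixpoint nwrites (c : cmd) : seq nat :=
  match c with
  | CSkip | CR _ _ _ => [::]
  | CN a _ _ => [:: a]
  | CSeq P Q | CIf _ P Q => nwrites P ++ nwrites Q
  | CFor v _ P => v :: nwrites P
  end.

Fixpoint rwrites (c : cmd) : seq nat :=
  match c with
  | CSkip | CN _ _ _ => [::]
  | CR a _ _ => [:: a]
  | CSeq P Q | CIf _ P Q => rwrites P ++ rwrites Q
  | CFor _ _ P => rwrites P
  end.

(** A loop body changes neither its counter nor its bound, so the number of rounds is known on
    entry; [ntime b <= 2] keeps the guard cheap. *)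
Fixpoint wf (c : cmd) : bool :=
  match c with
  | CSkip | CN _ _ _ | CR _ _ _ => true
  | CSeq P Q | CIf _ P Q => wf P && wf Q
  | CFor v b P =>
      [&& v \notin nwrites P, v \notin nreads b,
          ~~ has (mem (nwrites P)) (nreads b), ntime b <= 2 & wf P]
  end.

(* Cells 0 and 1 of array 0 hold the number of vertices and [p]. *)
Definition small_bound (b : nexp) : bool :=
  match b with
  | NLit k => k <= 10
  | NGet 0 (NLit 0) | NGet 0 (NLit 1) => true
  | _ => false
  end.

Fixpoint small_bounds (c : cmd) : bool :=
  match c with
  | CSkip | CN _ _ _ | CR _ _ _ => true
  | CSeq P Q | CIf _ P Q => small_bounds P && small_bounds Q
  | CFor _ b P => small_bound b && small_bounds P
  end.

(** Exponent of the time bound [N ^ degree c], for [N >= 10] bounding the number of vertices and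
    [p]. The generous increments absorb all constants. *)
Fixpoint degree (c : cmd) : nat :=
  match c with
  | CSkip => 0
  | CN a i e => (ntime i + ntime e).+1
  | CR a i e => (ntime i + rtime e).+1
  | CSeq P Q => (maxn (degree P) (degree Q)).+1
  | CIf b P Q => (maxn (btime b) (maxn (degree P) (degree Q))).+1
  | CFor v b P => degree P + 4
  end.

(** * Semantics and running time of bounded programs *)

Section Commands.
Variable R : realType.
Implicit Types (s : state R) (c P : cmd).

Definition setn v k s : state R := State (upd (nmem s) v 0 k) (rmem s).

(** Bounded loops allow a total function in place of [runs]; [runs_compile] connects the two, and
    correctness is proved for [cev] alone. *)
Fixpoint cev c s : state R :=
  match c with
  | CSkip => s
  | CN a i e => State (upd (nmem s) a (neval s i) (neval s e)) (rmem s)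
  | CR a i e => State (nmem s) (upd (rmem s) a (neval s i) (reval s e))
  | CSeq P Q => cev Q (cev P s)
  | CIf b P Q => if beval s b then cev P s else cev Q s
  | CFor v b P =>
      let k := neval s b in
      setn v k (iteri k (fun j s' => cev P (setn v j s')) s)
  end.

Lemma updE T (m : nat -> nat -> T) a i x b j :
  upd m a i x b j = if (b == a) && (j == i) then x else m b j.
Proof. by []. Qed.

Lemma setnE v k s a j : a != v -> nmem (setn v k s) a j = nmem s a j.
Proof. by rewrite /= updE => /negbTE ->. Qed.

Lemma setn_eq v k s : nmem (setn v k s) v 0 = k.
Proof. by rewrite /= updE !eqxx. Qed.

Lemma nframe c s a j : a \notin nwrites c -> nmem (cev c s) a j = nmem s a j.
Proof.
elim: c s => //= [b i e|P IHP Q IHQ|b P IHP Q IHQ|v b P IHP] s.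
- by rewrite inE updE => /negbTE ->.
- by rewrite mem_cat negb_or => /andP [h1 h2]; rewrite IHQ ?IHP.
- by rewrite mem_cat negb_or => /andP [h1 h2]; case: ifP => _; rewrite ?IHQ ?IHP.
- rewrite inE negb_or => /andP [h1 h2]; rewrite updE (negbTE h1) /=.
  by elim: (neval s b) => //= k IH; rewrite IHP // setnE.
Qed.

Lemma rframe c s a j : a \notin rwrites c -> rmem (cev c s) a j = rmem s a j.
Proof.
elim: c s => //= [b i e|P IHP Q IHQ|b P IHP Q IHQ|v b P IHP] s.
- by rewrite inE updE => /negbTE ->.
- by rewrite mem_cat negb_or => /andP [h1 h2]; rewrite IHQ ?IHP.
- by rewrite mem_cat negb_or => /andP [h1 h2]; case: ifP => _; rewrite ?IHQ ?IHP.
- by move=> h; elim: (neval s b) => //= k IH; rewrite IHP.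
Qed.

Lemma neval_agree s s' (e : nexp) :
  (forall a j, a \in nreads e -> nmem s a j = nmem s' a j) -> neval s e = neval s' e.
Proof.
elim: e => //= [a i IH|e1 IH1 e2 IH2|e1 IH1 e2 IH2] h.
- rewrite h ?mem_head // IH // => b j bi; apply: h; by rewrite inE bi orbT.
- by rewrite IH1 ?IH2 // => a j ai; apply: h; rewrite mem_cat ai ?orbT.
- by rewrite IH1 ?IH2 // => a j ai; apply: h; rewrite mem_cat ai ?orbT.
Qed.

Definition loop v P k s := iteri k (fun j s' => cev P (setn v j s')) s.

Lemma loop_nframe v P k s a j : a \notin v :: nwrites P -> nmem (loop v P k s) a j = nmem s a j.
Proof.
rewrite inE negb_or => /andP [h1 h2].
by elim: k => //= k IH; rewrite nframe // setnE.
Qed.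

Lemma loop_rframe v P k s a j : a \notin rwrites P -> rmem (loop v P k s) a j = rmem s a j.
Proof. by move=> h; elim: k => //= k IH; rewrite rframe. Qed.

(** Besides the invariant, the rule supplies that arrays not written keep their contents; this
    spares the invariants all framing clauses. *)
Lemma for_inv v b P s (I : nat -> state R -> Prop) (Q : state R -> Prop) :
  I 0 s ->
  (forall k s', k < neval s b -> (forall a j, a \notin v :: nwrites P -> nmem s' a j = nmem s a j) ->
    (forall a j, a \notin rwrites P -> rmem s' a j = rmem s a j) ->
    I k s' -> I k.+1 (cev P (setn v k s'))) ->
  (forall s', (forall a j, a \notin v :: nwrites P -> nmem s' a j = nmem s a j) ->
    (forall a j, a \notin rwrites P -> rmem s' a j = rmem s a j) ->
    I (neval s b) s' -> Q (setn v (neval s b) s')) ->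
  Q (cev (CFor v b P) s).
Proof.
move=> I0 IS; rewrite /= -/(loop v P (neval s b) s); apply.
- by move=> a j; apply: loop_nframe.
- by move=> a j; apply: loop_rframe.
have : neval s b <= neval s b by [].
elim: {-2}(neval s b) => //= k IH kb; apply: IS => //.
- by move=> a j; apply: loop_nframe.
- by move=> a j; apply: loop_rframe.
- exact: IH (ltnW kb).
Qed.

Variable N : nat.
Hypothesis N10 : 10 <= N.

Definition small s := (nmem s 0 0 <= N) && (nmem s 0 1 <= N).

(** A round costs at most 7 for the guard, [T] for the body, 6 for the increment and 1 each for
    sequencing and loop, in all [T + 15]. Entering costs 4, and the last guard at most 8. *)
Lemma runs_for v b P s T : wf (CFor v b P) -> 0 \notin v :: nwrites P -> small s ->
  (forall s', small s' -> exists2 t, t <= T & runs (compile P) s' t (cev P s')) ->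
  exists2 t, t <= 12 + neval s b * (T + 15) &
    runs (compile (CFor v b P)) s t (cev (CFor v b P) s).
Proof.
move=> /= /and5P [vP vb nb tb _] z ss HP; set K := neval s b.
have z' := z; rewrite inE negb_or in z'; case/andP: z' => zv zP.
pose S j := setn v j (loop v P j s).
have SK j : neval (S j) b = K.
  apply: neval_agree => a i ab; rewrite setnE; last by apply: contraNneq vb => <-.
  apply: loop_nframe; rewrite inE negb_or; apply/andP; split.
    by apply: contraNneq vb => <-.
  by apply/negP => aP; move/hasPn: nb => /(_ a ab); rewrite inE aP.
have sS j : small (S j).
  by rewrite /small !setnE // !loop_nframe.
have gS j : beval (S j) (NLe (NAdd (NGet v (NLit 0)) (NLit 1)) b) = (j < K).
  by rewrite -[LHS]/(nmem (S j) v 0 + 1 <= neval (S j) b) SK setn_eq addn1.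
suff H m j : j + m = K -> exists2 t, t <= 8 + m * (T + 15) &
    runs (While (NLe (NAdd (NGet v (NLit 0)) (NLit 1)) b)
          (Seq (compile P) (NSet v (NLit 0) (NAdd (NGet v (NLit 0)) (NLit 1))))) (S j) t (S K).
  have [t tle rt] := H K 0 erefl.
  exists (3 + t).+1; first by move: tle; move: (K * _); clear; lia.
  exact: (@runs_Seq R _ _ s 3 (S 0) t _ (@runs_NSet R v (NLit 0) (NLit 0) s) rt).
elim: m j => [|m IH] j jm.
  rewrite addn0 in jm; rewrite -jm; exists ((4 + ntime b).+1).+1; first by move: tb; clear; lia.
  by apply: runs_WhileF; rewrite gS -jm ltnn.
have [t tle rt] := HP (S j) (sS j).
have [t2 t2le rt2] := IH j.+1 (etrans (addSnnS _ _) jm).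
exists (((4 + ntime b).+1 + (t + 6).+1 + t2).+1).
  by rewrite mulSn; move: tb tle t2le; clear; lia.
apply: runs_WhileT rt2.
  by rewrite gS -jm addnS ltnS leq_addr.
apply: runs_Seq rt _.
have -> : S j.+1 = State (upd (nmem (cev P (S j))) v (neval (cev P (S j)) (NLit 0))
   (neval (cev P (S j)) (NAdd (NGet v (NLit 0)) (NLit 1)))) (rmem (cev P (S j))).
  by rewrite /= nframe // setn_eq addn1.
exact: runs_NSet.
Qed.

Lemma leq_exp_self k : k <= N ^ k.
Proof. by apply: ltnW; apply: ltn_expl; apply: leq_trans N10. Qed.

Lemma leq_expN i j : i <= j -> N ^ i <= N ^ j.
Proof. by apply: leq_pexp2l; apply: leq_trans N10. Qed.

Lemma leq_three (a b d m : nat) : a <= N ^ m -> b <= N ^ m -> d <= N ^ m -> a + b + d <= N ^ m.+1.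
Proof.
move=> h1 h2 h3; apply: (@leq_trans (3 * N ^ m)).
  by rewrite !mulSn mul0n addn0 -addnA !leq_add.
by rewrite expnS leq_mul2r (leq_trans _ N10) ?orbT.
Qed.

Lemma runs_compile c s : wf c -> small_bounds c -> 0 \notin nwrites c -> small s ->
  exists2 t, t <= N ^ degree c & runs (compile c) s t (cev c s).
Proof.
elim: c s => [|a i e|a i e|P IHP Q IHQ|b P IHP Q IHQ|v b P IHP] s.
- by move=> _ _ _ _; exists 1 => //; constructor.
- move=> _ _ _ _; exists (ntime i + ntime e).+1; first exact: leq_exp_self.
  exact: runs_NSet.
- move=> _ _ _ _; exists (ntime i + rtime e).+1; first exact: leq_exp_self.
  exact: runs_RSet.
- move=> /= /andP [wP wQ] /andP [sP sQ]; rewrite mem_cat negb_or => /andP [zP zQ] ss.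
  have [t1 l1 r1] := IHP s wP sP zP ss.
  have [|t2 l2 r2] := IHQ (cev P s) wQ sQ zQ.
    by rewrite /small !nframe.
  exists (t1 + t2).+1; last exact: runs_Seq r1 r2.
  rewrite -addn1; apply: leq_three.
  + by apply: leq_trans l1 (leq_expN _); rewrite leq_maxl.
  + by apply: leq_trans l2 (leq_expN _); rewrite leq_maxr.
  + by rewrite expn_gt0 (leq_trans _ N10).
- move=> /= /andP [wP wQ] /andP [sP sQ]; rewrite mem_cat negb_or => /andP [zP zQ] ss.
  have h3 : 0 < N ^ maxn (btime b) (maxn (degree P) (degree Q)).
    by rewrite expn_gt0 (leq_trans _ N10).
  have hb : btime b <= N ^ maxn (btime b) (maxn (degree P) (degree Q)).
    by apply: leq_trans (leq_exp_self _) (leq_expN _); rewrite leq_maxl.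
  case: ifP => bb.
    have [t l r] := IHP s wP sP zP ss; exists (btime b + t).+1; last exact: runs_IfT.
    rewrite -addn1; apply: leq_three => //; apply: leq_trans l (leq_expN _).
    by rewrite leq_max leq_maxl orbT.
  have [t l r] := IHQ s wQ sQ zQ ss; exists (btime b + t).+1; last by apply: runs_IfF => //; rewrite bb.
  rewrite -addn1; apply: leq_three => //; apply: leq_trans l (leq_expN _).
  by rewrite leq_max leq_maxr orbT.
- move=> w /= /andP [sb sP] z ss.
  have wP : wf P by case/and5P: w.
  have zP : 0 \notin nwrites P by move: z; rewrite inE negb_or => /andP [].
  have [t l r] := runs_for w z ss (fun s' ss' => IHP s' wP sP zP ss').
  exists t => //; apply: leq_trans l _.
  have KN : neval s b <= N.
    case/andP: ss => s0 s1; case: b sb {w r IHP} => //=.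
      by move=> k h; apply: leq_trans h N10.
    by case=> // -[] // [|[]].
  have h1 : 0 < N by apply: leq_trans N10.
  apply: (@leq_trans (12 + N * (N ^ degree P + 15))); first by rewrite leq_add2l leq_mul2r KN orbT.
  (* The summands 12, [15 * N] and [N ^ (degree P).+1] are each at most [N ^ (degree P + 3)]; adding
     three of them costs one more exponent. *)
  rewrite mulnDr -expnS addnA addnAC addn4; apply: leq_three.
  + apply: (@leq_trans (N ^ 2)); last exact: leq_expN.
    by rewrite expnS expn1 (leq_trans _ (leq_mul N10 N10)).
  + apply: (@leq_trans (N ^ 3)); last exact: leq_expN.
    by rewrite !expnS expn0 muln1 leq_mul // (leq_trans _ (leq_mul N10 N10)).
  + by apply: leq_expN; rewrite ltnW.
Qed.

End Commands.

(** * The program *)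

(* Natural arrays 4 to 18 hold tables, those from 20 on hold a number in cell 0.
    4: i |-> i * n          5: current multiplicities      6: links committed so far
    7: reached vertices     8: vertices covered by a link   9: leaf representatives
   10, 11: the two tokens  12-17: chain table              18: digits
   Real arrays 1 and 2 belong to the chain table, 3 holds the cost of the
   committed links, 4 that of the cheapest chain, 5 that of the best solution.
   Registers from 40 on serve the enumeration. *)
Definition reg a := NGet a (NLit 0).
Definition entry a i j := NGet a (NAdd (NGet 4 i) j).
Definition bor b1 b2 := BNot (BAnd (BNot b1) (BNot b2)).
Definition beq e1 e2 := BAnd (NLe e1 e2) (NLe e2 e1).
Definition bpair y z i j :=
  bor (BAnd (beq y i) (beq z j)) (BAnd (beq y j) (beq z i)).
Definition seqs := foldr CSeq CSkip.
Definition set_reg a e := CN a (NLit 0) e.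
Definition forV v P := CFor v (reg 0) P.

Definition clear_where v a b :=
  forV v (CIf (NLe (NGet a (reg v)) (NLit 0)) (CN b (reg v) (NLit 0)) CSkip).

Definition badj :=
  bor (bor (NLe (NLit 2) (entry 5 (reg 20) (reg 21)))
           (BAnd (NLe (NLit 1) (entry 5 (reg 20) (reg 21)))
                 (BNot (bpair (reg 20) (reg 21) (reg 23) (reg 24)))))
      (bpair (reg 20) (reg 21) (reg 25) (reg 26)).

(* Reachability from the vertex in array 27 after the removal of the edge (23, 24) and the
   addition of the link (25, 26). *)
Definition REACH := seqs
  [:: forV 20 (CN 7 (reg 20) (NLit 0));
      CN 7 (reg 27) (NLit 1);
      forV 22 (forV 20 (forV 21
        (CIf (BAnd (NLe (NLit 1) (NGet 7 (reg 20))) badj)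
             (CN 7 (reg 21) (NLit 1)) CSkip)))].

Definition COVER := seqs
  [:: forV 20 (CN 8 (reg 20) (NLit 1));
      forV 23 (forV 24 (CSeq REACH
        (clear_where 20 7 8)))].

(** * Reachability and covering *)

Section Correctness.
Variables (R : realType) (n : nat).
Notation V := 'I_n.+1.
Implicit Types (s : state R) (M : V -> V -> nat).

Lemma cev_cons c l s : cev (seqs (c :: l)) s = cev (seqs l) (cev c s).
Proof. by []. Qed.

Lemma cev_nil s : cev (seqs [::]) s = s.
Proof. by []. Qed.

Lemma cev_seq P Q s : cev (CSeq P Q) s = cev Q (cev P s).
Proof. by []. Qed.

Lemma cevN a i e s b j : nmem (cev (CN a i e) s) b j =
  if (b == a) && (j == neval s i) then neval s e else nmem s b j.
Proof. by []. Qed.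

Lemma cevIf b P Q s : cev (CIf b P Q) s = if beval s b then cev P s else cev Q s.
Proof. by []. Qed.

Definition pos (i j : V) := i * n.+1 + j.

Definition ctx M s :=
  [/\ nmem s 0 0 = n.+1, forall i : V, nmem s 4 i = i * n.+1 &
      forall i j, nmem s 5 (pos i j) = M i j].

Definition unchanged (ws : seq nat) s s' :=
  forall a j, a \notin ws -> nmem s' a j = nmem s a j.

Lemma ctx_unchanged ws M s s' : all (fun a => a \notin ws) [:: 0; 4; 5] ->
  unchanged ws s s' -> ctx M s -> ctx M s'.
Proof.
move=> /= /and4P [w0 w4 w5 _] h [h0 h4 h5]; split=> [|i|i j]; by rewrite h.
Qed.

Lemma ctx_cev M c s : all (fun a => a \notin nwrites c) [:: 0; 4; 5] ->
  ctx M s -> ctx M (cev c s).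
Proof. by move=> w; apply: ctx_unchanged w _ => a j; exact: nframe. Qed.

Lemma ctx_setn M v k s : v \notin [:: 0; 4; 5] -> ctx M s -> ctx M (setn v k s).
Proof.
move=> w; apply: (@ctx_unchanged [:: v]).
  by move: w; rewrite /= !inE !negb_or => /and3P [h1 h2 h3]; rewrite ![_ == v]eq_sym h1 h2 h3.
by move=> a j; rewrite inE => /setnE ->.
Qed.

Lemma forV_inv v P s (I : nat -> state R -> Prop) (Q : state R -> Prop) :
  nmem s 0 0 = n.+1 -> I 0 s ->
  (forall (k : V) s', unchanged (v :: nwrites P) s s' ->
    (forall a j, a \notin rwrites P -> rmem s' a j = rmem s a j) ->
    I k s' -> I k.+1 (cev P (setn v k s'))) ->
  (forall s', unchanged (v :: nwrites P) s s' ->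
    (forall a j, a \notin rwrites P -> rmem s' a j = rmem s a j) ->
    I n.+1 s' -> Q (setn v n.+1 s')) ->
  Q (cev (forV v P) s).
Proof.
move=> n0 I0 IS IQ; apply: (for_inv I0).
  move=> k s'; rewrite [neval _ _]n0 => kn; exact: (IS (Ordinal kn)).
by rewrite [neval _ _]n0.
Qed.

(** The search is modelled by folds over [enum V] so that this one rule relates a loop to its
    model. *)
Lemma forV_fold v P s T (h : T -> V -> T) z (Rel : state R -> T -> Prop) :
  nmem s 0 0 = n.+1 -> Rel s z ->
  (forall (k : V) s' acc, unchanged (v :: nwrites P) s s' ->
    (forall a j, a \notin rwrites P -> rmem s' a j = rmem s a j) ->
    Rel s' acc -> Rel (cev P (setn v k s')) (h acc k)) ->
  (forall s' acc, Rel s' acc -> Rel (setn v n.+1 s') acc) ->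
  Rel (cev (forV v P) s) (foldl h z (enum V)).
Proof.
move=> n0 R0 RS Rv.
apply: (forV_inv (I := fun k s' => Rel s' (foldl h z (take k (enum V))))
  (Q := fun s' => Rel s' (foldl h z (enum V))) n0).
- by rewrite take0.
- move=> k s' h1 h2 r; rewrite (take_nth k) ?size_enum_ord // foldl_rcons.
  by rewrite nth_ord_enum; apply: RS.
- by move=> s' _ _; rewrite take_oversize ?size_enum_ord //; exact: Rv.
Qed.

Lemma bpairE s ey ez ei ej (y z i j : V) : neval s ey = y -> neval s ez = z ->
  neval s ei = i -> neval s ej = j -> beval s (bpair ey ez ei ej) = eqpair y z i j.
Proof.
move=> hy hz hi hj; rewrite /= hy hz hi hj /eqpair -!val_eqE /= !eqn_leq.
by rewrite negb_and !negbK.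
Qed.

Lemma entryE s a ei ej (i j : V) : (forall i : V, nmem s 4 i = i * n.+1) ->
  neval s ei = i -> neval s ej = j -> neval s (entry a ei ej) = nmem s a (pos i j).
Proof. by move=> h4 hi hj; rewrite /= hi hj h4. Qed.

Lemma badjE s M (y z i j x a : V) : ctx M s -> nmem s 20 0 = y -> nmem s 21 0 = z ->
  nmem s 23 0 = i -> nmem s 24 0 = j -> nmem s 25 0 = x -> nmem s 26 0 = a ->
  beval s badj = adj M i j x a y z.
Proof.
move=> [_ h4 h5] hy hz hi hj hx ha; rewrite /badj.
have e : neval s (entry 5 (reg 20) (reg 21)) = M y z.
  by rewrite (@entryE s 5 _ _ y z) // h5.
have p1 := @bpairE s (reg 20) (reg 21) (reg 23) (reg 24) y z i j hy hz hi hj.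
have p2 := @bpairE s (reg 20) (reg 21) (reg 25) (reg 26) y z x a hy hz hx ha.
move: p1 p2 e; set b1 := bpair _ _ _ _; set b2 := bpair _ _ _ _; set e := entry _ _ _.
rewrite /adj /= => -> -> ->; case: (eqpair y z i j); case: (eqpair y z x a);
  by rewrite ?orbT ?orbF ?andbF ?andbT //=; case: (M y z) => [|[|k]].
Qed.

(** A path without repetitions has fewer edges than there are vertices, so the scan needs only that
    many rounds. *)
Lemma reach_path M (i j x a u : V) (v : V) :
  connect (adj M i j x a) u v ->
  exists p, [/\ path (adj M i j x a) u p, v = last u p & size p < n.+1].
Proof.
move=> /connectP [p0 /shortenP [p pp up _] vE]; exists p; split => //.
by have := max_card (mem (u :: p)); rewrite (card_uniqP up) card_ord.
Qed.

Definition params s (i j x a u : V) :=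
  [/\ nmem s 23 0 = i, nmem s 24 0 = j, nmem s 25 0 = x, nmem s 26 0 = a & nmem s 27 0 = u].

Lemma fill_spec v a e s (f : V -> nat) : nmem s 0 0 = n.+1 -> a != v ->
  (forall (k : V) s', unchanged [:: v; a] s s' ->
     (forall w : V, k <= w -> nmem s' a w = nmem s a w) -> nmem s' v 0 = k ->
     neval s' e = f k) ->
  forall w : V, nmem (cev (forV v (CN a (reg v) e)) s) a w = f w.
Proof.
move=> n0 av he; apply: (forV_inv (I := fun k s' => forall w : V,
    nmem s' a w = if w < k then f w else nmem s a w)
    (Q := fun s' => forall w : V, nmem s' a w = f w)) => //.
- move=> k s' h _ I w; rewrite [LHS]updE eqxx /= updE !eqxx /=.
  rewrite (he k); last 1 first.
  + by rewrite setn_eq.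
  + case: eqP => [wk|wk]; first by rewrite wk ltnSn; congr f; apply: val_inj.
    by rewrite updE (negbTE av) /= I ltnS [w <= k]leq_eqVlt (introF eqP wk).
  + move=> b j; rewrite !inE negb_or => /andP [h1 h2].
    by rewrite setnE // h // !inE negb_or h1.
  + by move=> w' kw; rewrite setnE // I ltnNge kw.
- by move=> s' _ _ I w; rewrite setnE // I ltn_ord.
Qed.

Lemma clear_spec v a b s : nmem s 0 0 = n.+1 -> uniq [:: v; a; b] ->
  forall w : V, nmem (cev (clear_where v a b) s) b w = if nmem s a w <= 0 then 0 else nmem s b w.
Proof.
move=> n0 u; rewrite /= !inE negb_or in u; case/and3P: u => /andP [va vb] ab _.
apply: (forV_inv (I := fun l s4 => (forall w : V, nmem s4 b w =
      if (w < l) && (nmem s a w <= 0) then 0 else nmem s b w))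
    (Q := fun s4 => forall w : V, nmem s4 b w = if nmem s a w <= 0 then 0 else nmem s b w)) => //.
- move=> l s4 h4 _ I4 w; rewrite cevIf; set s5 := setn v l s4.
  have e : beval s5 (NLe (NGet a (reg v)) (NLit 0)) = (nmem s a l <= 0).
    rewrite -[LHS]/(nmem s5 a (nmem s5 v 0) <= 0) setn_eq setnE 1?eq_sym // h4 //.
    by rewrite !inE negb_or eq_sym va.
  have I5 : nmem s5 b w = if (w < l) && (nmem s a w <= 0) then 0 else nmem s b w.
    by rewrite setnE 1?eq_sym.
  rewrite e; case: ifP => h7.
    rewrite cevN eqxx andTb -[neval s5 (reg v)]/(nmem s5 v 0) setn_eq.
    case: eqP => [wl|wl]; first by rewrite wl ltnSn h7.
    by rewrite I5 ltnS [w <= l]leq_eqVlt (introF eqP wl).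
  rewrite -[cev CSkip s5]/s5 I5 ltnS [w <= l]leq_eqVlt; case: eqP => [wl|//].
  by rewrite wl h7 !andbF.
- by move=> s4 _ _ I4 w; rewrite setnE 1?eq_sym // I4 ltn_ord.
Qed.

Lemma params_unchanged ws s s' i j x a u :
  all (fun b => b \notin ws) [:: 23; 24; 25; 26; 27] -> unchanged ws s s' ->
  params s i j x a u -> params s' i j x a u.
Proof.
by move=> /= /and5P [h1 h2 h3 h4 /andP [h5 _]] h [p1 p2 p3 p4 p5]; split; rewrite h.
Qed.

Lemma REACH_spec M s (i j x a u : V) : ctx M s -> params s i j x a u ->
  forall v : V, nmem (cev REACH s) 7 v = connect (adj M i j x a) u v.
Proof.
move=> cs [p1 p2 p3 p4 p5].
rewrite /REACH !cev_cons cev_nil.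
set s1 := cev (forV 20 _) s; set s2 := cev (CN 7 _ _) s1.
have s1E : unchanged [:: 20; 7] s s1 by move=> b k h; rewrite nframe.
have s2E : unchanged [:: 20; 7] s s2.
  by move=> b k h; rewrite nframe ?s1E //; move: h; rewrite !inE => /norP [].
have r1 : forall v : V, nmem s1 7 v = 0.
  by apply: (fill_spec (f := fun=> 0)) => //; case: cs.
have r2 : forall v : V, nmem s2 7 v = (v == u).
  move=> v.
  have e27 : neval s1 (reg 27) = u by rewrite -p5; apply: s1E.
  by rewrite cevN e27 r1 val_eqE; case: eqP.
have cs2 : ctx M s2 by apply: ctx_unchanged s2E cs.
pose A := adj M i j x a.
pose sound s' := forall v : V, nmem s' 7 v = 0 \/ (nmem s' 7 v = 1 /\ connect A u v).
have step s' (y z : V) : ctx M s' -> params s' i j x a u -> nmem s' 20 0 = y ->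
    nmem s' 21 0 = z -> sound s' ->
    let s'' := cev (CIf (BAnd (NLe (NLit 1) (NGet 7 (reg 20))) badj)
             (CN 7 (reg 21) (NLit 1)) CSkip) s' in
    [/\ sound s'', forall v : V, nmem s' 7 v = 1 -> nmem s'' 7 v = 1 &
       nmem s' 7 y = 1 -> A y z -> nmem s'' 7 z = 1].
  move=> c' [q1 q2 q3 q4 q5] hy hz so.
  have e : beval s' (BAnd (NLe (NLit 1) (NGet 7 (reg 20))) badj) = (0 < nmem s' 7 y) && A y z.
    by rewrite -[LHS]/((0 < nmem s' 7 (nmem s' 20 0)) && beval s' badj) hy
      (@badjE s' M y z i j x a).
  have e2 b l : nmem (cev (CN 7 (reg 21) (NLit 1)) s') b l =
      if (b == 7) && (l == z) then 1 else nmem s' b l.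
    by rewrite cevN -[neval s' (reg 21)]/(nmem s' 21 0) hz.
  rewrite cevIf e; case: (so y) => [y0|[y1 cy]]; first by rewrite y0; split.
  rewrite y1; case yz: (A y z); last by split.
  split.
  + move=> v; rewrite e2 eqxx andTb; case: eqP => [vz|_]; last exact: so.
    right; split => //; have -> : v = z by apply: val_inj.
    exact: connect_trans cy (connect1 yz).
  + by move=> v v1; rewrite e2 eqxx andTb; case: eqP.
  + by move=> _ _; rewrite e2 !eqxx.
have rowloop s0 (y : V) : ctx M s0 -> params s0 i j x a u -> nmem s0 20 0 = y -> sound s0 ->
    let s'' := cev (forV 21 (CIf (BAnd (NLe (NLit 1) (NGet 7 (reg 20))) badj)
             (CN 7 (reg 21) (NLit 1)) CSkip)) s0 in
    [/\ sound s'', forall v : V, nmem s0 7 v = 1 -> nmem s'' 7 v = 1 &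
       nmem s0 7 y = 1 -> forall z, A y z -> nmem s'' 7 (val (z : V)) = 1].
  move=> c0 q0 y0 so0.
  apply: (forV_inv (I := fun k s' => [/\ sound s', forall v : V, nmem s0 7 v = 1 -> nmem s' 7 v = 1 &
       nmem s0 7 y = 1 -> forall z : V, z < k -> A y z -> nmem s' 7 z = 1])
       (Q := fun s' => [/\ sound s', forall v : V, nmem s0 7 v = 1 -> nmem s' 7 v = 1 &
       nmem s0 7 y = 1 -> forall z : V, A y z -> nmem s' 7 z = 1])).
  - by case: c0.
  - by split.
  - move=> k s' h _ [so mo pr].
    have h' : unchanged [:: 21; 7] s0 (setn 21 k s').
      by move=> b l hb; move: (hb); rewrite !inE negb_or => /andP [b1 b2]; rewrite setnE // h.
    have [|||||so' mo' pr'] := step (setn 21 k s') y k.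
    + exact: ctx_unchanged h' c0.
    + exact: params_unchanged h' q0.
    + by rewrite h'.
    + by rewrite setn_eq.
    + by move=> v; rewrite setnE.
    split=> // [v v1|y1 z]; first by apply: mo'; rewrite setnE // mo.
    rewrite ltnS leq_eqVlt => /orP [/eqP zk|zk] yz.
      have -> : z = k by apply: val_inj.
      apply: pr'; first by rewrite setnE // mo.
      by rewrite -(val_inj zk).
    by apply: mo'; rewrite setnE // pr.
  - move=> s' _ _ [so mo pr]; split => [v|v v1|y1 z yz]; rewrite setnE //; first exact: mo.
    exact: pr.
have round s0 : ctx M s0 -> params s0 i j x a u -> sound s0 ->
    let s'' := cev (forV 20 (forV 21 (CIf (BAnd (NLe (NLit 1) (NGet 7 (reg 20))) badj)
             (CN 7 (reg 21) (NLit 1)) CSkip))) s0 in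
    [/\ sound s'', forall v : V, nmem s0 7 v = 1 -> nmem s'' 7 v = 1 &
       forall y z : V, nmem s0 7 y = 1 -> A y z -> nmem s'' 7 z = 1].
  move=> c0 q0 so0.
  apply: (forV_inv (I := fun k s' => [/\ sound s', forall v : V, nmem s0 7 v = 1 -> nmem s' 7 v = 1 &
       forall y z : V, y < k -> nmem s0 7 y = 1 -> A y z -> nmem s' 7 z = 1])
       (Q := fun s' => [/\ sound s', forall v : V, nmem s0 7 v = 1 -> nmem s' 7 v = 1 &
       forall y z : V, nmem s0 7 y = 1 -> A y z -> nmem s' 7 z = 1])).
  - by case: c0.
  - by split.
  - move=> k s' h _ [so mo pr].
    have h' : unchanged [:: 20; 21; 7] s0 (setn 20 k s').
      by move=> b l hb; move: (hb); rewrite !inE negb_or => /andP [b1 b2]; rewrite setnE // h.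
    have [||||so' mo' pr'] := rowloop (setn 20 k s') k.
    + exact: ctx_unchanged h' c0.
    + exact: params_unchanged h' q0.
    + by rewrite setn_eq.
    + by move=> v; rewrite setnE.
    split=> // [v v1|y z]; first by apply: mo'; rewrite setnE // mo.
    rewrite ltnS leq_eqVlt => /orP [/eqP yk|yk] y1 yz.
      have yk' : y = k by apply: val_inj.
      by rewrite yk' in y1 yz; apply: pr' => //; rewrite setnE // mo.
    by apply: mo'; rewrite setnE // (pr y).
  - move=> s' _ _ [so mo pr]; split => [v|v v1|y z y1 yz]; rewrite setnE //; first exact: mo.
    exact: (pr y).
have so2 : sound s2.
  by move=> v; rewrite r2; case: eqP => [->|_]; [right|left].
have q2 : params s2 i j x a u by apply: params_unchanged s2E _.
(* Marks are never wrong, and after [k] rounds every path with at most [k] edges has its end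
   marked. *)
apply: (forV_inv (I := fun k s' => sound s' /\
    forall p, path A u p -> size p <= k -> nmem s' 7 (last u p) = 1)
    (Q := fun s' => forall v : V, nmem s' 7 v = connect A u v)).
- by case: cs2.
- by split=> // -[|//] _ _; have := r2 u; rewrite eqxx.
- move=> k s' h _ [so pr].
  have h' : unchanged [:: 22; 20; 21; 7] s2 (setn 22 k s').
    by move=> b l hb; move: (hb); rewrite !inE negb_or => /andP [b1 b2]; rewrite setnE // h.
  have [|||so' mo' pr'] := round (setn 22 k s').
  + exact: ctx_unchanged h' cs2.
  + exact: params_unchanged h' q2.
  + by move=> v; rewrite setnE.
  split=> //; case/lastP => [|p z].
    by move=> _ _; apply: mo'; rewrite setnE //; apply: (pr [::]).
  rewrite rcons_path last_rcons size_rcons ltnS => /andP [pp yz] sz.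
  by apply: pr' yz; rewrite setnE //; apply: pr.
- move=> s' _ _ [so pr] v; rewrite setnE //.
  case cv: (connect A u v).
    by have [p [pp -> sp]] := reach_path cv; apply: pr pp (ltnW sp).
  by case: (so v) => [//|[_]]; rewrite cv.
Qed.

Lemma COVER_spec M s (x a u : V) : ctx M s -> nmem s 25 0 = x -> nmem s 26 0 = a ->
  nmem s 27 0 = u -> forall v : V, nmem (cev COVER s) 8 v = covm M u v x a.
Proof.
move=> cs p3 p4 p5.
rewrite /COVER !cev_cons cev_nil.
set s1 := cev (forV 20 _) s.
have s1E : unchanged [:: 20; 8] s s1 by move=> b k h; rewrite nframe.
have r1 : forall v : V, nmem s1 8 v = 1.
  by apply: (fill_spec (f := fun=> 1)) => //; case: cs.
have cs1 : ctx M s1 by apply: ctx_unchanged s1E cs.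
pose A i j := adj M i j x a.
have inner s0 (i : V) (f : V -> bool) : ctx M s0 ->
    [/\ nmem s0 23 0 = i, nmem s0 25 0 = x, nmem s0 26 0 = a & nmem s0 27 0 = u] ->
    (forall v : V, nmem s0 8 v = f v) ->
    forall v : V, nmem (cev (forV 24 (CSeq REACH
        (clear_where 20 7 8))) s0) 8 v =
      f v && [forall j, connect (A i j) u v].
  move=> c0 [q1 q2 q3 q4] f0.
  apply: (forV_inv (I := fun k s' => forall v : V,
       nmem s' 8 v = f v && [forall (j : V | j < k), connect (A i j) u v])
       (Q := fun s' => forall v : V, nmem s' 8 v = f v && [forall j, connect (A i j) u v])).
  - by case: c0.
  - move=> v; rewrite f0; congr (nat_of_bool _); rewrite -[LHS]andbT; congr (_ && _).
    by apply/esym/forallP.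
  - move=> k s' h _ fs; set s2 := setn 24 k s'.
    have h2 : unchanged [:: 24; 22; 21; 20; 7; 8] s0 s2.
      by move=> b l hb; move: (hb); rewrite !inE negb_or => /andP [b1 b2]; rewrite setnE // h //= !inE;
         move: hb; rewrite !inE; do 5 case: (b == _).
    have c2 : ctx M s2 by apply: ctx_unchanged h2 c0.
    have pr : params s2 i k x a u by split; rewrite ?setn_eq // h2.
    have rs := REACH_spec c2 pr.
    rewrite cev_seq; set s3 := cev REACH s2.
    have e8 v : nmem s3 8 v = nmem s' 8 v by rewrite nframe // setnE.
    have c3 : ctx M s3 by apply: ctx_cev c2.
    move=> v; rewrite clear_spec //; last by case: c3.
    rewrite rs e8 fs.
    have -> : [forall (j : V | j < k.+1), connect (A i j) u v] =
       [forall (j : V | j < k), connect (A i j) u v] && connect (A i k) u v.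
      apply/forallP/andP => [H|[/forallP H1 H2] j].
        split; last by have := H k; rewrite ltnSn.
        by apply/forallP => j; apply/implyP => jk; have := H j; rewrite ltnS ltnW.
      apply/implyP; rewrite ltnS leq_eqVlt => /orP [/eqP/val_inj -> //|jk].
      by have := H1 j; rewrite jk.
    by rewrite -/(A i k); case: (connect (A i k) u v); rewrite ?andbT ?andbF.
  - move=> s' _ _ fs v; rewrite setnE // fs; congr (nat_of_bool (_ && _)).
    by apply: eq_forallb => j; rewrite ltn_ord.
have ih s' k : unchanged (23 :: nwrites (forV 24 (CSeq REACH
        (clear_where 20 7 8)))) s1 s' ->
    unchanged [:: 23; 24; 22; 21; 20; 7; 8] s1 (setn 23 k s').
  move=> h b l hb; move: (hb); rewrite !inE negb_or => /andP [b1 b2]; rewrite setnE // h //= !inE;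
         move: hb; rewrite !inE; by do 6 case: (b == _).
apply: (forV_inv (I := fun k s' => forall v : V,
       nmem s' 8 v = [forall (i : V | i < k), forall j, connect (A i j) u v])
       (Q := fun s' => forall v : V, nmem s' 8 v = covm M u v x a)).
- by case: cs1.
- by move=> v; rewrite r1; case: forallP => // h; case: h.
- move=> k s' h _ fs v.
  have h2 := ih s' k h.
  rewrite (@inner _ k (fun v => [forall (i : V | i < k), forall j, connect (A i j) u v])).
  + congr (nat_of_bool _); apply/andP/forallP => [[/forallP H1 H2] i|H].
      apply/implyP; rewrite ltnS leq_eqVlt => /orP [/eqP/val_inj -> //|jk].
      by have := H1 i; rewrite jk.
    split; last by have := H k; rewrite ltnSn.
    by apply/forallP => i; apply/implyP => ik; have := H i; rewrite ltnS ltnW.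
  + exact: ctx_unchanged h2 cs1.
  + by split; rewrite ?setn_eq // h2 // s1E.
  + by move=> w; rewrite setnE.
- move=> s' _ _ fs v; rewrite setnE // fs; congr (nat_of_bool _).
  by apply: eq_forallb => i; rewrite ltn_ord.
Qed.

Lemma cev_skip s : cev CSkip s = s.
Proof. by []. Qed.

End Correctness.
Arguments cev : simpl never.
Arguments setn : simpl never.

(** * Leaf blocks and tokens *)

Definition incr a e := set_reg a (NAdd (reg a) e).

Definition EXITS_ROW :=
  forV 21 (CIf (NLe (NGet 8 (reg 21)) (NLit 0)) (incr 28 (entry 5 (reg 31) (reg 21))) CSkip).

(** Register 28 counts the leaving edges; register 29 drops to 0 when the block has a vertex smaller
    than the candidate. *)
Definition EXITS_BODY :=
  CIf (NLe (NLit 1) (NGet 8 (reg 31)))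
    (CSeq (CIf (NLe (NAdd (reg 31) (NLit 1)) (reg 27)) (set_reg 29 (NLit 0)) CSkip)
          EXITS_ROW)
    CSkip.

Definition LEAVES_BODY := seqs
  [:: set_reg 25 (reg 27); set_reg 26 (reg 27); COVER;
      set_reg 28 (NLit 0); set_reg 29 (NLit 1); forV 31 EXITS_BODY;
      CIf (BAnd (NLe (NLit 1) (reg 29)) (NLe (reg 28) (NLit 1)))
        (CSeq (CN 9 (reg 30) (reg 27)) (incr 30 (NLit 1))) CSkip].

Definition LEAVES := CSeq (set_reg 30 (NLit 0)) (forV 27 LEAVES_BODY).

(** An index past the table gives vertex 0, matching the default of [nth] in [getleaf]. *)
Definition GETLEAF a d :=
  CIf (NLe (NAdd d (NLit 1)) (reg 30)) (set_reg a (NGet 9 d)) (set_reg a (NLit 0)).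

Definition COVER_FROM b u x a := seqs
  [:: set_reg 27 u; set_reg 25 x; set_reg 26 a; COVER; clear_where 20 8 b].

Definition digit k := NGet 18 (NAdd (reg 39) (NLit k)).

(* The token with digits k, ..., k + 3 is stored in array [b]. *)
Definition TOKEN b k := seqs
  [:: GETLEAF 36 (digit k); GETLEAF 37 (digit k.+1); GETLEAF 38 (digit k.+2);
      forV 20 (CN b (reg 20) (NLit 1));
      CIf (NLe (digit k.+3) (NLit 0))
        (seqs [:: COVER_FROM b (reg 36) (reg 36) (reg 37);
                  COVER_FROM b (reg 37) (reg 37) (reg 38);
                  COVER_FROM b (reg 38) (reg 38) (reg 36)])
        (seqs [:: set_reg 23 (reg 36); set_reg 24 (reg 36); set_reg 25 (reg 36);
                  set_reg 26 (reg 36); set_reg 27 (reg 36); REACH; clear_where 20 7 b])].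

Section Tokens.
Variables (R : realType) (n : nat).
Notation V := 'I_n.+1.
Implicit Types (s : state R) (M : V -> V -> nat).

Lemma cev_set a e s b j : nmem (cev (set_reg a e) s) b j =
  if (b == a) && (j == 0) then neval s e else nmem s b j.
Proof. by []. Qed.

Lemma cev_set_eq a e s : nmem (cev (set_reg a e) s) a 0 = neval s e.
Proof. by rewrite cev_set !eqxx. Qed.

Lemma cev_set_neq a e s b j : b != a -> nmem (cev (set_reg a e) s) b j = nmem s b j.
Proof. by rewrite cev_set => /negbTE ->. Qed.

Lemma notin_sub (l ws : seq nat) a : a \notin ws -> all (mem ws) l -> a \notin l.
Proof. by move=> h /allP k; apply: contra h => /k. Qed.

(** Sums, conjunctions and filters are turned into folds, the form that [forV_fold] delivers. *)
Lemma sum_foldl (P : pred V) (F : V -> nat) :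
  \sum_(y | P y) F y = foldl (fun a y => if P y then a + F y else a) 0 (enum V).
Proof.
have -> : \sum_(y | P y) F y = \sum_(y <- enum V | P y) F y by rewrite big_enum_cond.
have h l z : z + \sum_(y <- l | P y) F y = foldl (fun a y => if P y then a + F y else a) z l.
  elim: l z => [|y l IH] z; first by rewrite big_nil addn0.
  by rewrite big_cons /= -IH; case: (P y); rewrite ?addnA.
by rewrite -h add0n.
Qed.

Lemma all_foldl (P : pred V) (l : seq V) :
  all P l = foldl (fun a y => if P y then a else false) true l.
Proof.
have h l' b : b && all P l' = foldl (fun a y => if P y then a else false) b l'.
  elim: l' b => [|y l' IH] b /=; first by rewrite andbT.
  by rewrite -IH; case: (P y); rewrite ?andbF.
by rewrite -h.
Qed.

Lemma filter_foldl (P : pred V) (l : seq V) :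
  seq.filter P l = foldl (fun acc y => if P y then rcons acc y else acc) [::] l.
Proof.
have h l' acc : acc ++ seq.filter P l' = foldl (fun acc y => if P y then rcons acc y else acc) acc l'.
  elim: l' acc => [|y l' IH] acc /=; first by rewrite cats0.
  by rewrite -IH; case: (P y); rewrite // cat_rcons.
by rewrite -h.
Qed.

Lemma EXITS_ROW_spec M s (y : V) (P : V -> bool) : ctx M s -> nmem s 31 0 = y ->
  (forall z : V, nmem s 8 z = P z) ->
  nmem (cev EXITS_ROW s) 28 0 = nmem s 28 0 + \sum_(z | ~~ P z) M y z.
Proof.
move=> cs hy h8; rewrite sum_foldl.
have h : nmem s 28 0 + 0 = nmem s 28 0 by rewrite addn0.
apply: (forV_fold (Rel := fun s' (a : nat) => nmem s' 28 0 = nmem s 28 0 + a)).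
- by case: cs.
- by rewrite addn0.
- move=> z s' acc hs _ e; rewrite cevIf; set s2 := setn 21 z s'.
  have u2 : unchanged [:: 21; 28] s s2.
    by move=> b j; rewrite !inE negb_or => /andP [b1 b2]; rewrite setnE // hs //= !inE negb_or b1.
  have c2 : ctx M s2 by apply: ctx_unchanged u2 cs.
  have z2 : neval s2 (reg 21) = z by apply: setn_eq.
  have -> : beval s2 (NLe (NGet 8 (reg 21)) (NLit 0)) = ~~ P z.
    by rewrite -[LHS]/(nmem s2 8 (neval s2 (reg 21)) <= 0) z2 u2 // h8; case: (P z).
  have e2 : nmem s2 28 0 = nmem s 28 0 + acc by rewrite setnE.
  case: ifP => _; last by [].
  have [_ c4 c5] := c2.
  rewrite /incr cev_set_eq -[LHS]/(nmem s2 28 0 + neval s2 (entry 5 (reg 31) (reg 21))).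
  rewrite (@entryE _ _ s2 5 _ _ y z) //; last by rewrite -hy; apply: u2.
  by rewrite c5 e2 addnA.
- by move=> s' acc; rewrite setnE.
Qed.

Lemma EXITS_spec M s (u : V) : ctx M s -> nmem s 27 0 = u ->
  (forall z : V, nmem s 8 z = covm M u z u u) -> nmem s 28 0 = 0 -> nmem s 29 0 = 1 ->
  let s' := cev (forV 31 EXITS_BODY) s in
  nmem s' 28 0 = exits M u /\
  nmem s' 29 0 = [forall y, covm M u y u u ==> (u <= y)].
Proof.
move=> cs hu h8 h28 h29; rewrite /exits sum_foldl.
have -> : [forall y, covm M u y u u ==> (u <= y)] = all (fun y => covm M u y u u ==> (u <= y)) (enum V).
  by apply/forallP/allP => [h y _|h y]; apply: h; rewrite ?mem_enum.
rewrite all_foldl.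
pose h (acc : nat * bool) (y : V) :=
  (if covm M u y u u then acc.1 + \sum_(z | ~~ covm M u z u u) M y z else acc.1,
   if covm M u y u u ==> (u <= y) then acc.2 else false).
have hE l a b : foldl h (a, b) l =
    (foldl (fun a y => if covm M u y u u then a + \sum_(z | ~~ covm M u z u u) M y z else a) a l,
     foldl (fun a y => if covm M u y u u ==> (u <= y) then a else false) b l).
  by elim: l a b => //= y l IH a b; rewrite /h /= IH.
pose Rel s' (acc : nat * bool) := nmem s' 28 0 = acc.1 /\ nmem s' 29 0 = acc.2.
suff : Rel (cev (forV 31 EXITS_BODY) s) (foldl h (0, true) (enum V)) by rewrite hE.
apply: (forV_fold (Rel := Rel)).
- by case: cs.
- by split.
- move=> y s' [a b] hs _ [ea eb]; rewrite /Rel /EXITS_BODY cevIf; set s2 := setn 31 y s'.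
  have u2 : unchanged [:: 31; 21; 28; 29] s s2.
    move=> c j hc; move: (hc); rewrite !inE negb_or => /andP [b1 b2]; rewrite setnE // hs //= !inE.
    by move: hc; rewrite !inE; do 4 case: (c == _).
  have c2 : ctx M s2 by apply: ctx_unchanged u2 cs.
  have y2 : neval s2 (reg 31) = y by apply: setn_eq.
  have -> : beval s2 (NLe (NLit 1) (NGet 8 (reg 31))) = covm M u y u u.
    by rewrite -[LHS]/(0 < nmem s2 8 (neval s2 (reg 31))) y2 u2 // h8; case: covm.
  rewrite /h /=; case: ifP => cv; last by rewrite cev_skip; split; [exact: ea|exact: eb].
  rewrite cev_seq; set s3 := cev (CIf _ _ _) s2.
  have u3 : unchanged [:: 29] s2 s3 by move=> c j hc; rewrite nframe.
  split.
    rewrite (@EXITS_ROW_spec M _ y (fun z => covm M u z u u)).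
    + by rewrite u3 // setnE // ea.
    + by apply: ctx_unchanged u3 c2.
    + by rewrite u3 // -y2.
    + by move=> z; rewrite u3 // u2.
  rewrite nframe // /s3 cevIf.
  have -> : beval s2 (NLe (NAdd (reg 31) (NLit 1)) (reg 27)) = (y < u).
    rewrite -[LHS]/(neval s2 (reg 31) + 1 <= nmem s2 27 0) y2 u2 // hu addn1 //.
  rewrite ltnNge; case: (u <= y); first exact: eb.
  by rewrite cev_set_eq.
- by move=> s' [a b] [h1 h2]; split; rewrite setnE.
Qed.

Definition leaf_table M s :=
  nmem s 30 0 = size (leaves M) /\
  forall d, d < size (leaves M) -> nmem s 9 d = nth ord0 (leaves M) d.

Lemma LEAVES_spec M s : ctx M s -> leaf_table M (cev LEAVES s).
Proof.
move=> cs; rewrite /LEAVES cev_seq; set s1 := cev (set_reg 30 _) s.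
have c1 : ctx M s1 by apply: ctx_cev cs.
pose Rel s' l := nmem s' 30 0 = size l /\ forall d, d < size l -> nmem s' 9 d = nth (ord0 : V) l d.
suff : Rel (cev (forV 27 LEAVES_BODY) s1) (foldl (fun acc y => if leafrep M y then rcons acc y else acc) [::] (enum V)).
  by rewrite -filter_foldl.
apply: (forV_fold (Rel := Rel)).
- by case: c1.
- by split => [|d]; rewrite ?cev_set_eq.
- move=> u s' l hs _ [e30 e9]; rewrite /Rel /LEAVES_BODY; set s2 := setn 27 u s'.
  have c2 : ctx M s2.
    by apply: ctx_setn => //; apply: ctx_unchanged hs c1.
  rewrite 2!cev_cons; set s3 := cev (set_reg 26 _) _.
  have u3 : unchanged [:: 25; 26] s2 s3.
    by move=> b j; rewrite !inE negb_or => /andP [h1 h2]; rewrite !cev_set_neq.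
  have c3 : ctx M s3 by apply: ctx_unchanged u3 c2.
  have e27 : nmem s3 27 0 = u by rewrite u3 // setn_eq.
  have e26 : nmem s3 26 0 = u by rewrite cev_set_eq -[LHS]/(nmem s2 27 0) setn_eq.
  have e25 : nmem s3 25 0 = u by rewrite cev_set_neq // cev_set_eq -[LHS]/(nmem s2 27 0) setn_eq.
  have cv := COVER_spec c3 e25 e26 e27.
  rewrite 3!cev_cons; set s4 := cev COVER s3 in cv *; set s5 := cev (set_reg 29 _) _.
  have u5 : unchanged [:: 28; 29] s4 s5.
    by move=> b j; rewrite !inE negb_or => /andP [h1 h2]; rewrite !cev_set_neq.
  have c4 : ctx M s4 by apply: ctx_cev c3.
  have c5 : ctx M s5 by apply: ctx_unchanged u5 c4.
  have [||||x1 x2] := @EXITS_spec M s5 u c5.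
  + by rewrite u5 // nframe.
  + by move=> z; rewrite u5.
  + by rewrite cev_set_neq // cev_set_eq.
  + by rewrite cev_set_eq.
  rewrite cev_cons; set s6 := cev (forV 31 _) s5 in x1 x2 *.
  have f6 a j : a \notin [:: 27; 25; 26; 28; 29; 31; 20; 8; 23; 24; 22; 21; 7] ->
      nmem s6 a j = nmem s' a j.
    move=> ha; have hb b : b \in [:: 27; 25; 26; 28; 29; 31; 20; 8; 23; 24; 22; 21; 7] -> a != b.
      by move=> hb; apply: contraNneq ha => ->.
    rewrite nframe; last by apply: (notin_sub ha).
    rewrite u5; last by rewrite !inE !(negbTE (hb _ _)).
    rewrite nframe; last by apply: (notin_sub ha).
    rewrite u3; last by rewrite !inE !(negbTE (hb _ _)).
    by rewrite setnE // hb.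
  rewrite cev_cons cev_nil cevIf.
  have -> : beval s6 (BAnd (NLe (NLit 1) (reg 29)) (NLe (reg 28) (NLit 1))) = leafrep M u.
    by rewrite -[LHS]/((0 < nmem s6 29 0) && (nmem s6 28 0 <= 1)) x1 x2 /leafrep; case: [forall _, _].
  case: ifP => _; last by rewrite -[cev CSkip s6]/s6 f6 //; split => // d dl; rewrite f6 ?e9.
  rewrite cev_seq; split.
    rewrite /incr cev_set_eq -[LHS]/(nmem (cev (CN 9 (reg 30) (reg 27)) s6) 30 0 + 1).
    by rewrite nframe // f6 // e30 size_rcons addn1.
  move=> d; rewrite size_rcons ltnS => dl; rewrite /incr cev_set_neq // cevN eqxx andTb.
  rewrite -[neval s6 (reg 30)]/(nmem s6 30 0) f6 // e30 nth_rcons.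
  move: dl; rewrite leq_eqVlt => /orP [/eqP ->|dl].
    rewrite eqxx ltnn -[neval s6 (reg 27)]/(nmem s6 27 0) nframe // u5 // nframe //.
  by rewrite dl (ltn_eqF dl) f6 // e9.
- by move=> s' l [h1 h2]; split => [|d /h2]; rewrite setnE.
Qed.

Lemma unchanged_cev c s : unchanged (nwrites c) s (cev c s).
Proof. by move=> a j; exact: nframe. Qed.

Lemma GETLEAF_spec M s a d k : leaf_table M s -> neval s d = k ->
  nmem (cev (GETLEAF a d) s) a 0 = getleaf M k.
Proof.
move=> [h30 h9] hd; rewrite cevIf.
have -> : beval s (NLe (NAdd d (NLit 1)) (reg 30)) = (k < size (leaves M)).
  by rewrite -[LHS]/(neval s d + 1 <= nmem s 30 0) hd addn1 h30.
case: ifP => h; rewrite cev_set_eq /getleaf.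
  by rewrite -[LHS]/(nmem s 9 (neval s d)) hd h9.
by rewrite nth_default // leqNgt h.
Qed.

Lemma COVER_FROM_spec M s b eu ex ea (u x a : V) (P : V -> bool) : ctx M s ->
  neval s eu = u -> neval s ex = x -> neval s ea = a ->
  all (fun e => ~~ has (mem [:: 25; 26; 27]) (nreads e)) [:: eu; ex; ea] ->
  uniq [:: 20; 8; b] -> b \notin nwrites COVER -> b \notin [:: 25; 26; 27] ->
  (forall v : V, nmem s b v = P v) ->
  forall v : V, nmem (cev (COVER_FROM b eu ex ea) s) b v = P v && covm M u v x a.
Proof.
move=> cs hu hx ha /and4P [_ /hasPn rx /hasPn ra _] ub bC b3 hP v.
rewrite /COVER_FROM 3!cev_cons; set s1 := cev (set_reg 26 _) _.
have u1 : unchanged [:: 25; 26; 27] s s1.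
  by move=> c j; rewrite !inE !negb_or => /and3P [h1 h2 h3]; rewrite !cev_set_neq.
have c1 : ctx M s1 by apply: ctx_unchanged u1 cs.
have e27 : nmem s1 27 0 = u by [].
have e25 : nmem s1 25 0 = x.
  rewrite cev_set_neq // cev_set_eq -hx; apply: neval_agree => c j /rx.
  by rewrite !inE !negb_or => /and3P [h1 h2 h3]; rewrite cev_set_neq.
have e26 : nmem s1 26 0 = a.
  rewrite cev_set_eq -ha; apply: neval_agree => c j /ra.
  by rewrite !inE !negb_or => /and3P [h1 h2 h3]; rewrite !cev_set_neq.
rewrite 2!cev_cons cev_nil clear_spec //; last by case: (@ctx_cev R n M COVER s1 isT c1).
rewrite (COVER_spec c1 e25 e26 e27) nframe // u1 // hP.
by case: (P v); case: covm.
Qed.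

Definition digits s (d : nat -> nat) := forall k, k < 10 -> neval s (digit k) = d k.

Lemma digits_unchanged ws s s' d : (18 \notin ws) && (39 \notin ws) -> unchanged ws s s' ->
  digits s d -> digits s' d.
Proof.
move=> /andP [h1 h2] h hd k k10; rewrite -hd //; apply/esym/neval_agree => a j.
by rewrite !inE => /orP [/eqP ->|/eqP ->]; rewrite h.
Qed.

Lemma leaf_table_unchanged ws M s s' : (9 \notin ws) && (30 \notin ws) -> unchanged ws s s' ->
  leaf_table M s -> leaf_table M s'.
Proof.
by move=> /andP [h1 h2] h [k1 k2]; split => [|d /k2]; rewrite h.
Qed.

Lemma TOKEN_spec M s b k d : ctx M s -> leaf_table M s -> digits s d -> k.+3 < 10 ->
  (b == 10) || (b == 11) ->
  forall v : V, nmem (cev (TOKEN b k) s) b v =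
    tokm M (d k) (d k.+1) (d k.+2) (d k.+3) v.
Proof.
move=> cs ls ds k10 b10.
rewrite /TOKEN 3!cev_cons; set s1 := cev (GETLEAF 36 _) s.
set s2 := cev (GETLEAF 37 _) s1; set s3 := cev (GETLEAF 38 _) s2.
have u1 : unchanged [:: 36] s s1 by move=> c j h; rewrite nframe //; move: h; rewrite !inE orbb.
have u2 : unchanged [:: 37] s1 s2 by move=> c j h; rewrite nframe //; move: h; rewrite !inE orbb.
have u3 : unchanged [:: 38] s2 s3 by move=> c j h; rewrite nframe //; move: h; rewrite !inE orbb.
have l1 : leaf_table M s1 by apply: leaf_table_unchanged u1 ls.
have l2 : leaf_table M s2 by apply: leaf_table_unchanged u2 l1.
have d1 : digits s1 d by apply: digits_unchanged u1 ds.
have d2 : digits s2 d by apply: digits_unchanged u2 d1.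
have d3 : digits s3 d by apply: digits_unchanged u3 d2.
have c3 : ctx M s3.
  by apply: (ctx_unchanged _ u3) => //; apply: (ctx_unchanged _ u2) => //; apply: ctx_unchanged u1 cs.
have e36 : nmem s3 36 0 = getleaf M (d k).
  by rewrite u3 // u2 //; apply: GETLEAF_spec ls _; apply: ds; lia.
have e37 : nmem s3 37 0 = getleaf M (d k.+1).
  by rewrite u3 //; apply: GETLEAF_spec l1 _; apply: d1; lia.
have e38 : nmem s3 38 0 = getleaf M (d k.+2).
  by apply: GETLEAF_spec l2 _; apply: d2; lia.
rewrite cev_cons; set s4 := cev (forV 20 _) s3.
have bI : b \in [:: 10; 11] by rewrite !inE.
have bn c : c \notin [:: 10; 11] -> c != b by move=> h; apply: contraNneq h => ->.
have u4 : unchanged [:: 20; b] s3 s4 by move=> c j h; rewrite nframe.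
have e4 : forall v : V, nmem s4 b v = 1.
  apply: (fill_spec (f := fun=> 1)) => //; first by case: c3.
  by rewrite eq_sym bn.
have uw c : c \notin [:: 20; 10; 11] -> c \notin [:: 20; b].
  by rewrite !inE !negb_or => /andP [-> h] /=; apply: bn; rewrite !inE negb_or.
have c4 : ctx M s4.
  by apply: ctx_unchanged u4 c3; rewrite /= !uw.
have d4 : digits s4 d by apply: digits_unchanged u4 d3; rewrite !uw.
have f36 : nmem s4 36 0 = getleaf M (d k) by rewrite u4 // uw.
have f37 : nmem s4 37 0 = getleaf M (d k.+1) by rewrite u4 // uw.
have f38 : nmem s4 38 0 = getleaf M (d k.+2) by rewrite u4 // uw.
rewrite cev_cons cev_nil cevIf.
have -> : beval s4 (NLe (digit k.+3) (NLit 0)) = (d k.+3 == 0).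
  by rewrite -[LHS]/(neval s4 (digit k.+3) <= 0) d4 // leqn0.
have ub : uniq [:: 20; 8; b] by rewrite /= !inE negb_or !bn.
have bC : b \notin nwrites COVER by case/orP: b10 => /eqP ->.
have b3 : b \notin [:: 25; 26; 27] by case/orP: b10 => /eqP ->.
rewrite /tokm; case: ifP => dk v.
  rewrite 3!cev_cons cev_nil.
  set s5 := cev (COVER_FROM _ _ _ _) s4; set s6 := cev (COVER_FROM _ _ _ _) s5.
  have wC c : c \in [:: 0; 4; 5; 36; 37; 38] -> c \notin nwrites (COVER_FROM b (reg 36) (reg 36) (reg 37)).
    have : all (fun c => c \notin nwrites (COVER_FROM b (reg 36) (reg 36) (reg 37))) [:: 0; 4; 5; 36; 37; 38].
      by case/orP: b10 => /eqP ->.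
    by move=> /allP; apply.
  have u5 c j : c \in [:: 0; 4; 5; 36; 37; 38] -> nmem s5 c j = nmem s4 c j.
    by move=> h; rewrite nframe // wC.
  have u6 c j : c \in [:: 0; 4; 5; 36; 37; 38] -> nmem s6 c j = nmem s5 c j.
    by move=> h; rewrite nframe // wC.
  have c5 : ctx M s5 by case: c4 => h1 h2 h3; split=> [|i|i j]; rewrite u5.
  have c6 : ctx M s6 by case: c5 => h1 h2 h3; split=> [|i|i j]; rewrite u6.
  have e5 : forall v : V, nmem s5 b v = covm M (getleaf M (d k)) v (getleaf M (d k)) (getleaf M (d k.+1)).
    by apply: (COVER_FROM_spec (P := fun=> true) c4).
  have e6 := @COVER_FROM_spec M s5 b (reg 37) (reg 37) (reg 38) _ _ _ _ c5 (etrans (u5 37 0 isT) f37) (etrans (u5 37 0 isT) f37)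
    (etrans (u5 38 0 isT) f38) isT ub bC b3 e5.
  have e7 := @COVER_FROM_spec M s6 b (reg 38) (reg 38) (reg 36) _ _ _ _ c6 (etrans (u6 38 0 isT) (etrans (u5 38 0 isT) f38))
     (etrans (u6 38 0 isT) (etrans (u5 38 0 isT) f38))
    (etrans (u6 36 0 isT) (etrans (u5 36 0 isT) f36)) isT ub bC b3 e6.
  by rewrite e7 /= andbA.
rewrite 5!cev_cons; set s5 := cev (set_reg 27 _) _.
have u5 : unchanged [:: 23; 24; 25; 26; 27] s4 s5.
  by move=> c j; rewrite !inE !negb_or => /and5P [h1 h2 h3 h4 h5]; rewrite !cev_set_neq.
have c5 : ctx M s5 by apply: ctx_unchanged u5 c4.
have p5 : params s5 (getleaf M (d k)) (getleaf M (d k)) (getleaf M (d k)) (getleaf M (d k)) (getleaf M (d k)).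
  by split; rewrite -f36.
rewrite 2!cev_cons cev_nil clear_spec.
- rewrite (REACH_spec c5 p5) nframe; last by case/orP: b10 => /eqP ->.
  rewrite u5 ?e4; last by move: b10 => /orP [] /eqP ->.
  by rewrite /connm; case: connect.
- by case: (@ctx_cev R n M REACH s5 isT c5).
- by rewrite /= !inE negb_or !bn.
Qed.

End Tokens.

(** * The chain table *)

Definition link_cost i j := RGet 0 (NAdd (NGet 4 i) j).
Definition new_cost := RAdd (RGet 1 (reg 27)) (link_cost (reg 25) (reg 26)).

(** Of each chain only the link at position [digit 9] is stored: the new link if the old chain has
    exactly that length, and otherwise what the predecessor stored. *)
Definition UPDATE :=
  CIf (BAnd (NLe (NLit 1) (NGet 8 (reg 31)))
        (bor (NLe (NGet 13 (reg 31)) (NLit 0)) (BNot (RLe (RGet 2 (reg 31)) new_cost))))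
    (seqs [:: CN 13 (reg 31) (NLit 1); CR 2 (reg 31) new_cost;
       CIf (beq (reg 32) (digit 9))
         (seqs [:: CN 16 (reg 31) (reg 25); CN 17 (reg 31) (reg 26)])
         (seqs [:: CN 16 (reg 31) (NGet 14 (reg 27)); CN 17 (reg 31) (NGet 15 (reg 27))])])
    CSkip.

Definition RELAX_BODY :=
  CIf (BAnd (NLe (NLit 1) (NGet 12 (reg 27)))
        (BAnd (BNot (beq (reg 25) (reg 26))) (NLe (entry 6 (reg 25) (reg 26)) (NLit 0))))
    (CSeq COVER (forV 31 UPDATE)) CSkip.

(** A new layer is built in arrays of its own, since every relaxation has to read the previous
    layer. *)
Definition COPY := forV 31 (seqs
  [:: CN 12 (reg 31) (NGet 13 (reg 31)); CR 1 (reg 31) (RGet 2 (reg 31));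
      CN 14 (reg 31) (NGet 16 (reg 31)); CN 15 (reg 31) (NGet 17 (reg 31))]).

Definition RELAX := seqs
  [:: forV 31 (CN 13 (reg 31) (NLit 0)); forV 27 (forV 25 (forV 26 RELAX_BODY)); COPY].

Definition INIT := forV 31 (seqs
  [:: CN 12 (reg 31) (NGet 10 (reg 31)); CR 1 (reg 31) RZero;
      CN 14 (reg 31) (NLit 0); CN 15 (reg 31) (NLit 0)]).

(** The loop bound has to be [p], as [small_bounds] admits no digit; the test inside disables the
    surplus rounds. *)
Definition CHAINS :=
  CFor 32 (NGet 0 (NLit 1)) (CIf (NLe (NAdd (reg 32) (NLit 1)) (digit 8)) RELAX CSkip).

Definition BEST := seqs
  [:: set_reg 33 (NLit 0); set_reg 34 (NLit 0); set_reg 35 (NLit 0);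
      forV 31 (CIf
        (BAnd (NLe (NLit 1) (NGet 12 (reg 31))) (BAnd (NLe (NLit 1) (NGet 11 (reg 31)))
           (bor (NLe (reg 33) (NLit 0)) (BNot (RLe (RGet 4 (NLit 0)) (RGet 1 (reg 31)))))))
        (seqs [:: set_reg 33 (NLit 1); CR 4 (NLit 0) (RGet 1 (reg 31));
                  set_reg 34 (NGet 14 (reg 31)); set_reg 35 (NGet 15 (reg 31))])
        CSkip)].

Section Chains.
Variables (R : realType) (n : nat).
Notation V := 'I_n.+1.
Implicit Types (s : state R) (M : V -> V -> nat) (FM : rel V).
Variable cm : V -> V -> \bar R.

Definition runchanged (ws : seq nat) s s' :=
  forall a j, a \notin ws -> rmem s' a j = rmem s a j.

Lemma cevR a i e s b j : rmem (cev (CR a i e) s) b j =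
  if (b == a) && (j == neval s i) then reval s e else rmem s b j.
Proof. by []. Qed.

Definition row s (ok di sx sa : nat) (k : nat) (o : option (\bar R * seq (V * V))) (v : V) :=
  if o is Some (d, ls) then
    [/\ nmem s ok v = 1, rmem s di v = d, nmem s sx v = (nth (ord0, ord0) ls k).1 &
        nmem s sa v = (nth (ord0, ord0) ls k).2]
  else nmem s ok v = 0.

Definition rep s ok di sx sa k (T : table R n) := forall v, row s ok di sx sa k (T v) v.

Lemma row_copy s s' ok di sx sa ok' di' sx' sa' k o (v : V) :
  nmem s' ok' v = nmem s ok v -> rmem s' di' v = rmem s di v -> nmem s' sx' v = nmem s sx v ->
  nmem s' sa' v = nmem s sa v -> row s ok di sx sa k o v -> row s' ok' di' sx' sa' k o v.
Proof. by rewrite /row => e1 e2 e3 e4; case: o => [[d ls]|]; rewrite ?e1 ?e2 ?e3 ?e4. Qed.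

Lemma rep_unchanged ws rws s s' ok di sx sa k T :
  all (fun a => a \notin ws) [:: ok; sx; sa] -> di \notin rws ->
  unchanged ws s s' -> runchanged rws s s' ->
  rep s ok di sx sa k T -> rep s' ok di sx sa k T.
Proof.
by move=> /and4P [h1 h2 h3 _] h4 hn hr r v; apply: row_copy (r v); rewrite ?hn ?hr.
Qed.

Definition relax_ctx M FM h k cur s :=
  [/\ ctx M s, forall i j, nmem s 6 (pos i j) = FM i j,
      forall i j, rmem s 0 (pos i j) = cm i j,
      rep s 12 1 14 15 k cur &
      nmem s 32 0 = h /\ neval s (digit 9) = k].

Lemma relax_ctx_unchanged ws rws M FM h k cur s s' :
  all (fun a => a \notin ws) [:: 0; 4; 5; 6; 12; 14; 15; 18; 32; 39] ->
  all (fun a => a \notin rws) [:: 0; 1] -> unchanged ws s s' -> runchanged rws s s' ->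
  relax_ctx M FM h k cur s -> relax_ctx M FM h k cur s'.
Proof.
move=> /allP wn /allP wr hn hr [h1 h2 h3 h4 [h5 h6]]; split.
- by apply: ctx_unchanged hn h1; rewrite /= !wn.
- by move=> i j; rewrite hn // wn.
- by move=> i j; rewrite hr // wr.
- by apply: rep_unchanged hn hr h4; rewrite /= ?wr // !wn.
- split; first by rewrite hn // wn.
  rewrite -h6; apply: neval_agree => a j.
  by rewrite !inE => /orP [/eqP ->|/eqP ->]; rewrite hn // wn.
Qed.

Lemma UPDATE_spec M FM h k cur s acc (u x a : V) d0 ls0 : relax_ctx M FM h k cur s ->
  nmem s 27 0 = u -> nmem s 25 0 = x -> nmem s 26 0 = a ->
  cur u = Some (d0, ls0) -> size ls0 = h -> x != a -> ~~ FM x a ->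
  (forall v : V, nmem s 8 v = covm M u v x a) ->
  rep s 13 2 16 17 k acc ->
  rep (cev (forV 31 UPDATE) s) 13 2 16 17 k (relax1 cm M FM cur acc u x a).
Proof.
move=> cs hu hx ha cu sz xa fx h8 ra.
pose new v := relax1 cm M FM cur acc u x a v.
apply: (forV_inv (n := n) (I := fun l s' => forall v : V,
     row s' 13 2 16 17 k (if v < l then new v else acc v) v)
   (Q := fun s' => rep s' 13 2 16 17 k (relax1 cm M FM cur acc u x a))).
- by case: cs => -[c0 _ _].
- by move=> v; apply: ra.
- move=> l s' hn hr I v; set s2 := setn 31 l s'.
  have u2 : unchanged [:: 31; 13; 16; 17] s s2.
    move=> b j hb; rewrite setnE; last by move: hb; rewrite inE negb_or => /andP [].
    by apply: hn; apply: (notin_sub hb).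
  have r2 : runchanged [:: 2] s s2 by move=> b j hb; apply: hr.
  have [[_ h4 _] h6 h0 hc [h32 h9]] : relax_ctx M FM h k cur s2.
    exact: relax_ctx_unchanged u2 r2 cs.
  have e31 : nmem s2 31 0 = l by apply: setn_eq.
  have e25 : nmem s2 25 0 = x by rewrite u2.
  have e26 : nmem s2 26 0 = a by rewrite u2.
  have e27 : nmem s2 27 0 = u by rewrite u2.
  have := hc u; rewrite /row cu => -[_ g1 g2 g3].
  have enew : reval s2 new_cost = (d0 + cm x a)%E.
    rewrite -[LHS]/(rmem s2 1 (nmem s2 27 0) + rmem s2 0 (nmem s2 4 (nmem s2 25 0) + nmem s2 26 0))%E.
    by rewrite e25 e26 e27 g1 h4 -/(pos x a) h0.
  have I2 : row s2 13 2 16 17 k (acc l) l by have := I l; rewrite ltnn.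
  pose tt := covm M u l x a && (if acc l is Some (d', _) then ~~ (d' <= d0 + cm x a)%E else true).
  have test : beval s2 (BAnd (NLe (NLit 1) (NGet 8 (reg 31)))
        (bor (NLe (NGet 13 (reg 31)) (NLit 0)) (BNot (RLe (RGet 2 (reg 31)) new_cost)))) =
      tt.
    rewrite -[LHS]/((0 < nmem s2 8 (nmem s2 31 0)) && ~~ (~~ (nmem s2 13 (nmem s2 31 0) <= 0) &&
       ~~ ~~ (rmem s2 2 (nmem s2 31 0) <= reval s2 new_cost)%E)).
    rewrite e31 enew u2 // h8 /tt; case: (covm M u l x a) => //.
    by move: I2; rewrite /row; case: (acc l) => [[d' ls']|]; [move=> [-> -> _ _]|move=> ->] => //=; rewrite negbK.
  have newl : new l = if tt then Some ((d0 + cm x a)%E, rcons ls0 (x, a)) else acc l.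
    by rewrite /new /relax1 cu xa fx /tt.
  have old : v != l -> row s2 13 2 16 17 k (if v < l.+1 then new v else acc v) v.
    by move=> vl; rewrite ltnS leq_eqVlt val_eqE (negbTE vl) /=; exact: I.
  rewrite /UPDATE cevIf test; case t: tt; last first.
    rewrite cev_skip; have [->|vl] := eqVneq v l; last exact: old.
    by rewrite ltnSn newl t.
  rewrite 3!cev_cons cev_nil; set s3 := cev (CN 13 _ _) s2; set s4 := cev (CR 2 _ _) s3.
  have enew3 : reval s3 new_cost = (d0 + cm x a)%E by [].
  have n4 b j : nmem s4 b j = if (b == 13) && (j == l) then 1 else nmem s2 b j.
    by rewrite -[LHS]/(nmem s3 b j) cevN -[neval s2 (reg 31)]/(nmem s2 31 0) e31.
  have r4 b j : rmem s4 b j = if (b == 2) && (j == l) then (d0 + cm x a)%E else rmem s2 b j.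
    by rewrite cevR enew3 -[neval s3 (reg 31)]/(nmem s2 31 0) e31.
  have test4 : beval s4 (beq (reg 32) (digit 9)) = (h == k).
    rewrite eqn_leq -h32 -h9.
    by rewrite -[LHS]/((nmem s4 32 0 <= nmem s4 18 (nmem s4 39 0 + 9)) &&
        (nmem s4 18 (nmem s4 39 0 + 9) <= nmem s4 32 0)) !n4.
  set s5 := cev (CIf _ _ _) s4.
  have r5 b j : rmem s5 b j = rmem s4 b j by apply: rframe.
  have sel5 : [/\ nmem s5 16 l = (nth (ord0, ord0) (rcons ls0 (x, a)) k).1,
      nmem s5 17 l = (nth (ord0, ord0) (rcons ls0 (x, a)) k).2 &
      forall b j : nat, (b \notin [:: 16; 17]) || (j != l :> nat) -> nmem s5 b j = nmem s4 b j].
    rewrite /s5 cevIf test4 nth_rcons sz; case: ifP => hk.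
      have -> : (k < h) = false by rewrite (eqP hk) ltnn.
      rewrite eq_sym hk 2!cev_cons cev_nil.
      have f (b j : nat) : nmem (cev (CN 17 (reg 31) (reg 26)) (cev (CN 16 (reg 31) (reg 25)) s4)) b j =
          if (b == 17) && (j == l) then a : nat else if (b == 16) && (j == l) then x : nat else nmem s4 b j.
        rewrite cevN -[neval _ (reg 26)]/(nmem s2 26 0) -[neval _ (reg 31)]/(nmem s2 31 0) e31 e26.
        by rewrite cevN -[neval _ (reg 25)]/(nmem s2 25 0) -[neval _ (reg 31)]/(nmem s2 31 0) e31 e25.
      split; rewrite ?f ?eqxx // => b j; rewrite f !inE negb_or.
      by case/orP => [/andP [/negbTE h1 /negbTE h2]|/negbTE h1]; rewrite ?h1 ?h2 ?andbF.
    (* The case [k == h] is excluded here, and past the end both lists give the default link. *)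
    have -> : (if k < h then nth (ord0, ord0) ls0 k else if k == h then (x, a) else (ord0, ord0)) =
        nth (ord0, ord0) ls0 k.
      rewrite eq_sym hk; case: ltnP => // hk'; by rewrite nth_default // sz.
    rewrite 2!cev_cons cev_nil.
    have f (b j : nat) : nmem (cev (CN 17 (reg 31) (NGet 15 (reg 27))) (cev (CN 16 (reg 31) (NGet 14 (reg 27))) s4)) b j =
          if (b == 17) && (j == l) then nmem s2 15 u else if (b == 16) && (j == l) then nmem s2 14 u else nmem s4 b j.
      rewrite cevN -[neval _ (NGet 15 _)]/(nmem s2 15 (nmem s2 27 0)) -[neval _ (reg 31)]/(nmem s2 31 0) e31 e27.
      by rewrite cevN -[neval _ (NGet 14 _)]/(nmem s2 14 (nmem s2 27 0)) -[neval _ (reg 31)]/(nmem s2 31 0) e31 e27.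
    split; rewrite ?f ?eqxx // => b j; rewrite f !inE negb_or.
    by case/orP => [/andP [/negbTE h1 /negbTE h2]|/negbTE h1]; rewrite ?h1 ?h2 ?andbF.
  have [sel1 sel2 sel3] := sel5.
  have [->|vl] := eqVneq v l.
    rewrite ltnSn newl t; split=> //.
    + by rewrite sel3 // n4 !eqxx.
    + by rewrite r5 r4 !eqxx.
  have vl' : (nat_of_ord v == l) = false by apply: negbTE.
  apply: row_copy (old vl).
  + by rewrite sel3 ?vl' ?orbT // n4 vl' andbF.
  + by rewrite r5 r4 vl' andbF.
  + by rewrite sel3 ?vl' ?orbT // n4 vl' andbF.
  + by rewrite sel3 ?vl' ?orbT // n4 vl' andbF.
- move=> s' _ _ I v; have := I v; rewrite ltn_ord; apply: row_copy; by rewrite ?setnE.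
Qed.

Lemma rep_ext s ok di sx sa k T T' : T =1 T' -> rep s ok di sx sa k T -> rep s ok di sx sa k T'.
Proof. by move=> e r v; rewrite -e. Qed.

(** All chains of a layer have the same length, so register 32 is the position of the link appended
    next. *)
Definition sized (h : nat) (cur : table R n) := forall u d ls, cur u = Some (d, ls) -> size ls = h.

Lemma RELAX_BODY_spec M FM h k cur s acc (u x a : V) : relax_ctx M FM h k cur s ->
  sized h cur -> nmem s 27 0 = u -> nmem s 25 0 = x -> nmem s 26 0 = a ->
  rep s 13 2 16 17 k acc ->
  rep (cev RELAX_BODY s) 13 2 16 17 k (relax1 cm M FM cur acc u x a).
Proof.
move=> cs sz hu hx ha ra; rewrite /RELAX_BODY cevIf.
have [[_ h4 _] h6 _ hc _] := cs.
have -> : beval s (BAnd (NLe (NLit 1) (NGet 12 (reg 27)))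
        (BAnd (BNot (beq (reg 25) (reg 26))) (NLe (entry 6 (reg 25) (reg 26)) (NLit 0)))) =
    [&& cur u : bool, x != a & ~~ FM x a].
  rewrite -[LHS]/[&& 0 < nmem s 12 (nmem s 27 0), ~~ ((nmem s 25 0 <= nmem s 26 0) && (nmem s 26 0 <= nmem s 25 0)) &
     nmem s 6 (nmem s 4 (nmem s 25 0) + nmem s 26 0) <= 0].
  rewrite hu hx ha h4 -/(pos x a) h6 -eqn_leq -val_eqE.
  have := hc u; rewrite /row; case: (cur u) => [[d ls] [-> _ _ _]|->] //=.
  by case: (FM x a).
case: ifP => [/and3P [cu xa fx]|ncu]; last first.
  apply: rep_ext ra => v; rewrite /relax1; case: (cur u) ncu => [[d ls]|//] /=.
  by case: (x != a) => //=; case: (FM x a).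
case cuE: (cur u) cu => [[d0 ls0]|//] _.
rewrite cev_seq; set s1 := cev COVER s.
have u1 : unchanged (nwrites COVER) s s1 by apply: unchanged_cev.
have r1 : runchanged [::] s s1 by move=> b j hb; apply: rframe.
have szl := sz _ _ _ cuE; apply: (UPDATE_spec (h := h) _ _ _ _ cuE szl xa fx).
- exact: relax_ctx_unchanged u1 r1 cs.
- by rewrite u1.
- by rewrite u1.
- by rewrite u1.
- by have [c0 _ _ _ _] := cs; exact: COVER_spec c0 hx ha hu.
- exact: rep_unchanged u1 r1 ra.
Qed.

Lemma RELAX_LOOPS_spec M FM h k cur s : relax_ctx M FM h k cur s -> sized h cur ->
  rep s 13 2 16 17 k (fun=> None) ->
  rep (cev (forV 27 (forV 25 (forV 26 RELAX_BODY))) s) 13 2 16 17 k (relax cm M FM cur).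
Proof.
move=> cs sz r0.
pose Rel s' acc := rep s' 13 2 16 17 k acc.
have stable v j s' acc : v \notin [:: 13; 16; 17] -> Rel s' acc -> Rel (setn v j s') acc.
  rewrite !inE !negb_or => /and3P [h1 h2 h3] r w; apply: row_copy (r w) => //;
    by rewrite setnE // eq_sym.
have n0 s' : relax_ctx M FM h k cur s' -> nmem s' 0 0 = n.+1 by case=> -[].
have keep v P s1 s2 j : all (fun a => a \notin v :: nwrites P) [:: 0; 4; 5; 6; 12; 14; 15; 18; 32; 39] ->
    all (fun a => a \notin rwrites P) [:: 0; 1] ->
    unchanged (v :: nwrites P) s1 s2 -> runchanged (rwrites P) s1 s2 ->
    relax_ctx M FM h k cur s1 -> relax_ctx M FM h k cur (setn v j s2).
  move=> w1 w2 h1 h2 c1.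
  have u : unchanged (v :: nwrites P) s1 (setn v j s2).
    move=> b l hb; rewrite setnE ?h1 //; first by move: hb; rewrite inE negb_or => /andP [].
  exact: (relax_ctx_unchanged w1 w2 u h2 c1).
have L26 s1 acc (u x : V) : relax_ctx M FM h k cur s1 -> nmem s1 27 0 = u -> nmem s1 25 0 = x ->
    Rel s1 acc -> Rel (cev (forV 26 RELAX_BODY) s1)
      (foldl (fun acc a => relax1 cm M FM cur acc u x a) acc (enum V)).
  move=> c1 hu hx r1; apply: (forV_fold (n := n) (Rel := Rel)) => //; first exact: n0.
  move=> a s2 acc2 hn hr r2.
  apply: RELAX_BODY_spec sz _ _ _ _; first exact: keep hn hr c1.
  - by rewrite setnE // hn.
  - by rewrite setnE // hn.
  - by rewrite setn_eq.
  - exact: stable r2.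
have L25 s1 acc (u : V) : relax_ctx M FM h k cur s1 -> nmem s1 27 0 = u ->
    Rel s1 acc -> Rel (cev (forV 25 (forV 26 RELAX_BODY)) s1)
      (foldl (fun acc x => foldl (fun acc a => relax1 cm M FM cur acc u x a) acc (enum V)) acc (enum V)).
  move=> c1 hu r1; apply: (forV_fold (n := n) (Rel := Rel)) => //; first exact: n0.
  move=> x s2 acc2 hn hr r2.
  apply: L26; first exact: keep hn hr c1.
  - by rewrite setnE // hn.
  - by rewrite setn_eq.
  - exact: stable r2.
apply: (forV_fold (n := n) (Rel := Rel)) => //; first exact: n0.
  move=> u s2 acc2 hn hr r2.
  apply: L25; first exact: keep hn hr cs.
  - by rewrite setn_eq.
  - exact: stable r2.
Qed.

Lemma COPY_spec s k T : nmem s 0 0 = n.+1 -> rep s 13 2 16 17 k T -> rep (cev COPY s) 12 1 14 15 k T.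
Proof.
move=> n0 r.
apply: (forV_inv (n := n) (I := fun l s' => forall v : V, v < l -> row s' 12 1 14 15 k (T v) v)
  (Q := fun s' => rep s' 12 1 14 15 k T)) => //.
- move=> l s' hn hr I v; set s2 := setn 31 l s'.
  have e31 : nmem s2 31 0 = l by apply: setn_eq.
  rewrite 4!cev_cons cev_nil; set s3 := cev (CN 15 _ _) _.
  have f (b j : nat) : nmem s3 b j =
      if (b == 15) && (j == l) then nmem s2 17 l else if (b == 14) && (j == l) then nmem s2 16 l
      else if (b == 12) && (j == l) then nmem s2 13 l else nmem s2 b j.
    rewrite cevN -[neval _ (reg 31)]/(nmem s2 31 0) -[neval _ (NGet 17 _)]/(nmem s2 17 (nmem s2 31 0)) e31.
    rewrite cevN -[neval _ (reg 31)]/(nmem s2 31 0) -[neval _ (NGet 16 _)]/(nmem s2 16 (nmem s2 31 0)) e31.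
    rewrite -[nmem (cev (CR _ _ _) _) b j]/(nmem (cev (CN 12 (reg 31) (NGet 13 (reg 31))) s2) b j).
    by rewrite cevN -[neval _ (reg 31)]/(nmem s2 31 0) -[neval _ (NGet 13 _)]/(nmem s2 13 (nmem s2 31 0)) e31.
  have g (b j : nat) : rmem s3 b j = if (b == 1) && (j == l) then rmem s2 2 l else rmem s2 b j.
    rewrite -[LHS]/(if (b == 1) && (j == nmem s2 31 0) then rmem s2 2 (nmem s2 31 0) else rmem s2 b j).
    by rewrite e31.
  have old b : b \in [:: 13; 16; 17] -> nmem s2 b l = nmem s b l.
    by rewrite !inE => /or3P [] /eqP ->; apply: hn.
  rewrite ltnS leq_eqVlt => /orP [/eqP vl|vl].
    have -> : v = l by apply: val_inj.
    apply: row_copy (r l).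
    + by rewrite f eqxx -(old 13).
    + by rewrite g !eqxx; apply: hr.
    + by rewrite f eqxx -(old 16).
    + by rewrite f !eqxx -(old 17).
  have vl' : (nat_of_ord v == l) = false by rewrite ltn_eqF.
  by apply: row_copy (I v vl); rewrite ?f ?g vl' ?andbF.
- move=> s' _ _ I v; have := I v (ltn_ord v); apply: row_copy; by rewrite ?setnE.
Qed.

Lemma relax_sized h M FM cur : sized h cur -> sized h.+1 (relax cm M FM cur).
Proof.
move=> sz v d ls /relax_sound [u [d0 [ls0 [x [a [[cu _ _ _] [_ ->]]]]]]].
by rewrite size_rcons (sz _ _ _ cu).
Qed.

Lemma iter_sized M FM S h : sized h (iter h (relax cm M FM) (start R S)).
Proof.
elim: h => [|h IH] /=; last exact: relax_sized.
by move=> u d ls; rewrite /start; case: ifP => // _ [_ <-].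
Qed.

Lemma RELAX_spec M FM h k cur s : relax_ctx M FM h k cur s -> sized h cur ->
  rep (cev RELAX s) 12 1 14 15 k (relax cm M FM cur).
Proof.
move=> cs sz; rewrite /RELAX 3!cev_cons cev_nil.
set s1 := cev (forV 31 _) s.
have u1 : unchanged [:: 31; 13] s s1 by move=> b j hb; rewrite nframe.
have r1 : runchanged [::] s s1 by move=> b j hb; apply: rframe.
have c1 : relax_ctx M FM h k cur s1 by apply: relax_ctx_unchanged u1 r1 cs.
have z1 : forall v : V, nmem s1 13 v = 0.
  by apply: (fill_spec (f := fun=> 0)) => //; case: cs => -[].
apply: COPY_spec; last exact: RELAX_LOOPS_spec c1 sz _.
by rewrite nframe //; case: c1 => -[].
Qed.

Definition chain_ctx M FM (S' : pred V) w k s :=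
  [/\ ctx M s, forall i j, nmem s 6 (pos i j) = FM i j,
      forall i j, rmem s 0 (pos i j) = cm i j,
      forall v : V, nmem s 11 v = S' v & neval s (digit 8) = w /\ neval s (digit 9) = k].

Lemma chain_ctx_unchanged ws rws M FM S' w k s s' :
  all (fun a => a \notin ws) [:: 0; 4; 5; 6; 11; 18; 39] ->
  all (fun a => a \notin rws) [:: 0] -> unchanged ws s s' -> runchanged rws s s' ->
  chain_ctx M FM S' w k s -> chain_ctx M FM S' w k s'.
Proof.
move=> /allP wn /allP wr hn hr [h1 h2 h3 h4 [h5 h6]]; split.
- by apply: ctx_unchanged hn h1; rewrite /= !wn.
- by move=> i j; rewrite hn // wn.
- by move=> i j; rewrite hr // wr.
- by move=> v; rewrite hn // wn.
- by split; [rewrite -h5|rewrite -h6]; apply: neval_agree => a j;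
    rewrite !inE => /orP [/eqP ->|/eqP ->]; rewrite hn // wn.
Qed.

Lemma INIT_spec s k (S : pred V) : nmem s 0 0 = n.+1 -> (forall v : V, nmem s 10 v = S v) ->
  rep (cev INIT s) 12 1 14 15 k (start R S).
Proof.
move=> n0 h10.
apply: (forV_inv (n := n) (I := fun l s' => forall v : V, v < l -> row s' 12 1 14 15 k (start R S v) v)
  (Q := fun s' => rep s' 12 1 14 15 k (start R S))) => //.
- move=> l s' hn hr I v; set s2 := setn 31 l s'.
  have e31 : nmem s2 31 0 = l by apply: setn_eq.
  rewrite 4!cev_cons cev_nil; set s3 := cev (CN 15 _ _) _.
  have f (b j : nat) : nmem s3 b j =
      if (b == 15) && (j == l) then 0 else if (b == 14) && (j == l) then 0
      else if (b == 12) && (j == l) then nmem s2 10 l else nmem s2 b j.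
    rewrite cevN -[neval _ (reg 31)]/(nmem s2 31 0) e31.
    rewrite cevN -[neval _ (reg 31)]/(nmem s2 31 0) e31.
    rewrite -[nmem (cev (CR _ _ _) _) b j]/(nmem (cev (CN 12 (reg 31) (NGet 10 (reg 31))) s2) b j).
    by rewrite cevN -[neval _ (reg 31)]/(nmem s2 31 0) -[neval _ (NGet 10 _)]/(nmem s2 10 (nmem s2 31 0)) e31.
  have g (b j : nat) : rmem s3 b j = if (b == 1) && (j == l) then 0%E else rmem s2 b j.
    rewrite -[LHS]/(if (b == 1) && (j == nmem s2 31 0) then 0%E else rmem s2 b j).
    by rewrite e31.
  rewrite ltnS leq_eqVlt => /orP [/eqP vl|vl].
    have -> : v = l by apply: val_inj.
    have e10 : nmem s2 10 l = S l by rewrite -h10; apply: hn.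
    rewrite /row /start; case: (S l) e10 => e10; last by rewrite f eqxx; exact: e10.
    split.
    + by rewrite f eqxx; exact: e10.
    + by rewrite g !eqxx.
    + by rewrite f eqxx nth_nil.
    + by rewrite f !eqxx nth_nil.
  have vl' : (nat_of_ord v == l) = false by rewrite ltn_eqF.
  by apply: row_copy (I v vl); rewrite ?f ?g vl' ?andbF.
- move=> s' _ _ I v; have := I v (ltn_ord v); apply: row_copy; by rewrite ?setnE.
Qed.

Lemma CHAINS_spec p M FM S S' w k s : nmem s 0 1 = p -> chain_ctx M FM S' w k s ->
  rep s 12 1 14 15 k (start R S) ->
  rep (cev CHAINS s) 12 1 14 15 k (iter (minn p w) (relax cm M FM) (start R S)).
Proof.
move=> hp cs r0.
apply: (for_inv (I := fun h s' => rep s' 12 1 14 15 k (iter (minn h w) (relax cm M FM) (start R S)))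
  (Q := fun s' => rep s' 12 1 14 15 k (iter (minn p w) (relax cm M FM) (start R S)))).
- by rewrite min0n.
- move=> h s' hp' hn hr r; set s2 := setn 32 h s'.
  have u2 : unchanged [:: 32; 31; 13; 27; 25; 26; 20; 8; 23; 24; 22; 21; 7; 16; 17; 12; 14; 15] s s2.
    move=> b j hb; rewrite setnE; last by move: hb; rewrite inE negb_or => /andP [].
    by apply: hn; apply: (notin_sub hb).
  have r2 : runchanged [:: 1; 2] s s2 by move=> b j hb; apply: hr; apply: (notin_sub hb).
  have c2 : chain_ctx M FM S' w k s2 by apply: chain_ctx_unchanged u2 r2 cs.
  have [x1 x2 x3 x4 [x5 x6]] := c2.
  have e32 : nmem s2 32 0 = h by apply: setn_eq.
  have rr : rep s2 12 1 14 15 k (iter (minn h w) (relax cm M FM) (start R S)).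
    by move=> v; apply: row_copy (r v); rewrite ?setnE.
  rewrite cevIf.
  have -> : beval s2 (NLe (NAdd (reg 32) (NLit 1)) (digit 8)) = (h < w).
    by rewrite -[LHS]/(nmem s2 32 0 + 1 <= neval s2 (digit 8)) e32 x5 addn1.
  case: ltnP => hw.
    rewrite (minn_idPl hw) /=; rewrite (minn_idPl (ltnW hw)) in rr.
    by apply: (RELAX_spec (h := h)); [split|exact: iter_sized].
  by rewrite cev_skip; rewrite (minn_idPr hw) in rr; rewrite (minn_idPr (leqW hw)).
- move=> s' _ _; rewrite -[neval s _]/(nmem s 0 1) hp => r v.
  by apply: row_copy (r v); rewrite ?setnE.
Qed.

Lemma BEST_spec M FM S' w k cur s : chain_ctx M FM S' w k s -> rep s 12 1 14 15 k cur ->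
  let o := if foldl (better S' cur) None (enum V) is Some (_, ls)
           then nth (ord0, ord0) ls k else (ord0, ord0) in
  nmem (cev BEST s) 34 0 = o.1 /\ nmem (cev BEST s) 35 0 = o.2.
Proof.
move=> cs r0; rewrite /BEST 4!cev_cons cev_nil; set s1 := cev (set_reg 35 _) _.
have u1 : unchanged [:: 33; 34; 35] s s1.
  by move=> b j; rewrite !inE !negb_or => /and3P [h1 h2 h3]; rewrite !cev_set_neq.
have r1 : runchanged [::] s s1 by [].
have c1 : chain_ctx M FM S' w k s1 by apply: chain_ctx_unchanged u1 r1 cs.
have p1 : rep s1 12 1 14 15 k cur by apply: rep_unchanged u1 r1 r0.
pose Rel s' (o : option (\bar R * seq (V * V))) := if o is Some (d, ls) then
   [/\ nmem s' 33 0 = 1, rmem s' 4 0 = d, nmem s' 34 0 = (nth (ord0, ord0) ls k).1 &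
       nmem s' 35 0 = (nth (ord0, ord0) ls k).2]
   else [/\ nmem s' 33 0 = 0, nmem s' 34 0 = 0 & nmem s' 35 0 = 0].
suff : forall body, body = forV 31 (CIf
        (BAnd (NLe (NLit 1) (NGet 12 (reg 31))) (BAnd (NLe (NLit 1) (NGet 11 (reg 31)))
           (bor (NLe (reg 33) (NLit 0)) (BNot (RLe (RGet 4 (NLit 0)) (RGet 1 (reg 31)))))))
        (seqs [:: set_reg 33 (NLit 1); CR 4 (NLit 0) (RGet 1 (reg 31));
                  set_reg 34 (NGet 14 (reg 31)); set_reg 35 (NGet 15 (reg 31))])
        CSkip) -> Rel (cev body s1) (foldl (better S' cur) None (enum V)).
  move=> /(_ _ erefl); rewrite /Rel; case: (foldl _ _ _) => [[d ls]|] [] //.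
move=> _ ->; apply: (forV_fold (n := n) (Rel := Rel)).
- by case: c1 => -[].
- by split.
- move=> v s' o hn hr q; set s2 := setn 31 v s'.
  have u2 : unchanged [:: 31; 33; 34; 35] s1 s2.
    move=> b j hb; rewrite setnE; last by move: hb; rewrite inE negb_or => /andP [].
    by apply: hn; apply: (notin_sub hb).
  have r2 : runchanged [:: 4] s1 s2 by move=> b j hb; apply: hr.
  have [_ _ _ h11 _] : chain_ctx M FM S' w k s2 by apply: chain_ctx_unchanged u2 r2 c1.
  have p2 : rep s2 12 1 14 15 k cur by apply: rep_unchanged u2 r2 p1.
  have e31 : nmem s2 31 0 = v by apply: setn_eq.
  have q2 : Rel s2 o.
    by move: q; rewrite /Rel; case: o => [[d ls]|] //.
  have test : beval s2 (BAnd (NLe (NLit 1) (NGet 12 (reg 31))) (BAnd (NLe (NLit 1) (NGet 11 (reg 31)))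
           (bor (NLe (reg 33) (NLit 0)) (BNot (RLe (RGet 4 (NLit 0)) (RGet 1 (reg 31))))))) =
     if cur v is Some (d, ls) then
       S' v && (if o is Some (d', _) then ~~ (d' <= d)%E else true) else false.
    rewrite -[LHS]/[&& 0 < nmem s2 12 (nmem s2 31 0), 0 < nmem s2 11 (nmem s2 31 0) &
       ~~ (~~ (nmem s2 33 0 <= 0) && ~~ ~~ (rmem s2 4 0 <= rmem s2 1 (nmem s2 31 0))%E)].
    rewrite e31 h11; have := p2 v; rewrite /row.
    case: (cur v) => [[d ls] [-> -> _ _]|-> //]; case: (S' v); last by rewrite andbF.
    rewrite negb_and !negbK; move: q2; rewrite /Rel.
    by case: o {q} => [[d' ls'] [-> -> _ _]|[-> _ _]].
  rewrite cevIf test /better; have := p2 v; rewrite /row.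
  case: (cur v) => [[d ls] [g1 g2 g3 g4]|_]; last exact: q.
  case: ifP => _; last exact: q.
  rewrite 4!cev_cons cev_nil /Rel; split=> //.
- by move=> s' o; rewrite /Rel; case: o => [[d ls]|].
Qed.

End Chains.

(** * Committing one link *)

Definition cell i j := NAdd (NGet 4 i) j.

Definition COMMIT :=
  CIf (BAnd (BNot (beq (reg 34) (reg 35))) (NLe (entry 6 (reg 34) (reg 35)) (NLit 0)))
    (seqs [:: CN 6 (cell (reg 34) (reg 35)) (NLit 1); CN 6 (cell (reg 35) (reg 34)) (NLit 1);
      CN 5 (cell (reg 34) (reg 35)) (NAdd (entry 5 (reg 34) (reg 35)) (NLit 1));
      CN 5 (cell (reg 35) (reg 34)) (NAdd (entry 5 (reg 35) (reg 34)) (NLit 1));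
      CR 3 (NLit 0) (RAdd (link_cost (reg 34) (reg 35)) (RGet 3 (NLit 0)))])
    CSkip.

Definition STEP := seqs [:: LEAVES; TOKEN 10 0; TOKEN 11 4; INIT; CHAINS; BEST; COMMIT].

Section Steps.
Variables (R : realType) (n : nat).
Notation V := 'I_n.+1.
Implicit Types (s : state R) (M : V -> V -> nat).
Variable cs : {set V} -> \bar R.
Let cm (x a : V) := cs [set x; a].

Lemma pos_eq (i j k l : V) : (pos i j == pos k l) = (i == k) && (j == l).
Proof.
apply/eqP/andP => [|[/eqP -> /eqP ->] //]; rewrite /pos => h.
have jl : val j = val l.
  have := congr1 (fun x => x %% n.+1) h.
  by rewrite !modnMDl !modn_small.
have ik : val i = val k.
  have := congr1 (fun x => x %/ n.+1) h.
  by rewrite !divnMDl // !divn_small // !addn0.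
by rewrite -!val_eqE ik jl !eqxx.
Qed.

(* The state represents the set [F] of committed links. *)
Definition holds M0 p (F : {set {set V}}) s :=
  [/\ ctx (multF M0 F) s, nmem s 0 1 = p, forall i j, nmem s 6 (pos i j) = inF F i j,
      forall i j, rmem s 0 (pos i j) = cm i j & rmem s 3 0 = ctot cs F].

Lemma holds_unchanged ws rws M0 p F s s' :
  all (fun a => a \notin ws) [:: 0; 4; 5; 6] -> all (fun a => a \notin rws) [:: 0; 3] ->
  unchanged ws s s' -> runchanged rws s s' -> holds M0 p F s -> holds M0 p F s'.
Proof.
move=> /allP wn /allP wr hn hr [h1 h2 h3 h4 h5]; split.
- by apply: ctx_unchanged hn h1; rewrite /= !wn.
- by rewrite hn // wn.
- by move=> i j; rewrite hn // wn.
- by move=> i j; rewrite hr // wr.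
- by rewrite hr // wr.
Qed.

Lemma holds_cev M0 p F P s :
  all (fun a => a \notin nwrites P) [:: 0; 4; 5; 6] ->
  all (fun a => a \notin rwrites P) [:: 0; 3] -> holds M0 p F s -> holds M0 p F (cev P s).
Proof.
move=> w1 w2; apply: (holds_unchanged w1 w2); first exact: unchanged_cev.
by move=> a j; exact: rframe.
Qed.

Lemma digits_cev P s d : (18 \notin nwrites P) && (39 \notin nwrites P) ->
  digits s d -> digits (cev P s) d.
Proof. by move=> w; apply: digits_unchanged w _; exact: unchanged_cev. Qed.

Lemma COMMIT_spec M0 p F s (x a : V) : holds M0 p F s -> nmem s 34 0 = x -> nmem s 35 0 = a ->
  holds M0 p (if (x != a) && ~~ inF F x a then [set x; a] |: F else F) (cev COMMIT s).
Proof.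
move=> hs hx ha; have [[h0 h4 h5] hp h6 hc h3] := hs.
rewrite /COMMIT cevIf.
have -> : beval s (BAnd (BNot (beq (reg 34) (reg 35))) (NLe (entry 6 (reg 34) (reg 35)) (NLit 0))) =
    (x != a) && ~~ inF F x a.
  rewrite -[LHS]/(~~ ((nmem s 34 0 <= nmem s 35 0) && (nmem s 35 0 <= nmem s 34 0)) &&
     (nmem s 6 (nmem s 4 (nmem s 34 0) + nmem s 35 0) <= 0)).
  by rewrite hx ha h4 -/(pos x a) h6 -eqn_leq -val_eqE; case: (inF F x a).
case: ifP => [/andP [xa nF]|_]; last exact: hs.
rewrite 5!cev_cons cev_nil; set s5 := cev (CR _ _ _) _.
have f (b j : nat) : nmem s5 b j =
   if (b == 5) && (j == pos a x) then nmem s 5 (pos a x) + 1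
   else if (b == 5) && (j == pos x a) then nmem s 5 (pos x a) + 1
   else if (b == 6) && ((j == pos a x) || (j == pos x a)) then 1 else nmem s b j.
  rewrite -[LHS]/(if (b == 5) && (j == nmem s 4 (nmem s 35 0) + nmem s 34 0)
    then (if (nmem s 4 (nmem s 35 0) + nmem s 34 0) == (nmem s 4 (nmem s 34 0) + nmem s 35 0)
       then nmem s 5 (nmem s 4 (nmem s 34 0) + nmem s 35 0) + 1
       else nmem s 5 (nmem s 4 (nmem s 35 0) + nmem s 34 0)) + 1
    else if (b == 5) && (j == nmem s 4 (nmem s 34 0) + nmem s 35 0)
      then nmem s 5 (nmem s 4 (nmem s 34 0) + nmem s 35 0) + 1
    else if (b == 6) && (j == nmem s 4 (nmem s 35 0) + nmem s 34 0) then 1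
    else if (b == 6) && (j == nmem s 4 (nmem s 34 0) + nmem s 35 0) then 1 else nmem s b j).
  rewrite hx ha !h4 -/(pos x a) -/(pos a x).
  rewrite [pos a x == pos x a]pos_eq [a == x]eq_sym (negbTE xa).
  by case: (b == 5); case: (b == 6); case: (j == pos a x); case: (j == pos x a).
have sw (i j : V) : ([set i; j] == [set x; a]) = ((i == a) && (j == x)) || ((i == x) && (j == a)).
  by rewrite -eqp_mk /eqpair orbC.
split.
- split=> [|i|i j]; rewrite f //; first exact: h4.
  rewrite -[5 == 5]/true -[5 == 6]/false !andTb !pos_eq /multF finset.in_setU1 sw.
  have nF' : [set a; x] \in F = false by apply: negbTE; rewrite finset.setUC.
  case: andP => [[/eqP -> /eqP ->]|_].
    by rewrite h5 /multF nF' /= addn0.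
  case: andP => [[/eqP -> /eqP ->]|_]; last by rewrite h5.
  by rewrite h5 /multF -/(inF F x a) (negbTE nF) /= addn0.
- by rewrite f.
- move=> i j; rewrite f -[6 == 5]/false -[6 == 6]/true !andTb !pos_eq /inF finset.in_setU1 sw.
  by case: ifP => // _; apply: h6.
- exact: hc.
- rewrite /ctot finset.big_setU1 //= -/(ctot cs F) -h3 -/(cm x a).
  rewrite -[LHS]/(rmem s 0 (nmem s 4 (nmem s 34 0) + nmem s 35 0) + rmem s 3 0)%E.
  by rewrite hx ha h4 -/(pos x a) hc.
Qed.

Lemma STEP_spec M0 p F d s : holds M0 p F s -> digits s d ->
  holds M0 p (step cm p M0 d F) (cev STEP s).
Proof.
move=> hs ds; rewrite /STEP.
rewrite cev_cons; set s1 := cev LEAVES s.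
have h1 : holds M0 p F s1 by apply: holds_cev hs.
have d1 : digits s1 d by apply: digits_cev ds.
have l1 : leaf_table (multF M0 F) s1 by apply: LEAVES_spec; case: hs.
rewrite cev_cons; set s2 := cev (TOKEN 10 0) s1.
have h2 : holds M0 p F s2 by apply: holds_cev h1.
have d2 : digits s2 d by apply: digits_cev d1.
have l2 : leaf_table (multF M0 F) s2.
  by apply: leaf_table_unchanged (@unchanged_cev R (TOKEN 10 0) s1) l1.
have c1 : ctx (multF M0 F) s1 by case: h1.
have c2 : ctx (multF M0 F) s2 by case: h2.
have t2 := @TOKEN_spec R n _ s1 10 0 d c1 l1 d1 isT isT.
rewrite cev_cons; set s3 := cev (TOKEN 11 4) s2.
have h3 : holds M0 p F s3 by apply: holds_cev h2.
have d3 : digits s3 d by apply: digits_cev d2.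
have t3 := @TOKEN_spec R n _ s2 11 4 d c2 l2 d2 isT isT.
have t2' : forall v : V, nmem s3 10 v = tokm (multF M0 F) (d 0) (d 1) (d 2) (d 3) v.
  by move=> v; rewrite nframe // t2.
rewrite cev_cons; set s4 := cev INIT s3.
have h4 : holds M0 p F s4 by apply: holds_cev h3.
have d4 : digits s4 d by apply: digits_cev d3.
have n3 : nmem s3 0 0 = n.+1 by case: h3 => -[].
have r4 := @INIT_spec R n s3 (d 9) _ n3 t2'.
set S := tokm _ _ _ _ _ in r4; pose S' := tokm (multF M0 F) (d 4) (d 5) (d 6) (d 7).
have k4 : chain_ctx cm (multF M0 F) (inF F) S' (d 8) (d 9) s4.
  have [x1 x2 x3 x4 x5] := h4; split=> //.
    by move=> v; rewrite nframe // t3.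
  by rewrite !d4.
have p4 : nmem s4 0 1 = p by case: h4.
rewrite cev_cons; set s5 := cev CHAINS s4.
have r5 := CHAINS_spec p4 k4 r4.
have h5 : holds M0 p F s5 by apply: holds_cev h4.
have k5 : chain_ctx cm (multF M0 F) (inF F) S' (d 8) (d 9) s5.
  have r : runchanged (rwrites CHAINS) s4 s5 by move=> a j; exact: rframe.
  by apply: chain_ctx_unchanged (@unchanged_cev R CHAINS s4) r k4.
rewrite cev_cons; set s6 := cev BEST s5.
have h6 : holds M0 p F s6 by apply: holds_cev h5.
have [e34 e35] := BEST_spec k5 r5.
rewrite cev_cons cev_nil.
have := COMMIT_spec h6 e34 e35.
rewrite /step /pick_link /cheapest -/S -/S'.
by case: (foldl _ _ _) => [[dd ls]|] //; case: (nth _ ls _).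
Qed.

End Steps.

(** * Enumeration of the digit sequences *)

Definition ROWS := CSeq (set_reg 40 (NLit 0))
  (forV 31 (CSeq (CN 4 (reg 31) (reg 40)) (incr 40 (NGet 0 (NLit 0))))).

Definition np := NGet 0 (NLit 1).

(** The machine cannot multiply, so the factor [2 * p + 1] is applied by repeated addition. *)
Definition TIMES := seqs
  [:: set_reg 44 (reg 41); CFor 45 np (incr 44 (NAdd (reg 41) (reg 41))); set_reg 41 (reg 44)].

Definition POWER := CSeq (set_reg 41 (NLit 1)) (CFor 42 np (CFor 43 (NLit 10) TIMES)).

Definition FILL a e := forV 48 (forV 49 (CN a (cell (reg 48) (reg 49)) e)).

Definition RESET := seqs
  [:: FILL 5 (entry 1 (reg 48) (reg 49)); FILL 6 (NLit 0); CR 3 (NLit 0) RZero; set_reg 39 (NLit 0)].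

(** Register 39 is the offset of the ten digits read by the current step. *)
Definition STEPS := CFor 47 np (CSeq STEP (incr 39 (NLit 10))).

Definition CHECK := seqs
  [:: set_reg 27 (NLit 0); set_reg 25 (NLit 0); set_reg 26 (NLit 0); COVER;
      set_reg 50 (NLit 1);
      forV 31 (CIf (NLe (NGet 8 (reg 31)) (NLit 0)) (set_reg 50 (NLit 0)) CSkip)].

Definition SAVE :=
  CIf (BAnd (NLe (NLit 1) (reg 50))
        (bor (NLe (reg 2) (NLit 0)) (BNot (RLe (RGet 5 (NLit 0)) (RGet 3 (NLit 0))))))
    (seqs [:: set_reg 2 (NLit 1); CR 5 (NLit 0) (RGet 3 (NLit 0));
       FILL 3 (entry 6 (reg 48) (reg 49))])
    CSkip.

(* Array 18 is an odometer in base 2 p + 1; array 51 holds the current position,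
   array 52 the carry. *)
Definition NEXT_DIGIT :=
  CSeq (CIf (NLe (NLit 1) (reg 52))
         (CIf (NLe (NAdd (NGet 18 (reg 51)) (NLit 1)) (NAdd np np))
            (CSeq (CN 18 (reg 51) (NAdd (NGet 18 (reg 51)) (NLit 1))) (set_reg 52 (NLit 0)))
            (CN 18 (reg 51) (NLit 0)))
         CSkip)
    (incr 51 (NLit 1)).

(** All positions are visited, also after the carry has died out, so that the loop bounds stay
    fixed. *)
Definition NEXT := seqs
  [:: set_reg 51 (NLit 0); set_reg 52 (NLit 1); CFor 53 np (CFor 54 (NLit 10) NEXT_DIGIT)].

Definition ATTEMPT := seqs [:: RESET; STEPS; CHECK; SAVE; NEXT].

Definition SETUP := CSeq ROWS POWER.
Definition SEARCH := CFor 46 (reg 41) ATTEMPT.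

Definition dig b k i := (k %/ b ^ i) %% b.

Lemma dig_surj b (e : nat -> nat) m : (forall i, e i < b) ->
  exists2 k, k < b ^ m & forall i, i < m -> dig b k i = e i.
Proof.
elim: m e => [|m IH] e eb; first by exists 0.
have [k kb hk] := IH (fun i => e i.+1) (fun i => eb i.+1).
have b0 : 0 < b by apply: leq_trans (eb 0).
exists (k * b + e 0).
  rewrite expnS; apply: (@leq_trans (k.+1 * b)); first by rewrite mulSn addnC ltn_add2r.
  by rewrite mulnC leq_mul2l kb orbT.
case=> [|i] im; first by rewrite /dig divn1 modnMDl modn_small.
rewrite /dig expnS divnMA divnMDl // (divn_small (eb 0)) addn0; exact: hk.
Qed.

Lemma dig0 b i : dig b 0 i = 0.
Proof. by rewrite /dig div0n mod0n. Qed.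

(** [b ^ i %| k.+1] says that all digits of [k] below position [i] are maximal, that is, that a
    carry reaches position [i]. *)
Lemma dig_succ b k i : 0 < b ->
  dig b k.+1 i = if b ^ i %| k.+1 then (if (dig b k i).+1 < b then (dig b k i).+1 else 0) else dig b k i.
Proof.
move=> b0; rewrite /dig divnS ?expn_gt0 ?b0 //; case: ifP => _; last by rewrite add0n.
have := ltn_pmod (k %/ b ^ i) b0; rewrite leq_eqVlt add1n modnS dvdn_eq /= => h.
rewrite -dvdn_eq; case: ifP => d.
  suff : (k %/ b ^ i %% b).+1 < b -> False by case: ltnP => // h1 /(_ isT).
  move=> h1; move: d; rewrite {1}(divn_eq (k %/ b ^ i) b) -addnS dvdn_addr ?dvdn_mull //.
  by rewrite gtnNdvd.
case: ltnP => // h1; move: d; case/orP: h => [/eqP h|]; last by rewrite ltnNge h1.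
by rewrite (divn_eq (k %/ b ^ i) b) -addnS dvdn_addr ?dvdn_mull // h dvdnn.
Qed.

Lemma dvd_succ b k i : 0 < b ->
  (b ^ i.+1 %| k.+1) = (b ^ i %| k.+1) && ~~ ((dig b k i).+1 < b).
Proof.
move=> b0; have [h|h] := boolP (b ^ i %| k.+1); last first.
  apply/negbTE; apply: contra h; apply: dvdn_trans; exact: dvdn_exp2l.
have -> : (b ^ i.+1 %| k.+1) = (dig b k.+1 i == 0).
  by rewrite /dig -[RHS]/(b %| k.+1 %/ b ^ i) dvdn_divRL // -expnS.
rewrite dig_succ // h; case: ltnP => //.
Qed.

Section Search.
Variables (R : realType) (n : nat).
Notation V := 'I_n.+1.
Implicit Types (s : state R) (M : V -> V -> nat).
Variable cs : {set V} -> \bar R.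
Let cm (x a : V) := cs [set x; a].

Lemma ROWS_spec s : nmem s 0 0 = n.+1 -> forall i : V, nmem (cev ROWS s) 4 i = i * n.+1.
Proof.
move=> n0; rewrite /ROWS cev_seq; set s1 := cev (set_reg 40 _) s.
apply: (forV_inv (n := n)
  (I := fun k s' => nmem s' 40 0 = k * n.+1 /\ forall i : V, i < k -> nmem s' 4 i = i * n.+1)
  (Q := fun s' => forall i : V, nmem s' 4 i = i * n.+1)) => //.
- move=> k s' hn _ [h40 h4]; set s2 := setn 31 k s'.
  rewrite cev_seq; set s3 := cev (CN 4 _ _) s2.
  have n2 : nmem s2 0 0 = n.+1 by rewrite -n0; apply: hn.
  have e31 : nmem s2 31 0 = k by apply: setn_eq.
  split.
    rewrite /incr cev_set_eq -[LHS]/(nmem s' 40 0 + nmem s2 0 0) h40 n2 mulSn addnC //.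
  move=> i; rewrite ltnS leq_eqVlt /incr cev_set_neq // cevN.
  rewrite -[neval s2 (reg 31)]/(nmem s2 31 0) e31 -[neval s2 (reg 40)]/(nmem s' 40 0) h40 -[4 == 4]/true andTb.
  by case: eqP => [->|_ /= /h4].
- by move=> s' _ _ [_ h] i; apply: h.
Qed.

Lemma TIMES_spec p s : nmem s 0 1 = p -> nmem (cev TIMES s) 41 0 = (2 * p).+1 * nmem s 41 0.
Proof.
move=> hp; rewrite /TIMES 3!cev_cons cev_nil cev_set_eq; set s1 := cev (set_reg 44 _) s.
rewrite -[LHS]/(nmem (cev (CFor 45 np (incr 44 (NAdd (reg 41) (reg 41)))) s1) 44 0).
apply: (for_inv (I := fun k s' => nmem s' 44 0 = (2 * k).+1 * nmem s 41 0)
   (Q := fun s' => nmem s' 44 0 = (2 * p).+1 * nmem s 41 0)).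
- by rewrite cev_set_eq mul1n.
- move=> k s' _ hn _ h; rewrite /incr cev_set_eq.
  rewrite -[LHS]/(nmem s' 44 0 + (nmem s' 41 0 + nmem s' 41 0)) h.
  have -> : nmem s' 41 0 = nmem s 41 0 by rewrite hn.
  by rewrite mulnS !mulSn; lia.
- by move=> s' _ _; rewrite -[neval s1 np]/(nmem s 0 1) hp.
Qed.

Lemma POWER_spec p s : nmem s 0 1 = p -> nmem (cev POWER s) 41 0 = (2 * p).+1 ^ (10 * p).
Proof.
move=> hp; rewrite /POWER cev_seq; set s1 := cev (set_reg 41 _) s.
apply: (for_inv (I := fun k s' => nmem s' 41 0 = (2 * p).+1 ^ (10 * k))
   (Q := fun s' => nmem s' 41 0 = (2 * p).+1 ^ (10 * p))).
- by rewrite cev_set_eq.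
- move=> k s' _ hn _ h.
  apply: (for_inv (I := fun l s'' => nmem s'' 41 0 = (2 * p).+1 ^ (10 * k + l))
   (Q := fun s'' => nmem s'' 41 0 = (2 * p).+1 ^ (10 * k.+1))).
  + by rewrite addn0.
  + move=> l s'' _ hn2 _ h2; rewrite (@TIMES_spec p).
      by rewrite addnS expnS -h2.
    by rewrite setnE // hn2 // setnE // hn // -hp.
  + by move=> s'' _ _ h2; rewrite mulnS addnC.
- by move=> s' _ _; rewrite -[neval s1 np]/(nmem s 0 1) hp.
Qed.

Definition odigits p k s := forall i, i < 10 * p -> nmem s 18 i = dig (2 * p).+1 k i.

Lemma NEXT_spec p k s : nmem s 0 1 = p -> odigits p k s -> odigits p k.+1 (cev NEXT s).
Proof.
move=> hp hd; rewrite /NEXT 3!cev_cons cev_nil; set s2 := cev (set_reg 52 _) _.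
pose b := (2 * p).+1.
(* Digits below [i] are already those of [k.+1], the others still those of [k]; register 52 is the
   carry into position [i]. *)
pose I i s' := [/\ nmem s' 51 0 = i, nmem s' 52 0 = (b ^ i %| k.+1) &
   forall l, l < 10 * p -> nmem s' 18 l = if l < i then dig b k.+1 l else dig b k l].
have body s' i : i < 10 * p -> nmem s' 0 1 = p -> I i s' -> I i.+1 (cev NEXT_DIGIT s').
  move=> ip hp' [h1 h2 h3].
  have h18 : nmem s' 18 (nmem s' 51 0) = dig b k i by rewrite h1 h3 // ltnn.
  have old s'' : (forall l, l != i -> nmem s'' 18 l = nmem s' 18 l) -> nmem s'' 18 i = dig b k.+1 i ->
      forall l, l < 10 * p -> nmem s'' 18 l = if l < i.+1 then dig b k.+1 l else dig b k l.
    move=> e1 e2 l lp; have [->|li] := eqVneq l i; first by rewrite ltnSn.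
    by rewrite e1 // h3 // ltnS [l <= i]leq_eqVlt (negbTE li).
  rewrite /NEXT_DIGIT cev_seq; set s3 := cev (CIf _ _ _) s'.
  suff [q1 q2 q3] : [/\ nmem s3 51 0 = i, nmem s3 52 0 = (b ^ i.+1 %| k.+1) &
      forall l, l < 10 * p -> nmem s3 18 l = if l < i.+1 then dig b k.+1 l else dig b k l].
    split.
    - by rewrite /incr cev_set_eq -[LHS]/(nmem s3 51 0 + 1) q1 addn1.
    - by rewrite /incr cev_set_neq.
    - by move=> l lp; rewrite /incr cev_set_neq // q3.
  have b0 : 0 < b by [].
  have D := dig_succ k i b0; have D2 := dvd_succ k i b0.
  have lt : ((dig b k i).+1 < b) = (dig b k i + 1 <= p + p).
    by rewrite /b ltnS addn1 mul2n addnn.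
  split; first by rewrite nframe.
    rewrite /s3 cevIf -[beval _ _]/(0 < nmem s' 52 0) h2 D2.
    case: (b ^ i %| k.+1) h2 => h2; last exact: h2.
    rewrite cevIf -[beval _ _]/(nmem s' 18 (nmem s' 51 0) + 1 <= nmem s' 0 1 + nmem s' 0 1).
    rewrite h18 hp' -lt andTb -[0 < true]/true; case: ifP => _; last by rewrite nframe.
    by rewrite cev_seq cev_set_eq.
  rewrite /s3 cevIf -[beval _ _]/(0 < nmem s' 52 0) h2.
  case: (b ^ i %| k.+1) D h2 => D h2; last first.
    by apply: old => //; rewrite cev_skip D -h18 h1.
  rewrite -[0 < true]/true cevIf -[beval _ _]/(nmem s' 18 (nmem s' 51 0) + 1 <= nmem s' 0 1 + nmem s' 0 1).
  rewrite h18 hp' -lt; apply: old.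
    move=> l li; case: ifP => _; rewrite ?cev_seq ?cev_set_neq // cevN -[neval _ _]/(nmem s' 51 0) h1;
      by rewrite (negbTE li) andbF.
  rewrite D; case: ifP => _; rewrite ?cev_seq ?cev_set_neq // cevN -[neval _ (reg 51)]/(nmem s' 51 0) h1 !eqxx //.
  by rewrite -[LHS]/(nmem s' 18 (nmem s' 51 0) + 1) h18 addn1.
suff H s' : I (10 * p) s' -> odigits p k.+1 s'.
  apply: (for_inv (I := fun t s' => I (10 * t) s') (Q := odigits p k.+1)).
  - by rewrite muln0; split=> [||l /hd] //; rewrite expn0 dvd1n.
  - move=> t s' tp hn _ It.
    have tp' : t < p by rewrite -hp.
    apply: (for_inv (I := fun l s'' => I (10 * t + l) s'') (Q := I (10 * t.+1))).
    + by rewrite addn0; case: It => i1 i2 i3; split=> // [|||l lp]; rewrite setnE // i3.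
    + move=> l s'' l10 hn2 _ [i1 i2 i3]; rewrite addnS; apply: body.
      * by rewrite -[neval _ _]/10 in l10; lia.
      * rewrite setnE // hn2 // setnE // hn // -hp //.
      * by split=> // [|||m mp]; rewrite setnE // i3.
    + move=> s'' _ _; rewrite -[neval _ _]/10 mulnS addnC => -[i1 i2 i3].
      by split=> // [|||m mp]; rewrite setnE // i3.
  - move=> s' _ _; rewrite -[neval s2 np]/(nmem s 0 1) hp => -[i1 i2 i3].
    by apply: H; split=> // [|||m mp]; rewrite setnE // i3.
by move=> [_ _ h] i ip; rewrite h // ip.
Qed.

End Search.

Section Best.
Variables (R : realType) (n : nat).
Notation V := 'I_n.+1.
Implicit Types (s : state R) (M : V -> V -> nat) (F : {set {set V}}).
Variable cs : {set V} -> \bar R.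
Let cm (x a : V) := cs [set x; a].

Lemma FILL_spec s a e (f : V -> V -> nat) : nmem s 0 0 = n.+1 ->
  (forall i : V, nmem s 4 i = i * n.+1) -> a \notin [:: 0; 4; 48; 49] ->
  (forall (i j : V) s', unchanged [:: 48; 49; a] s s' -> nmem s' 48 0 = i -> nmem s' 49 0 = j ->
    neval s' e = f i j) ->
  forall i j : V, nmem (cev (FILL a e) s) a (pos i j) = f i j.
Proof.
move=> n0 h4 ha he.
have wa c : c \in [:: 0; 4; 48; 49] -> (c == a) = false.
  by move=> hc; apply/negbTE; apply: contraNneq ha => <-.
apply: (forV_inv (n := n) (I := fun k s' => forall i j : V, i < k -> nmem s' a (pos i j) = f i j)
  (Q := fun s' => forall i j : V, nmem s' a (pos i j) = f i j)) => //.
- move=> k s' hn _ h; set s2 := setn 48 k s'.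
  have u2 : unchanged [:: 48; 49; a] s s2.
    move=> b j hb; rewrite setnE; last by move: hb; rewrite inE negb_or => /andP [].
    by apply: hn; apply: (notin_sub hb); rewrite /= !inE !eqxx ?orbT.
  apply: (forV_inv (n := n) (I := fun l s' => forall i j : V, (i < k) || ((i == k) && (j < l)) ->
       nmem s' a (pos i j) = f i j)
     (Q := fun s' => forall i j : V, i < k.+1 -> nmem s' a (pos i j) = f i j)).
  + by rewrite u2 // !inE /= wa.
  + move=> i j; rewrite ltn0 andbF orbF => ik.
    by rewrite setnE 1?eq_sym ?wa //; apply: h.
  + move=> l s3 hn3 _ h3 i j; set s4 := setn 49 l s3.
    have u4 : unchanged [:: 48; 49; a] s s4.
      move=> b m hb; have hb' : b \notin [:: 49; a] by apply: (notin_sub hb); rewrite /= !inE !eqxx ?orbT.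
      rewrite setnE; last by move: hb'; rewrite inE negb_or => /andP [].
      by rewrite hn3 //; exact: u2.
    have e48 : nmem s4 48 0 = k by rewrite setnE // hn3 ?setn_eq // !inE /= wa.
    have e49 : nmem s4 49 0 = l by apply: setn_eq.
    have e4 : nmem s4 4 k = k * n.+1 by rewrite u4 ?h4 // !inE /= wa.
    rewrite cevN eqxx andTb -[neval _ (cell _ _)]/(nmem s4 4 (nmem s4 48 0) + nmem s4 49 0).
    rewrite e48 e49 e4 -/(pos k l) pos_eq (he k l) //.
    case: (boolP ((i == k) && (j == l))) => [/andP [/eqP -> /eqP ->] //|nij] hij.
    rewrite setnE 1?eq_sym ?wa //; apply: h3.
    case/orP: hij => [-> //|/andP [ik]]; rewrite ltnS leq_eqVlt => /orP [jl|jl]; first by rewrite ik -val_eqE jl in nij.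
    by rewrite ik jl orbT.
  + move=> s3 _ _ h3 i j; rewrite ltnS [i <= k]leq_eqVlt => ik.
    rewrite setnE 1?eq_sym ?wa //; apply: h3.
    by rewrite ltn_ord andbT orbC.
- by move=> s' _ _ h i j; rewrite setnE 1?eq_sym ?wa //; apply: h.
Qed.

Definition loaded M0 p s :=
  [/\ nmem s 0 0 = n.+1, nmem s 0 1 = p, forall i : V, nmem s 4 i = i * n.+1,
      forall i j, nmem s 1 (pos i j) = M0 i j & forall i j, rmem s 0 (pos i j) = cm i j].

Lemma loaded_unchanged ws rws M0 p s s' :
  all (fun a => a \notin ws) [:: 0; 1; 4] -> 0 \notin rws ->
  unchanged ws s s' -> runchanged rws s s' -> loaded M0 p s -> loaded M0 p s'.
Proof.
move=> /allP wn wr hn hr [h1 h2 h3 h4 h5]; split.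
- by rewrite hn // wn.
- by rewrite hn // wn.
- by move=> i; rewrite hn // wn.
- by move=> i j; rewrite hn // wn.
- by move=> i j; rewrite hr.
Qed.

Lemma RESET_spec M0 p s : loaded M0 p s ->
  holds cs M0 p finset.set0 (cev RESET s) /\ nmem (cev RESET s) 39 0 = 0.
Proof.
move=> [h0 hp h4 h1 hc]; rewrite /RESET 4!cev_cons cev_nil.
split; last by rewrite cev_set_eq.
set s1 := cev (FILL 5 _) s; set s2 := cev (FILL 6 _) s1; set s3 := cev (CR _ _ _) s2.
have e5 i j : nmem s1 5 (pos i j) = M0 i j.
  apply: FILL_spec => // k l s' hu e48 e49.
  rewrite -[LHS]/(nmem s' 1 (nmem s' 4 (nmem s' 48 0) + nmem s' 49 0)) e48 e49.
  by rewrite hu // hu // h4 -/(pos k l) h1.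
have e6 (i j : V) : nmem s2 6 (pos i j) = 0.
  by apply: (@FILL_spec s1 6 (NLit 0) (fun _ _ => 0) _ _ _ _ i j) => // [|k]; rewrite nframe.
split.
- split=> [|i|i j]; rewrite cev_set_neq // -[LHS]/(nmem s2 _ _) nframe //; first by rewrite nframe.
    by rewrite nframe // h4.
  by rewrite e5 /multF inE addn0.
- by rewrite cev_set_neq // -[LHS]/(nmem s2 _ _) !nframe.
- by move=> i j; rewrite cev_set_neq // -[LHS]/(nmem s2 _ _) e6 /inF inE.
- by move=> i j; rewrite rframe // rframe // rframe // rframe.
- by rewrite /ctot finset.big_set0.
Qed.

Lemma STEPS_spec M0 p d s : holds cs M0 p finset.set0 s -> nmem s 39 0 = 0 ->
  (forall i, i < 10 * p -> nmem s 18 i = d i) ->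
  holds cs M0 p (run cm p M0 d p finset.set0) (cev STEPS s).
Proof.
move=> hs h39 hd; have hp : nmem s 0 1 = p by case: hs.
apply: (for_inv (I := fun t s' => holds cs M0 p (run cm p M0 d t finset.set0) s' /\ nmem s' 39 0 = 10 * t)
  (Q := fun s' => holds cs M0 p (run cm p M0 d p finset.set0) s')).
- by rewrite muln0.
- move=> t s'; rewrite -[neval s np]/(nmem s 0 1) hp => tp hn hr [h e].
  rewrite cev_seq; set s2 := setn 47 t s'.
  have u2 : unchanged [:: 47] s' s2 by move=> b j; rewrite inE => /setnE ->.
  have h2 : holds cs M0 p (run cm p M0 d t finset.set0) s2.
    by apply: (holds_unchanged (rws := [::]) _ _ u2) h.
  have d2 : digits s2 (fun i => d (10 * t + i)).
    move=> k k10; rewrite -[LHS]/(nmem s2 18 (nmem s2 39 0 + k)) u2 // u2 // e.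
    rewrite hn // hd //; move: tp k10; clear; lia.
  split; first by apply: holds_cev (STEP_spec h2 d2).
  by rewrite /incr cev_set_eq -[LHS]/(nmem (cev STEP s2) 39 0 + 10) nframe // u2 // e mulnS addnC.
- move=> s' hn hr; rewrite -[neval s np]/(nmem s 0 1) hp => -[h _].
  apply: (holds_unchanged (ws := [:: 47]) (rws := [::])) h => //.
  by move=> b j; rewrite inE => /setnE ->.
Qed.

Definition okF M0 F := [forall v, covm (multF M0 F) ord0 v ord0 ord0].

Lemma CHECK_spec M0 p F s : holds cs M0 p F s -> nmem (cev CHECK s) 50 0 = okF M0 F.
Proof.
move=> hs; rewrite /CHECK; rewrite 3!cev_cons; set s1 := cev (set_reg 26 _) _.
have u1 : unchanged [:: 27; 25; 26] s s1.
  by move=> b j; rewrite !inE !negb_or => /and3P [k1 k2 k3]; rewrite !cev_set_neq.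
have c1 : ctx (multF M0 F) s1 by case: hs => c _ _ _ _; apply: ctx_unchanged u1 c.
have cv := @COVER_spec R n _ s1 ord0 ord0 ord0 c1 erefl erefl erefl.
rewrite 2!cev_cons; set s2 := cev COVER s1 in cv *; set s3 := cev (set_reg 50 _) s2.
have c3 : ctx (multF M0 F) s3 by apply: ctx_cev => //; apply: ctx_cev c1.
have e3 (v : V) : nmem s3 8 v = covm (multF M0 F) ord0 v ord0 ord0 by rewrite cev_set_neq.
have -> : okF M0 F = all (fun v => covm (multF M0 F) ord0 v ord0 ord0) (enum V).
  by apply/forallP/allP => [h y _|h y]; apply: h; rewrite ?mem_enum.
rewrite all_foldl cev_cons cev_nil.
apply: (forV_fold (n := n) (Rel := fun s' (b : bool) => nmem s' 50 0 = b)).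
- by case: c3.
- by rewrite cev_set_eq.
- move=> v s' b hn _ e; rewrite cevIf; set s4 := setn 31 v s'.
  have -> : beval s4 (NLe (NGet 8 (reg 31)) (NLit 0)) = ~~ covm (multF M0 F) ord0 v ord0 ord0.
    rewrite -[LHS]/(nmem s4 8 (nmem s4 31 0) <= 0) setn_eq setnE // hn // e3.
    by case: covm.
  by rewrite if_neg; case: ifP => _; [exact: e|rewrite cev_set_eq].
- by move=> s' b; rewrite setnE.
Qed.

Definition best_of M0 (Fs : seq {set {set V}}) s :=
  if nmem s 2 0 is 0 then forall F, F \in Fs -> ~~ okF M0 F
  else nmem s 2 0 = 1 /\ exists F, [/\ F \in Fs, okF M0 F, rmem s 5 0 = ctot cs F,
    forall i j, nmem s 3 (pos i j) = inF F i j &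
    forall F', F' \in Fs -> okF M0 F' -> (ctot cs F <= ctot cs F')%E].

Lemma best_of_unchanged ws rws M0 Fs s s' :
  (2 \notin ws) && (3 \notin ws) -> 5 \notin rws -> unchanged ws s s' -> runchanged rws s s' ->
  best_of M0 Fs s -> best_of M0 Fs s'.
Proof.
move=> /andP [w2 w3] r5 hn hr; rewrite /best_of hn //.
case: (nmem s 2 0) => // m [-> [F [f1 f2 f3 f4 f5]]]; split=> //; exists F; split=> //.
  by rewrite hr.
by move=> i j; rewrite hn.
Qed.

Lemma SAVE_spec M0 p Fs F s : holds cs M0 p F s -> nmem s 50 0 = okF M0 F ->
  best_of M0 Fs s -> best_of M0 (rcons Fs F) (cev SAVE s).
Proof.
move=> [[h0 h4 _] _ h6 _ h3] h50 hb; rewrite /SAVE cevIf.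
have -> : beval s (BAnd (NLe (NLit 1) (reg 50))
        (bor (NLe (reg 2) (NLit 0)) (BNot (RLe (RGet 5 (NLit 0)) (RGet 3 (NLit 0)))))) =
   okF M0 F && ((nmem s 2 0 == 0) || ~~ (rmem s 5 0 <= ctot cs F)%E).
  rewrite -[LHS]/((0 < nmem s 50 0) && ~~ (~~ (nmem s 2 0 <= 0) && ~~ ~~ (rmem s 5 0 <= rmem s 3 0)%E)).
  by rewrite h50 h3 negb_and !negbK leqn0; case: (okF M0 F).
case: ifP => [/andP [ok t]|t].
  rewrite 3!cev_cons cev_nil; set s2 := cev (CR _ _ _) _; set s3 := cev (FILL _ _) s2.
  have e2 : nmem s3 2 0 = 1 by rewrite nframe.
  have e5 : rmem s3 5 0 = ctot cs F by rewrite rframe // -h3.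
  have e3 i j : nmem s3 3 (pos i j) = inF F i j.
    apply: (@FILL_spec s2 3 _ (fun i j => nat_of_bool (inF F i j))) => // k l s' hu e48 e49.
    rewrite -[LHS]/(nmem s' 6 (nmem s' 4 (nmem s' 48 0) + nmem s' 49 0)) e48 e49.
    rewrite hu // hu // -[nmem s2 4 k]/(nmem s 4 k) h4 -/(pos k l) -[LHS]/(nmem s 6 (pos k l)).
    exact: h6.
  rewrite /best_of e2; split=> //; exists F; split=> //; first by rewrite mem_rcons mem_head.
  move=> F'; rewrite mem_rcons inE => /orP [/eqP -> //|F'Fs] ok'.
  move: hb t; rewrite /best_of; case: (nmem s 2 0) => [/(_ F' F'Fs)|m [_ [F0 [f1 f2 f3 f4 f5]]]].
    by rewrite ok'.
  by rewrite f3 -ltNge /= => lt; apply: le_trans (ltW lt) (f5 _ F'Fs ok').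
move: hb; rewrite cev_skip /best_of; case m2: (nmem s 2 0) => [|m].
  move=> h F'; rewrite mem_rcons inE => /orP [/eqP ->|/h //].
  by move: t; rewrite m2 eqxx orTb andbT => ->.
move=> [m1 [F0 [f1 f2 f3 f4 f5]]]; split=> //; exists F0; split=> //.
  by rewrite mem_rcons inE f1 orbT.
move=> F'; rewrite mem_rcons inE => /orP [/eqP ->|/f5 //] ok.
by move: t; rewrite ok m2 /= f3 => /negbFE.
Qed.

Definition attempts p M0 k := [seq run cm p M0 (dig (2 * p).+1 j) p finset.set0 | j <- iota 0 k].

Lemma best_of_cev M0 Fs P s : (2 \notin nwrites P) && (3 \notin nwrites P) -> 5 \notin rwrites P ->
  best_of M0 Fs s -> best_of M0 Fs (cev P s).
Proof.
move=> w r; apply: best_of_unchanged w r _ _; first exact: unchanged_cev.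
by move=> a j; exact: rframe.
Qed.

Lemma odigits_cev p k P s : 18 \notin nwrites P -> odigits p k s -> odigits p k (cev P s).
Proof. by move=> w hd i ip; rewrite nframe // hd. Qed.

Lemma attemptsS p M0 k : attempts p M0 k.+1 =
  rcons (attempts p M0 k) (run cm p M0 (dig (2 * p).+1 k) p finset.set0).
Proof. by rewrite /attempts -[k.+1]addn1 iotaD map_cat cats1 add0n. Qed.

Lemma ATTEMPT_spec M0 p k s : loaded M0 p s -> odigits p k s -> best_of M0 (attempts p M0 k) s ->
  odigits p k.+1 (cev ATTEMPT s) /\ best_of M0 (attempts p M0 k.+1) (cev ATTEMPT s).
Proof.
move=> hl hd hb; rewrite /ATTEMPT.
have [h1 h39] := RESET_spec hl; have b1 := best_of_cev (P := RESET) isT isT hb.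
have d1 := odigits_cev (P := RESET) isT hd.
rewrite cev_cons; move: (cev RESET s) h1 h39 b1 d1 => s1 h1 h39 b1 d1.
have h2 := STEPS_spec h1 h39 d1; have b2 := best_of_cev (P := STEPS) isT isT b1.
have d2 := odigits_cev (P := STEPS) isT d1.
rewrite cev_cons; move: (cev STEPS s1) h2 b2 d2 => s2 h2 b2 d2.
have h50 := CHECK_spec h2; have h3 := holds_cev (P := CHECK) isT isT h2.
have b3 := best_of_cev (P := CHECK) isT isT b2; have d3 := odigits_cev (P := CHECK) isT d2.
rewrite cev_cons; move: (cev CHECK s2) h50 h3 b3 d3 => s3 h50 h3 b3 d3.
have b4 := SAVE_spec h3 h50 b3; have d4 := odigits_cev (P := SAVE) isT d3.
have [_ p4 _ _ _] := holds_cev (P := SAVE) isT isT h3.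
rewrite cev_cons; move: (cev SAVE s3) b4 d4 p4 => s4 b4 d4 p4.
rewrite cev_cons cev_nil attemptsS; split; first exact: NEXT_spec.
exact: (best_of_cev (P := NEXT) isT isT b4).
Qed.

Lemma SEARCH_spec M0 p s : loaded M0 p s -> (forall i, nmem s 18 i = 0) -> nmem s 2 0 = 0 ->
  best_of M0 (attempts p M0 (nmem s 41 0)) (cev SEARCH s).
Proof.
move=> hl h18 h2.
apply: (for_inv (I := fun k s' => odigits p k s' /\ best_of M0 (attempts p M0 k) s')
  (Q := fun s' => best_of M0 (attempts p M0 (nmem s 41 0)) s')).
- split; first by move=> i _; rewrite h18 dig0.
  by rewrite /best_of h2.
- move=> k s' _ hn hr [hd hb]; apply: ATTEMPT_spec.
  + apply: (loaded_unchanged (ws := 46 :: nwrites ATTEMPT) (rws := rwrites ATTEMPT)) hl => //.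
    move=> b j hb'; rewrite setnE; last by move: hb'; rewrite inE negb_or => /andP [].
    exact: hn.
  + by move=> i ip; rewrite setnE // hd.
  + apply: (best_of_unchanged (ws := [:: 46]) (rws := [::])) hb => //.
    by move=> b j; rewrite inE => /setnE ->.
- move=> s' _ _ [_ hb]; apply: (best_of_unchanged (ws := [:: 46]) (rws := [::])) hb => //.
  by move=> b j; rewrite inE => /setnE ->.
Qed.

Lemma SETUP_spec M0 p s : nmem s 0 0 = n.+1 -> nmem s 0 1 = p ->
  (forall i j, nmem s 1 (pos i j) = M0 i j) -> (forall i j, rmem s 0 (pos i j) = cm i j) ->
  loaded M0 p (cev SETUP s) /\ nmem (cev SETUP s) 41 0 = (2 * p).+1 ^ (10 * p).
Proof.
move=> h0 hp h1 hc; split; last by rewrite /SETUP cev_seq; apply: POWER_spec; rewrite nframe.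
split=> [||i|i j|i j]; rewrite ?rframe //; last by rewrite nframe.
- by rewrite nframe.
- by rewrite nframe.
- by rewrite /SETUP cev_seq nframe //; apply: ROWS_spec.
Qed.

End Best.

(** * Correctness and running time *)

Section Multigraphs.
Variable V : finType.
Implicit Types (X : {set V}) (H : multigraph V).

Lemma ends_pair H (e : edge H) : exists x y, ends e = [set x; y].
Proof.
have /andP [] := ends_card e; rewrite leq_eqVlt => /orP [|/card_gt1P [a [b [fa fb ab]]] f2].
  by rewrite eq_sym => /cards1P [a ->] _; exists a, a; rewrite finset.setUid.
exists a, b; apply/esym/eqP; rewrite eqEcard finset.cards2 ab f2 andbT.
by apply/fintype.subsetP => z; rewrite !inE => /orP [] /eqP ->.
Qed.

(** Deleting the edges of a cut left by at most one edge disconnects the graph; conversely, after a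
    deletion, the set reached from a vertex is left by deleted edges only. *)
Lemma edge_connected2 H : edge_connected 2 H <->
  forall X, X != finset.set0 -> X != finset.setT -> 1 < #|[set e : edge H | crs X (ends e)]|.
Proof.
split=> [h X X0 XT|h Y Y2 x y].
  rewrite ltnNge; apply/negP => c.
  have {h} := h [set e : edge H | crs X (ends e)] c.
  have [u uX] := finset.set0Pn _ X0.
  have [v vX] : exists v, v \notin X.
    apply/existsP; rewrite -negb_forall; apply: contra XT => /forallP k.
    by apply/eqP/finset.setP => v; rewrite inE k.
  move=> /(_ u v); set e := (X in connect X) => cuv.
  have cl : fingraph.closed e (mem X).
    move=> a b /existsP [f /andP [nf /eqP fE]]; move: nf; rewrite inE fE crsE /cr /=.
    by case: (a \in X); case: (b \in X).
  by have := closed_connect cl cuv; rewrite uX (negbTE vX).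
set e := (X in connect X); apply/negPn/negP => nc.
have X0 : [set z | connect e x z] != finset.set0.
  by apply/finset.set0Pn; exists x; rewrite inE connect0.
have XT : [set z | connect e x z] != finset.setT.
  by apply/negP => /eqP/finset.setP /(_ y); rewrite !inE (negbTE nc).
have := h _ X0 XT; rewrite ltnNge => /negP; apply.
apply: leq_trans (_ : #|Y| <= 1) => //.
apply/subset_leq_card/fintype.subsetP => f; rewrite inE => cf.
apply/negPn/negP => fY.
have [a [b fE]] := ends_pair f.
have ab : e a b by apply/existsP; exists f; rewrite fY fE eqxx.
have ba : e b a by apply/existsP; exists f; rewrite fY fE finset.setUC eqxx.
move: cf; rewrite fE crsE /cr !inE /=.
case ca: (connect e x a); case cb: (connect e x b) => //.
  by rewrite (connect_trans ca (connect1 ab)) in cb.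
by rewrite (connect_trans cb (connect1 ba)) in ca.
Qed.

Lemma card_augment (G : multigraph V) (F : {set pair_of V}) X :
  #|[set e : edge (augment G F) | crs X (ends e)]| =
  #|[set e : edge G | crs X (ends e)]| + ncr (val @: F) X.
Proof.
rewrite ncrE big_imset => [|f g _ _]; last exact: val_inj.
have card_sum (T : finType) (P : pred T) : #|[set e | P e]| = \sum_e P e.
  by rewrite cardsE -sum1_card big_mkcond; apply: eq_bigr => e _; rewrite unfold_in; case: (P e).
by rewrite !card_sum big_sumType [in RHS]big_sub.
Qed.

(** The list fixes an order and an orientation; a loop becomes a pair [(x, x)], which crosses no
    cut. *)
Lemma edges_exist (G : multigraph V) : exists2 E : seq (V * V),
  mult E = (fun i j => #|[set e : edge G | ends e == [set i; j]]|) &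
  forall X, bdry E X = #|[set e : edge G | crs X (ends e)]|.
Proof.
have [|E hE] := @mk_seq V (map (@ends V G) (enum (edge G))).
  by move=> f /mapP [e _ ->]; exact: ends_pair.
exists E.
  apply/funext => i; apply/funext => j.
  have -> : mult E i j = count_mem [set i; j] (map (@mk V) E).
    by rewrite count_map; apply: eq_count => e /=; rewrite eqp_mk.
  rewrite hE count_map -sum1_count big_enum_cond -sum1_card /=.
  by apply: eq_bigl => e; rewrite inE.
move=> X; rewrite bdry_mk hE big_map big_enum /= -sum1_card [RHS]big_mkcond.
by apply: eq_bigr => e _; rewrite inE; case: crs.
Qed.

End Multigraphs.

Definition MAIN := CSeq SETUP SEARCH.

Section Solution.
Variables (R : realType) (m : nat).
Notation n := m.+1.
Notation V := 'I_n.
Variables (G : multigraph V) (p : nat) (c : pair_of V -> \bar R).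
Hypothesis c_ge0 : forall f, (0 <= c f)%E.

Definition set_cost (f : {set V}) : \bar R := if insub f is Some g then c g else 0%E.

Lemma set_cost_ge0 f : (0 <= set_cost f)%E.
Proof. by rewrite /set_cost; case: insub. Qed.

Lemma flat_pos T (z : T) (M : V -> V -> T) (i j : V) : flat z M (pos i j) = M i j.
Proof.
rewrite /flat /pos divnMDl // modnMDl divn_small // modn_small // addn0.
by rewrite (valK i) (valK j).
Qed.

Definition links (F : {set pair_of V}) : {set {set V}} := val @: F.

Lemma links2 F f : f \in links F -> #|f| = 2.
Proof. by move=> /imsetP [g _ ->]; exact: (eqP (valP g)). Qed.

Lemma card_links F : #|links F| = #|F|.
Proof. by rewrite card_imset //; exact: val_inj. Qed.

Lemma total_cost_links F : total_cost c F = ctot set_cost (links F).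
Proof.
rewrite /ctot big_imset => [|f g _ _]; last exact: val_inj.
by apply: eq_bigr => f _; rewrite /set_cost valK.
Qed.

Lemma links_onto (U : {set {set V}}) : (forall f, f \in U -> #|f| = 2) ->
  exists F, links F = U.
Proof.
move=> U2; exists [set g | val g \in U]; apply/finset.setP => f; apply/imsetP/idP.
  by case=> g; rewrite inE => gU ->.
move=> fU; have f2 : #|f| == 2 by rewrite U2.
by exists (Sub f f2); rewrite ?inE SubK.
Qed.

Lemma feasible_isplit E : (forall X, bdry E X = #|[set e : edge G | crs X (ends e)]|) ->
  forall F, feasible G p F <-> #|links F| <= p /\ isplit E (links F).
Proof.
move=> hE F; rewrite card_links /feasible edge_connected2.
split=> -[h1 h2]; split=> // X X0 XT; have := h2 X X0 XT; by rewrite card_augment hE.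
Qed.

Lemma okFE (E : seq (V * V)) (F : {set {set V}}) : (forall f, f \in F -> #|f| = 2) -> okF (mult E) F <-> isplit E F.
Proof.
move=> F2; have [E' mE bE] := commit_list E F2; rewrite /okF -mE -tec_cover.
split=> [/tecP h|h]; last apply/tecP; move=> X X0 XT; have := h X X0 XT; by rewrite bE.
Qed.

Lemma best_correct E s : mult E = multiplicity G ->
  (forall X, bdry E X = #|[set e : edge G | crs X (ends e)]|) ->
  best_of set_cost (mult E) (attempts set_cost p (mult E) ((2 * p).+1 ^ (10 * p))) s ->
  correct_output G p c s.
Proof.
move=> mE bE hb; have fE := feasible_isplit bE.
pose cm (x a : V) := set_cost [set x; a].
have found F : feasible G p F -> exists F', [/\ F' \in attempts set_cost p (mult E) ((2 * p).+1 ^ (10 * p)),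
    okF (mult E) F' & (ctot set_cost F' <= ctot set_cost (links F))%E].
  move=> /fE [cF sF]; have [d [dp [sd cd]]] := run_complete set_cost_ge0 cF (@links2 F) sF.
  (* The good digits are at most [2 * p], so they are the base [(2 * p).+1] digits of the number of
     some attempt. *)
  have [i|k kB hk] := @dig_surj (2 * p).+1 d (10 * p); first by rewrite ltnS.
  exists (run cm p (mult E) d p finset.set0); split=> //.
    apply/mapP; exists k; first by rewrite mem_iota.
    by apply: run_eq => i ip; rewrite hk.
  by apply/okFE => //; case: (@run_sound R m set_cost p (mult E) d p).
move: hb; rewrite /best_of; case h2: (nmem s 2 0) => [|k].
  move=> hn; split=> // -[F fF].
  by have [F' [F'a okF' _]] := found F fF; have := hn F' F'a; rewrite okF'.
move=> [k1 [F0 [F0a ok0 _ out0 min0]]]; rewrite /correct_output h2 k1.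
have [j _ F0E] := mapP F0a.
have [cF0 F02] := @run_sound R m set_cost p (mult E) (dig (2 * p).+1 j) p.
rewrite -F0E in cF0 F02.
have [F FE] := links_onto F02.
have fF : feasible G p F by apply/fE; rewrite FE; split=> //; apply/okFE.
split; last by case; exists F.
move=> _; split=> //; exists F.
  split=> // F' fF'; have [F'' [a ok le]] := found F' fF'.
  by rewrite !total_cost_links FE; apply: le_trans (min0 _ a ok) le.
move=> i l; rewrite -/(pos i l) out0 /inF -FE; congr (nat_of_bool _).
apply/imsetP/existsP => [[g gF gE]|[g /andP [gF /eqP gE]]].
  by exists g; rewrite gF gE eqxx.
by exists g.
Qed.

Lemma MAIN_correct : correct_output G p c (cev MAIN (input G p c)).
Proof.
have [E mE bE] := edges_exist G; apply: (@best_correct E _ mE bE).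
have [||hl h41] := @SETUP_spec R m set_cost (mult E) p (input G p c) erefl erefl.
- by move=> i j; rewrite mE -[LHS]/(flat 0 (multiplicity G) (pos i j)) flat_pos.
- by move=> i j; rewrite -[LHS]/(flat 0%E (cost_matrix c) (pos i j)) flat_pos.
rewrite /MAIN cev_seq -h41; apply: SEARCH_spec => //.
  by move=> i; rewrite nframe.
by rewrite nframe.
Qed.

(** Only the outermost loop has an exponential bound; it is handled by [runs_for], and
    [runs_compile] accounts for the setup and for each attempt. *)
Lemma MAIN_time : exists2 t, t <= (2 * p).+1 ^ (10 * p) *
    (n + p + 10) ^ (degree SETUP + degree ATTEMPT + 2) &
  runs (compile MAIN) (input G p c) t (cev MAIN (input G p c)).
Proof.
set N := n + p + 10.
have N10 : 10 <= N by rewrite /N leq_addl.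
have small0 : small N (input G p c).
  by rewrite /small -[nmem _ 0 0]/n -[nmem _ 0 1]/p /N -addnA leq_addr addnC -!addnA leq_addr.
have [t1 le1 r1] := @runs_compile R N N10 SETUP _ isT isT isT small0.
set s1 := cev SETUP _ in r1.
have small1 : small N s1 by rewrite /small !nframe.
have h41 : nmem s1 41 0 = (2 * p).+1 ^ (10 * p).
  by rewrite /s1 /SETUP cev_seq; apply: POWER_spec; rewrite nframe.
have [t2 le2 r2] := @runs_for R N 46 (reg 41) ATTEMPT s1 (N ^ degree ATTEMPT) isT isT small1
  (fun s' ss' => @runs_compile R N N10 ATTEMPT s' isT isT isT ss').
rewrite -[neval _ _]/(nmem s1 41 0) h41 in le2.
exists (t1 + t2).+1; last exact: runs_Seq r1 r2.
move: le1 le2; move: (degree SETUP) (degree ATTEMPT) => a b.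
have : 0 < (2 * p).+1 ^ (10 * p) by rewrite expn_gt0.
move: ((2 * p).+1 ^ (10 * p)) => B B0 le1 le2.
have Na : N ^ a <= N ^ (a + b) by rewrite leq_pexp2l ?leq_addr // (leq_trans _ N10).
have Nb : N ^ b <= N ^ (a + b) by rewrite leq_pexp2l ?leq_addl // (leq_trans _ N10).
have N0 : 0 < N ^ (a + b) by rewrite expn_gt0 (leq_trans _ N10).
(* Two spare exponents are worth a factor 100, which covers the constants of the outer loop. *)
have NN : 100 * N ^ (a + b) <= N ^ (a + b + 2).
  by rewrite [leqRHS]expnD [leqRHS]mulnC leq_mul //; exact: (leq_mul N10 N10).
apply: (@leq_trans (B * (100 * N ^ (a + b)))); last by rewrite leq_mul2l NN orbT.
apply: (@leq_trans (B * (N ^ a + 12 + (N ^ b + 15) + 1))).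
  rewrite !mulnDr; move: le1 le2; rewrite mulnDr.
  have : N ^ a <= B * N ^ a by rewrite leq_pmull.
  move: B0; clear; lia.
by rewrite leq_mul2l; apply/orP; right; move: Na Nb N0; clear; lia.
Qed.

End Solution.

(** * Arithmetic of the time bound *)

Lemma leq_wexp2r a b k : a <= b -> a ^ k <= b ^ k.
Proof. by move=> ab; case: k => // k; rewrite leq_exp2r. Qed.

Lemma nat_bound K : exists C, forall n p t, 0 < n ->
  t <= (2 * p).+1 ^ (10 * p) * (n + p + 10) ^ K ->
  t <= C * (if p <= 1 then 1 else p ^ (C * p)) * n ^ C.
Proof.
(* [3 ^ 10 * 12 ^ K] pays for [p <= 1], where the exponential factor is 1; [30] and [4 * K] come
   from the exponents for [p >= 2] below. *)
exists (3 ^ 10 * 12 ^ K + 4 * K + 30) => n p t n0 ht.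
have : 30 <= 3 ^ 10 * 12 ^ K + 4 * K + 30 by rewrite leq_addl.
have C1 : 3 ^ 10 * 12 ^ K <= 3 ^ 10 * 12 ^ K + 4 * K + 30 by rewrite -addnA leq_addr.
have C2 : 30 + 4 * K <= 3 ^ 10 * 12 ^ K + 4 * K + 30 by rewrite addnC leq_add2r leq_addl.
move: (3 ^ 10 * 12 ^ K + 4 * K + 30) C1 C2 => C C1 C2 C30.
have C0 : 0 < C by apply: leq_trans C30.
have KC : K <= C by move: C2; clear; lia.
have nC : n ^ K <= n ^ C by rewrite leq_pexp2l.
have nN : (n + p + 10) ^ K <= (p + 11) ^ K * n ^ K.
  rewrite -expnMn; apply: leq_wexp2r; move: n0; clear; nia.
apply: leq_trans ht _; apply: leq_trans (_ : (2 * p).+1 ^ (10 * p) * ((p + 11) ^ K * n ^ K) <= _).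
  by rewrite leq_mul2l nN orbT.
rewrite mulnA; apply: leq_mul nC; case: ifP => p1.
  rewrite muln1; apply: leq_trans C1; apply: leq_mul.
    by case: p p1 {nN} => [|[|]].
  by apply: leq_wexp2r; move: p1; clear; lia.
have p2 : 2 <= p by rewrite ltnNge p1.
have p0 : 0 < p by apply: leq_trans p2.
apply: (@leq_trans (p ^ (C * p))); last by rewrite leq_pmull.
(* For [p >= 2], [2 * p + 1 <= p ^ 3]. *)
have b1 : (2 * p).+1 ^ (10 * p) <= p ^ (30 * p).
  have -> : 30 * p = 3 * (10 * p) by rewrite mulnA.
  rewrite [leqRHS]expnM; apply: leq_wexp2r; rewrite !expnS expn0 muln1.
  by move: p2; clear; nia.
(* For [p >= 2], [p + 11 <= 8 * p <= p ^ 4]. *)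
have b2 : (p + 11) ^ K <= p ^ (4 * K).
  rewrite [leqRHS]expnM; apply: leq_wexp2r.
  apply: (@leq_trans (8 * p)); first by move: p2; clear; lia.
  by rewrite (expnSr p 3) leq_mul2r (@leq_exp2r 2 p 3) // p2 orbT.
apply: leq_trans (leq_mul b1 b2) _; rewrite -expnD leq_pexp2l //.
apply: (@leq_trans ((30 + 4 * K) * p)); last by rewrite leq_mul2r C2 orbT.
by rewrite mulnDl leq_add2l leq_pmulr.
Qed.

Lemma real_bound (R : realType) K : exists C, forall n p t, 0 < n ->
  t <= (2 * p).+1 ^ (10 * p) * (n + p + 10) ^ K ->
  (t%:R <= C%:R * 2 `^ (C%:R * (p%:R * log2 p%:R)) * n%:R ^+ C :> R)%R.
Proof.
have [C hC] := nat_bound K; exists C => n p t n0 /(hC _ _ _ n0) le.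
have -> : (2 `^ (C%:R * (p%:R * log2 p%:R)) = (if (p <= 1)%N then 1 else (p ^ (C * p))%N)%:R :> R)%R.
  case: ifP => p1.
    (* Since [ln 0] is 0 by convention, [p = 0] behaves like [p = 1]. *)
    have -> : (log2 p%:R = 0 :> R)%R.
      by rewrite /log2; case: p p1 {le} => [|[|]] // _; [rewrite ln0 //|rewrite ln1]; rewrite mul0r.
    by rewrite !mulr0 powRr0.
  have p0 : (0 < p%:R :> R)%R by rewrite ltr0n; case: (p) p1.
  have ln2 : (ln 2 != 0 :> R)%R by rewrite gt_eqF // ln_gt0 // ltr1n.
  rewrite natrX -powR_mulrn ?ltW // /powR !gt_eqF //=; congr expR.
  by rewrite /log2 natrM -!mulrA mulVf // mulr1.
by rewrite -natrX -!natrM ler_nat.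
Qed.

Theorem theorem4 (R : realType) :
  exists (A : prog) (C : nat),
    forall (n p : nat) (G : multigraph 'I_n) (c : pair_of 'I_n -> \bar R),
      (0 < n)%N ->
      (forall f, (0 <= c f)%E) ->
      exists (t : nat) (s : state R),
        runs A (input G p c) t s /\
        correct_output G p c s /\
        (t%:R <= C%:R * 2 `^ (C%:R * (p%:R * log2 p%:R)) * n%:R ^+ C :> R)%R.
Proof.
have [C hC] := real_bound R (degree SETUP + degree ATTEMPT + 2).
exists (compile MAIN), C => -[//|m] p G c n0 c_ge0.
have [t le rt] := MAIN_time G p c.
exists t, (cev MAIN (input G p c)); split=> //; split; last exact: hC.
exact: MAIN_correct.
Qed.
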